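(* Let $d\ge2$ and let $(y_n^* )_{n\ge1}$ be a bounded deterministic real sequence. Assume that $B$ has no zeros in $|z|\le1$, $\gcd(A-1,B)=1$, and at least one of $\deg(A-1)=p$ and $\deg B=q-1$ holds (with $\deg0=-\infty$). Assume also that, for a deterministic $\sigma^2>0$ and some $\nu>2$, almost surely, $$\mathbb E[w_{n+1}\mid\mathcal F_n]=0,\qquad \mathbb E[w_{n+1}^2\mid\mathcal F_n]=\sigma^2\quad(n\ge0),\qquad \sup_{n\ge0}\mathbb E[|w_{n+1}|^\nu\mid\mathcal F_n]<\infty.$$ Let $f_n$ be the auxiliary least-squares prediction defined in the context. For each fixed $0<\alpha<1$, put $c_\alpha=(d-1)\sigma^2(1-\alpha)/4$. Then, almost surely, $$\sum_{j=1}^{n-1}f_j^2\sim(d-1)\sigma^2\log n,$$ and, for all sufficiently large $n$, $$\sum_{j=\lceil n^\alpha\rceil}^{n-1}(y_{j+1}^*-f_j)^2\ge\frac12\sum_{j=\lceil n^\alpha\rceil}^{n-1}(y_{j+1}^* )^2+c_\alpha\log n.$$ Moreover, along any subsequence on which $E_n=O(\log n)$, one has $\sum_{j=0}^{n-1}y_{j+1}^*f_j=o(\log n)$.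
   Context: Fix integers $p\ge0$, $q\ge1$, put $d=p+q$, let $a_1,\dots,a_p,b_1,\dots,b_q$ be real with $b_1\ne0$, and put $A(z)=1+\sum_{i=1}^pa_iz^i$, $B(z)=\sum_{j=1}^qb_jz^{j-1}$, $\theta=(-a_1,\ldots,-a_p,b_1,\ldots,b_q)^T\in\mathbb R^d$; $z$ also denotes the backward shift, $zv_n=v_{n-1}$. $(w_n)_{n\ge1}$ is a real noise process, $w_n=0$ for $n\le0$, and $\mathcal F_n=\sigma(w_1,\dots,w_n)$. The ideal input $u_n^w$ ($u_n^w=0$ for $n<0$) is defined by $B(z)u_n^w=[A(z)-1]w_{n+1}$, $n\ge0$, i.e. $\sum_{j=1}^qb_ju_{n-j+1}^w=\sum_{i=1}^pa_iw_{n+1-i}$. Put $\varphi_n^w=(w_n,\ldots,w_{n-p+1},u_n^w,\ldots,u_{n-q+1}^w)^T$. The columns of $Q\in\mathbb R^{d\times(d-1)}$ form a fixed orthonormal basis of $\theta^\perp$, and $z_n=Q^T\varphi_n^w\in\mathbb R^{d-1}$. Let $\widehat\theta_0\in\mathbb R^d$ and the symmetric matrix $P_0>0$ be deterministic, $L_\theta=[\theta\ Q]$; let $G_0$ be the lower-right $(d-1)\times(d-1)$ block of $L_\theta^TP_0^{-1}L_\theta$ and let $S_0\in\mathbb R^{d-1}$ be the last $d-1$ coordinates of $L_\theta^TP_0^{-1}(\widehat\theta_0-\theta)$. Define $$G_n^w=G_0+\sum_{j=0}^{n-1}z_jz_j^T,\qquad S_n^w=S_0+\sum_{j=0}^{n-1}z_jw_{j+1},\qquad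 f_n=(S_n^w)^T(G_n^w)^{-1}z_n.$$ Also $E_n=\sum_{j=0}^{n-1}(y_{j+1}^* )^2$. *)

(* Defs.v *)
From HB Require Import structures.
From mathcomp Require Import all_boot all_order all_algebra.
From mathcomp Require Import all_classical all_reals all_analysis.
From mathcomp Require Import measurable_realfun complex.

Set Implicit Arguments.
Unset Strict Implicit.
Unset Printing Implicit Defensive.
Import Order.TTheory GRing.Theory Num.Theory.
Import numFieldNormedType.Exports.

Local Open Scope classical_set_scope.
Local Open Scope ring_scope.

(* Conventions: the coefficients a_1, ..., a_p and b_1, ..., b_q are the values
   at 1, ..., p and 1, ..., q of functions nat -> R whose other values are never
   used; two-sided signals (null at negative times) are indexed by int; vectors
   of R^n are column matrices. *)

Section Model.
Variable R : realType.

Definition polyA (p : nat) (a : nat -> R) : {poly R} :=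
  1 + \sum_(1 <= i < p.+1) a i *: 'X^i.

Definition polyB (q : nat) (b : nat -> R) : {poly R} :=
  \sum_(1 <= j < q.+1) b j *: 'X^(j.-1).

(* F(z) v_n, where z is the backward shift z v_n = v_{n-1}. *)
Definition shift_app (F : {poly R}) (v : int -> R) (n : int) : R :=
  \sum_(i < size F) F`_i * v (n - (i : nat)%:Z).

(* As b_1 != 0, these conditions determine u. *)
Definition ideal_input (p q : nat) (a b : nat -> R) (w u : int -> R) : Prop :=
  (forall n : int, n < 0 -> u n = 0) /\
  (forall n : int, 0 <= n ->
     shift_app (polyB q b) u n = shift_app (polyA p a - 1) w (n + 1)).

Definition theta (p q : nat) (a b : nat -> R) : 'cV[R]_(p + q) :=
  col_mx (\col_(i < p) - a i.+1) (\col_(j < q) b j.+1).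

Definition regressor (p q : nat) (w u : int -> R) (n : nat) : 'cV[R]_(p + q) :=
  col_mx (\col_(i < p) w (n%:Z - (i : nat)%:Z))
         (\col_(j < q) u (n%:Z - (j : nat)%:Z)).

(* The row space of kermx v consists of the rows x with x *m v = 0. *)
Definition orthonormal_basis_of_orthogonal (m k : nat)
    (Q : 'M[R]_(m, k)) (v : 'cV[R]_m) : Prop :=
  Q^T *m Q = 1%:M /\ (Q^T == kermx v)%MS.

Definition sym_posdef (m : nat) (M : 'M[R]_m) : Prop :=
  M^T = M /\ (forall v : 'cV[R]_m, v != 0 -> 0 < (v^T *m M *m v) 0 0).

Section LeastSquares.
Variables (p q : nat) (a b : nat -> R).
Variable Q : 'M[R]_(p + q, (p + q).-1).
Variables (thetahat0 : 'cV[R]_(p + q)) (P0 : 'M[R]_(p + q)).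
Variables w u : int -> R.

Definition Ltheta : 'M[R]_(p + q, 1 + (p + q).-1) :=
  row_mx (theta p q a b) Q.

Definition G0 : 'M[R]_((p + q).-1) :=
  drsubmx (Ltheta^T *m invmx P0 *m Ltheta).

Definition S0 : 'cV[R]_((p + q).-1) :=
  dsubmx (Ltheta^T *m invmx P0 *m (thetahat0 - theta p q a b)).

Definition zreg (n : nat) : 'cV[R]_((p + q).-1) :=
  Q^T *m regressor p q w u n.

Definition Gw (n : nat) : 'M[R]_((p + q).-1) :=
  G0 + \sum_(0 <= j < n) zreg j *m (zreg j)^T.

Definition Sw (n : nat) : 'cV[R]_((p + q).-1) :=
  S0 + \sum_(0 <= j < n) w (j.+1)%:Z *: zreg j.

Definition ls_pred (n : nat) : R :=
  ((Sw n)^T *m invmx (Gw n) *m zreg n) 0 0.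

End LeastSquares.

Definition energy (y : nat -> R) (n : nat) : R :=
  \sum_(0 <= j < n) y j.+1 ^+ 2.

(* ceil (n ^ alpha) *)
Definition ceil_pow (alpha : R) (n : nat) : nat :=
  `|Num.ceil (n%:R `^ alpha)|%N.

End Model.

Section Conditioning.
Context (d : measure_display) (T : measurableType d) (R : realType).
Variable P : probability T R.

Definition noise_filtration (w : int -> {RV P >-> R}) (n : nat) : set (set T) :=
  <<s [set A | exists k : nat, [/\ (1 <= k)%N, (k <= n)%N &
        exists2 B : set R, measurable B & A = w k%:Z @^-1` B]] >>.

(* Y is a version of E[X | G], for integrable X. *)
Definition cond_exp (G : set (set T)) (X Y : T -> R) : Prop :=
  [/\ P.-integrable setT (EFin \o X),
      P.-integrable setT (EFin \o Y),
      forall B : set R, measurable B -> G (Y @^-1` B) &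
      forall A : set T, G A ->
        (\int[P]_(t in A) (X t)%:E = \int[P]_(t in A) (Y t)%:E)%E].

(* Y is a version of E[X | G], for X >= 0 not assumed integrable. *)
Definition cond_exp_ge0 (G : set (set T)) (X : T -> R) (Y : T -> \bar R) : Prop :=
  [/\ forall t, 0 <= X t,
      forall t, (0 <= Y t)%E,
      forall B : set (\bar R), measurable B -> G (Y @^-1` B) &
      forall A : set T, G A ->
        (\int[P]_(t in A) (X t)%:E = \int[P]_(t in A) Y t)%E].

End Conditioning.

(* Main.v *)
Require Import Defs.
From HB Require Import structures.
From mathcomp Require Import all_boot all_order all_algebra.
From mathcomp Require Import all_classical all_reals all_analysis.
From mathcomp Require Import measurable_realfun complex.
From mathcomp Require Import zify ring lra.
Set Implicit Arguments.
Unset Strict Implicit.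
Unset Printing Implicit Defensive.
Import Order.TTheory GRing.Theory Num.Theory.
Import numFieldNormedType.Exports.
Local Open Scope classical_set_scope.
Local Open Scope ring_scope.

(** Put h_n = z_n^T G_n^-1 z_n, beta_n = G_n^-1 S_n and V_n = S_n^T G_n^-1 S_n, so
    that f_n = z_n^T beta_n.  The rank-one update gives the exact identity
      V_(n+1) = V_n - f_n^2/(1+h_n) + 2 w_(n+1) f_n/(1+h_n) + w_(n+1)^2 h_n/(1+h_n).
    The entries of B(z) z_n are moving averages of the noise whose coefficient
    vectors are linearly independent by the coprimeness and degree conditions;
    hence c n <= G_n <= C n, log det G_n = (d-1) log n + O(1), and
    sum h_j/(1+h_j) ~ (d-1) log n.  By martingale laws the two noise terms
    contribute sigma^2 (d-1) log n + o(log n), so that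
    V_n + sum f_j^2 = (d-1) sigma^2 log n + o(log n).  That V_n does not take a
    share follows from a weighted law of large numbers for S_n: the sum of
    |S_n|^2/(n log n)^2 converges, so each window [n^(1-delta), n] contains a time at
    which V is small compared with log n.

    For the cross term, beta_n varies slowly, so B(z) f_n is close to
    sum_k (C_k^T beta_(n-k-1)) w_(n-k).  Let yt be the bounded solution of the
    anticausal equation B(z^-1) yt = y; then sum y f = sum yt B(z) f up to
    boundary terms, and the right-hand side is a martingale plus increments of
    beta, hence o(log n) + o(sum y^2).  Expanding (y - f)^2 gives the lower bound. *)

(** * Bounded multipliers *)

(** Three obstacles shape the proof. The centred squares w^2 - sigma^2 have only a moment of order
    nu/2 > 1, beyond the reach of L^2 martingale theory; hence a convergence theorem for exponents r
    in [1,2], and localization, since the moment bound is only almost surely finite. Next, z_n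
    depends on the whole past of the noise, so y_(n+1) f_n is no martingale difference; applying
    B(z) leaves finitely many noise terms with slowly varying coefficients, and the anticausal
    equation moves B(z) from f to y. Finally, V_n is a priori only O(log n), the order of the
    prediction energy itself; but that energy is monotone, so one good time per window is enough.
    The factor d-1 counts the eigenvalues of G_n, each of order n. Probability enters through
    countably many martingale laws; the rest is deterministic on one path, so a single null set
    serves every subsequence. *)

Section SubSigmaAlgebra.
Context d (T : measurableType d) (R : realType).
Variable P : probability T R.

Lemma integrableM_bounded (X eta : T -> R) (M : R) :
  P.-integrable setT (EFin \o X) -> measurable_fun setT eta ->
  (forall t, `|eta t| <= M) -> P.-integrable setT (EFin \o (eta \* X)).
Proof.
move=> iX me eM.
have -> : EFin \o (eta \* X) = ((EFin \o eta) \* (EFin \o X))%E.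
  by apply/funext => t /=; rewrite EFinM.
apply: integrableMr => //.
exists M; split; first by rewrite num_real.
by move=> x Mx t _ /=; rewrite (le_trans (eM t))// ltW.
Qed.

Lemma integrable_bounded (eta : T -> R) (M : R) :
  measurable_fun setT eta ->
  (forall t, `|eta t| <= M) -> P.-integrable setT (EFin \o eta).
Proof.
move=> me eM; apply: measurable_bounded_integrable => //.
  by rewrite (le_lt_trans (probability_le1 P measurableT))// ltry.
exists M; split; first by rewrite num_real.
by move=> x Mx t _ /=; rewrite (le_trans (eM t))// ltW.
Qed.

Lemma integrableDR (X Y : T -> R) :
  P.-integrable setT (EFin \o X) -> P.-integrable setT (EFin \o Y) ->
  P.-integrable setT (EFin \o (fun t => X t + Y t)).
Proof.
move=> iX iY; rewrite (_ : _ \o _ = (EFin \o X) \+ (EFin \o Y))%E.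
  exact: integrableD.
by apply/funext => t /=; rewrite EFinD.
Qed.

Lemma integrableZR (k : R) (X : T -> R) :
  P.-integrable setT (EFin \o X) ->
  P.-integrable setT (EFin \o (fun t => k * X t)).
Proof.
move=> iX; rewrite (_ : _ \o _ = fun t => k%:E * (EFin \o X) t)%E.
  exact: integrableZl.
by apply/funext => t /=; rewrite EFinM.
Qed.

Lemma integrableNR (X : T -> R) :
  P.-integrable setT (EFin \o X) ->
  P.-integrable setT (EFin \o (fun t => - X t)).
Proof.
move=> iX; rewrite (_ : (fun t => - X t) = (fun t => -1 * X t)).
  exact: integrableZR.
by apply/funext => t; rewrite mulN1r.
Qed.

Lemma integrableBR (X Y : T -> R) :
  P.-integrable setT (EFin \o X) -> P.-integrable setT (EFin \o Y) ->
  P.-integrable setT (EFin \o (fun t => X t - Y t)).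
Proof. by move=> iX iY; apply: integrableDR => //; exact: integrableNR. Qed.

Lemma integrable_normR (X : T -> R) :
  P.-integrable setT (EFin \o X) ->
  P.-integrable setT (EFin \o (fun t => `|X t|)).
Proof. by move=> iX; have := integrable_abse iX. Qed.

Lemma integrable_sumR (n : nat) (X : nat -> T -> R) :
  (forall k, (k < n)%N -> P.-integrable setT (EFin \o X k)) ->
  P.-integrable setT (EFin \o (fun t => \sum_(k < n) X k t)).
Proof.
move=> iX; elim: n iX => [|n IH] iX.
  rewrite (_ : _ \o _ = cst 0%E); first exact: integrable0.
  by apply/funext => t /=; rewrite big_ord0.
rewrite (_ : (fun t => _) = (fun t => \sum_(k < n) X k t + X n t)).
  by apply: integrableDR; [apply: IH => k kn; apply: iX; rewrite ltnW|exact: iX].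
by apply/funext => t; rewrite big_ord_recr.
Qed.

(** As x <= K, the sum counts all integers in [1, x], which gives the integer part of x. *)
Lemma sum_indic_levels (x : R) (K : nat) : 0 <= x -> x <= K%:R ->
  let s := \sum_(k < K) (if k.+1%:R <= x then 1 else 0 : R) in
  x - 1 <= s /\ s <= x.
Proof.
move=> x0 xK /=.
have H n : \sum_(k < n) (if k.+1%:R <= x then 1 else 0 : R) =
    if n%:R <= x then n%:R else (Num.truncn x)%:R.
  elim: n => [|n IH]; first by rewrite big_ord0 x0.
  rewrite big_ord_recr/= IH.
  have [nx|nx] := leP n.+1%:R x.
    have -> : n%:R <= x by rewrite (le_trans _ nx)// ler_nat.
    by rewrite natr1.
  case: ifPn => [nx'|]; last by rewrite addr0.
  rewrite addr0; congr (_%:R); apply/esym/eqP.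
  by rewrite truncn_eq// nx' nx.
rewrite H; have /truncn_itv /andP[h1 h2] := x0.
case: ifPn => [Kx|_]; first by split => //; rewrite lerBlDr (le_trans xK)// lerDl.
by split => //; rewrite lerBlDr natr1 ltW.
Qed.

Variable G : set (set T).
Hypothesis mG : forall A, G A -> measurable A.

Lemma measurable_sub (f : T -> R) :
  (forall B, measurable B -> G (f @^-1` B)) -> measurable_fun setT f.
Proof. by move=> Gf _ B mB; rewrite setTI; apply: mG; exact: Gf. Qed.

Lemma Rintegral_indic_mul (A : set T) (Z : T -> R) :
  \int[P]_t (\1_A t * Z t) = \int[P]_(t in A) Z t.
Proof.
rewrite [RHS]Rintegral_mkcond; apply: eq_Rintegral => t _.
by rewrite patchE indicE; case: (t \in A); rewrite ?mul1r ?mul0r.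
Qed.

(* Both integrals agree up to 1/N when eta is replaced by the finite sum
   (1/N) \sum_k 1_{eta >= k/N}. *)
Lemma Rintegral_ge0_bounded_multiplier (Z eta : T -> R) (M : R) :
  P.-integrable setT (EFin \o Z) ->
  (forall A, G A -> 0 <= \int[P]_(t in A) Z t) ->
  (forall B, measurable B -> G (eta @^-1` B)) ->
  (forall t, 0 <= eta t <= M) ->
  0 <= \int[P]_t (eta t * Z t).
Proof.
move=> iZ Zge0 Geta etaM.
have meta := measurable_sub Geta.
have ieta : P.-integrable setT (EFin \o (eta \* Z)).
  apply: (integrableM_bounded (M := M)) => // t.
  by have /andP[e0 eM] := etaM t; rewrite ger0_norm.
have iaZ : P.-integrable setT (EFin \o (fun t => `|Z t|)).
  exact: integrable_normR.
suff H (N : nat) : - ((N.+1%:R)^-1 * \int[P]_t `|Z t|) <= \int[P]_t (eta t * Z t).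
  apply/ler_addgt0Pl => e e0; rewrite -lerBlDl sub0r.
  set I := \int[P]_t `|Z t| in H.
  have I0 : 0 <= I by apply: Rintegral_ge0.
  have [N hN] : exists N : nat, I / e < N.+1%:R.
    exists (Num.truncn (I / e)).
    by have /truncn_itv/andP[] : 0 <= I / e by rewrite divr_ge0// ltW.
  apply: le_trans (H N); rewrite lerN2 mulrC ler_pdivrMr// mulrC.
  by rewrite -ler_pdivrMr// ltW.
pose K := (Num.truncn (N.+1%:R * M)).+1.
pose A (k : nat) := eta @^-1` [set x : R | k.+1%:R <= N.+1%:R * x].
have GA k : G (A k).
  apply: Geta.
  rewrite (_ : mkset _ = `[k.+1%:R / N.+1%:R, +oo[%classic).
    exact: measurable_itv.
  by apply/seteqP; split=> x /=; rewrite in_itv/= andbT ler_pdivrMr// mulrC.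
pose s t := \sum_(k < K) \1_(A k) t : R.
have sE t : s t = \sum_(k < K) (if k.+1%:R <= N.+1%:R * eta t then 1 else 0 : R).
  apply: eq_bigr => k _; rewrite indicE /A.
  by case: ifPn => h; [rewrite mem_set|rewrite memNset//; apply/negP].
have sP t : N.+1%:R * eta t - 1 <= s t /\ s t <= N.+1%:R * eta t.
  have /andP[e0 eM] := etaM t.
  rewrite sE; apply: sum_indic_levels; first by rewrite mulr_ge0.
  apply: (@le_trans _ _ (N.+1%:R * M)); first by rewrite ler_pM2l.
  have /truncn_itv/andP[_ /ltW//] : 0 <= N.+1%:R * M.
  by rewrite mulr_ge0// (le_trans e0).
have iAZ k : P.-integrable setT (EFin \o (\1_(A k) \* Z)).
  apply: (integrableM_bounded (M := 1)) => //; first exact/measurable_indic/mG.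
  by move=> t; rewrite indicE; case: (_ \in _); rewrite ?normr1 ?normr0.
have isZ n : P.-integrable setT (EFin \o (fun t => \sum_(k < n) (\1_(A k) t * Z t))).
  by apply: (integrable_sumR (X := fun k t => \1_(A k) t * Z t)) => k _; exact: iAZ.
have sZ n : 0 <= \int[P]_t (\sum_(k < n) (\1_(A k) t * Z t)).
  elim: n => [|n IH].
    by rewrite (@eq_Rintegral _ _ _ P setT (fun=> 0)) ?Rintegral_cst ?mul0r// => t _; rewrite big_ord0.
  rewrite (@eq_Rintegral _ _ _ P setT (fun t => \sum_(k < n) (\1_(A k) t * Z t) + \1_(A n) t * Z t)).
    have /= -> := RintegralD (mu := P) measurableT (isZ n) (iAZ n).
    by rewrite addr_ge0// Rintegral_indic_mul Zge0.
  by move=> t _; rewrite big_ord_recr.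
have key t : - `|Z t| <= N.+1%:R * (eta t * Z t) - \sum_(k < K) (\1_(A k) t * Z t).
  rewrite -mulr_suml -/(s t).
  have [h1 h2] := sP t.
  rewrite mulrA -mulrBl.
  have : `| (N.+1%:R * eta t - s t) * Z t| <= `|Z t|.
    by rewrite normrM ler_piMl// ger0_norm; lra.
  by rewrite ler_norml => /andP[].
have i1 : P.-integrable setT (EFin \o (fun t => N.+1%:R * (eta t * Z t))).
  exact: integrableZR.
have : \int[P]_t (- `|Z t|) <=
    \int[P]_t (N.+1%:R * (eta t * Z t) - \sum_(k < K) (\1_(A k) t * Z t)).
  apply: le_Rintegral => //; first exact: integrableNR.
  exact: integrableBR.
have /= -> := RintegralB (mu := P) measurableT i1 (isZ K).
rewrite (RintegralZl (mu := P) _ measurableT ieta).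
rewrite (@eq_Rintegral _ _ _ P setT (fun t => (-1) * `|Z t|)); last by move=> t _; rewrite mulN1r.
rewrite (RintegralZl (mu := P) _ measurableT iaZ) mulN1r => h.
rewrite -(ler_pM2l (ltr0Sn R N)) mulrN mulrA mulfV ?pnatr_eq0// mul1r.
by have := sZ K; lra.
Qed.

End SubSigmaAlgebra.

(** * A smooth gauge *)

Section Gauge.
Variable R : realType.

(* A smooth substitute for |x|: gauge (x + y) <= gauge x + dgauge x * y + 2 |y|^r
   whenever 1 <= r <= 2, so that the stopped gauge of an L^r martingale has drift at
   most the sum of the r-th moments. *)
Definition gauge (x : R) : R := Num.sqrt (1 + x ^+ 2) - 1.
Definition dgauge (x : R) : R := x / Num.sqrt (1 + x ^+ 2).

Let s (x : R) := Num.sqrt (1 + x ^+ 2).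

Lemma sqrt1D_ge1 (x : R) : 1 <= Num.sqrt (1 + x ^+ 2).
Proof. by rewrite -[leLHS]sqrtr1 ler_wsqrtr// lerDl sqr_ge0. Qed.

Lemma sqr_sqrt1D (x : R) : Num.sqrt (1 + x ^+ 2) ^+ 2 = 1 + x ^+ 2.
Proof. by rewrite sqr_sqrtr// addr_ge0// sqr_ge0. Qed.

Lemma gauge_ge0 (x : R) : 0 <= gauge x.
Proof. by rewrite subr_ge0 sqrt1D_ge1. Qed.

Lemma gauge0 : gauge 0 = 0.
Proof. by rewrite /gauge expr0n addr0 sqrtr1 subrr. Qed.

Lemma gauge_le_norm (x : R) : gauge x <= `|x|.
Proof.
rewrite lerBlDr -(@ler_pXn2r _ 2) ?nnegrE ?sqrtr_ge0 ?addr_ge0//.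
by rewrite sqr_sqrt1D sqrrD expr1n mulr1 real_normK ?num_real// ; have := normr_ge0 x; lra.
Qed.

Lemma gauge_homo (x y : R) : `|x| <= `|y| -> gauge x <= gauge y.
Proof.
move=> xy; rewrite lerD2r ler_sqrt ?lerD2l ?addr_ge0 ?sqr_ge0//.
by rewrite -real_normK ?num_real// -[leRHS]real_normK ?num_real// lerXn2r// nnegrE.
Qed.

Lemma gauge_gt0 (x : R) : 0 < x -> 0 < gauge x.
Proof.
move=> x0; rewrite subr_gt0 -[ltLHS]sqrtr1 ltr_sqrt ?ltrDl ?exprn_gt0//.
by rewrite addr_gt0// exprn_gt0.
Qed.

Lemma dgauge_le1 (x : R) : `|dgauge x| <= 1.
Proof.
have h1 := sqrt1D_ge1 x; have h2 := sqr_sqrt1D x; rewrite /dgauge.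
set a := Num.sqrt _ in h1 h2 *.
rewrite normrM normfV (@ger0_norm _ a); last by lra.
rewrite ler_pdivrMr ?mul1r; last by lra.
rewrite -(@ler_pXn2r _ 2) ?nnegrE//; last by lra.
by rewrite real_normK ?num_real// h2; lra.
Qed.

(** Multiplication by a = sqrt(1 + x^2) reduces this to a b <= (a^2 + b^2)/2 with b = sqrt(1 +
    (x+y)^2); a >= 1 absorbs the rest. *)
Lemma gaugeD_le_sqr (x y : R) : gauge (x + y) <= gauge x + dgauge x * y + y ^+ 2.
Proof.
rewrite /gauge /dgauge; have h1 := sqrt1D_ge1 x; have h2 := sqr_sqrt1D x.
have h3 := sqrt1D_ge1 (x + y); have h4 := sqr_sqrt1D (x + y).
set a := Num.sqrt (1 + x ^+ 2) in h1 h2 *.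
set b := Num.sqrt _ in h3 h4 *.
have a0 : 0 < a by lra.
suff : b <= a + x / a * y + y ^+ 2 by lra.
have -> : a + x / a * y + y ^+ 2 = (a ^+ 2 + x * y + a * y ^+ 2) / a by field; lra.
rewrite ler_pdivlMr//.
have : b * a <= (b ^+ 2 + a ^+ 2) / 2 by have := sqr_ge0 (b - a); lra.
have : y ^+ 2 <= a * y ^+ 2 by rewrite ler_peMl// sqr_ge0.
have := sqr_ge0 y.
lra.
Qed.

Lemma gaugeD_le_norm (x y : R) : gauge (x + y) <= gauge x + dgauge x * y + 2 * `|y|.
Proof.
have h : gauge (x + y) <= gauge x + `|y|.
  rewrite /gauge; have h1 := sqrt1D_ge1 x; have h2 := sqr_sqrt1D x.
  have h3 := sqrt1D_ge1 (x + y); have h4 := sqr_sqrt1D (x + y).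
  set a := Num.sqrt (1 + x ^+ 2) in h1 h2 *.
  set b := Num.sqrt _ in h3 h4 *.
  suff : b <= a + `|y| by lra.
  have y0 := normr_ge0 y.
  rewrite -(@ler_pXn2r _ 2) ?nnegrE//; [|lra|lra].
  have -> : (a + `|y|) ^+ 2 = a ^+ 2 + 2 * (a * `|y|) + y ^+ 2.
    by rewrite sqrrD real_normK ?num_real//; ring.
  have : x * y <= a * `|y|.
    rewrite (le_trans (ler_norm _))// normrM ler_wpM2r//.
    rewrite -(@ler_pXn2r _ 2) ?nnegrE ?normr_ge0//; last by lra.
    by rewrite real_normK ?num_real// h2; lra.
  by rewrite h4 h2; lra.
have : - `|y| <= dgauge x * y.
  have : `|dgauge x * y| <= `|y| by rewrite normrM ler_piMl// dgauge_le1.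
  by rewrite ler_norml => /andP[].
lra.
Qed.

Lemma min_sqr_norm_le_powR (y r : R) : 1 <= r -> r <= 2 ->
  `|y| <= `|y| `^ r \/ y ^+ 2 <= `|y| `^ r.
Proof.
move=> r1 r2; have [y1|y1] := leP 1 `|y|.
  left; rewrite -{1}(powRr1 (normr_ge0 y)).
  by apply: ler_powR.
right; rewrite -real_normK ?num_real// -powR_mulrn//.
have [->|y0] := eqVneq `|y| 0.
  by rewrite !powR0//; apply/eqP; lra.
by apply: ger_powR => //; rewrite lt0r y0 normr_ge0 ltW.
Qed.

(** For |y| >= 1 the linear bound applies because r >= 1, for |y| < 1 the quadratic one because r <=
    2. *)
Lemma gaugeD_le_powR (x y r : R) : 1 <= r -> r <= 2 ->
  gauge (x + y) <= gauge x + dgauge x * y + 2 * `|y| `^ r.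
Proof.
move=> r1 r2; have [h|h] := min_sqr_norm_le_powR y r1 r2.
  by have := gaugeD_le_norm x y; lra.
have := gaugeD_le_sqr x y; have := powR_ge0 `|y| r; lra.
Qed.

Lemma measurable_gauge : measurable_fun setT gauge.
Proof.
rewrite (_ : gauge = fun x => (1 + x ^+ 2) `^ 2^-1 - 1); last first.
  by apply/funext => x; rewrite powR12_sqrt// addr_ge0// sqr_ge0.
apply: measurable_funB => //.
apply: (measurableT_comp (measurable_powR 2^-1)).
apply: measurable_funD => //.
Qed.

Lemma measurable_dgauge : measurable_fun setT dgauge.
Proof.
rewrite (_ : dgauge = fun x => x * (1 + x ^+ 2) `^ (- 2^-1)); last first.
  by apply/funext => x; rewrite powRN powR12_sqrt// addr_ge0// sqr_ge0.
apply: measurable_funM => //.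
apply: (measurableT_comp (measurable_powR (- 2^-1))).
apply: measurable_funD => //.
Qed.

End Gauge.

(** * Convergence of martingale series *)

Lemma cvgn_of_cauchy_tail (R : realType) (u : nat -> R) :
  (forall e, 0 < e -> exists m, forall k, `|u (m + k)%N - u m| < e) -> cvgn u.
Proof.
move=> H; apply: cauchy_cvg; apply: cauchy_exP => e e0.
have [m hm] := H _ e0; exists (u m); exists m => // n /= mn.
rewrite -ball_normE/= distrC; have := hm (n - m)%N; by rewrite subnKC.
Qed.

Lemma sum_shiftE (V : zmodType) (v : nat -> V) (m k : nat) :
  \sum_(j < k) v (m + j)%N = \sum_(j < m + k) v j - \sum_(j < m) v j.
Proof.
elim: k => [|k IH]; first by rewrite big_ord0 addn0 subrr.
by rewrite big_ord_recr/= IH addnS big_ord_recr addrAC.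
Qed.

Lemma bounded_series_tail (R : realType) (v : nat -> R) (M e : R) :
  (forall j, 0 <= v j) -> (forall n, \sum_(j < n) v j <= M) -> 0 < e ->
  exists m, forall k, \sum_(j < k) v (m + j)%N <= e.
Proof.
move=> v0 vM e0.
pose u n := \sum_(j < n) v j.
have uS n : u n.+1 = u n + v n by rewrite /u big_ord_recr.
have ui : {homo u : n m / (n <= m)%N >-> n <= m}.
  by apply: homo_leq => // [x|n]; [exact: le_trans|rewrite uS lerDl].
have cu : cvgn u.
  apply: nondecreasing_is_cvgn => //; exists M => _ [n _ <-]; exact: vM.
have /cvgrPdist_lt/(_ _ e0)[m _ hm] := cu.
exists m => k.
rewrite sum_shiftE -/(u _) -/(u _).
have ul n : u n <= limn u by apply: nondecreasing_cvgn_le.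
have := hm m (leqnn m); have := ul m; have := ul (m + k)%N => /=.
by move=> h1 h2; rewrite ger0_norm ?subr_ge0// => h3; lra.
Qed.

Section Martingale.
Context d (T : measurableType d) (R : realType).
Variable P : probability T R.
Variable gen : nat -> set (set T).
Hypothesis gen_mono : forall n, gen n `<=` gen n.+1.
Hypothesis gen_meas : forall n, gen n `<=` measurable.

Definition adapted n (f : T -> R) :=
  measurable_fun (setT : set (g_sigma_algebraType (gen n))) f.

Lemma gen_measurable n A : <<s gen n>> A -> measurable A.
Proof. apply: smallest_sub => //; exact: sigma_algebra_measurable. Qed.

Lemma gen_leq n m : (n <= m)%N -> gen n `<=` gen m.
Proof.
by move=> /subnKC <-; elim: (m - n)%N => [|k IH]; rewrite ?addn0// addnS => A /IH /gen_mono.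
Qed.

Lemma adaptedP n f :
  adapted n f <-> forall B, measurable B -> <<s gen n>> (f @^-1` B).
Proof.
split=> [mf B mB|h _ B mB]; last by rewrite setTI; exact: h.
by have := mf measurableT B mB; rewrite setTI.
Qed.

Lemma adapted_measurable n f : adapted n f -> measurable_fun setT f.
Proof.
by move=> /adaptedP h _ B mB; rewrite setTI; apply: (@gen_measurable n); exact: h.
Qed.

Lemma adapted_leq n m f : (n <= m)%N -> adapted n f -> adapted m f.
Proof.
move=> nm /adaptedP h; apply/adaptedP => B mB.
by apply: sub_sigma_algebra2 (h B mB); exact: gen_leq.
Qed.

(** Adding M makes the multiplier nonnegative at no cost, since Z integrates to zero; the one-sided
    bound is then used for Z and for -Z. *)
Lemma Rintegral_bounded_multiplier_eq0 n (Z eta : T -> R) (M : R) :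
  P.-integrable setT (EFin \o Z) ->
  (forall A, <<s gen n>> A -> \int[P]_(t in A) Z t = 0) ->
  adapted n eta -> (forall t, `|eta t| <= M) ->
  \int[P]_t (eta t * Z t) = 0.
Proof.
move=> iZ Z0 aeta etaM.
have ZT0 : \int[P]_t Z t = 0.
  by apply: Z0; exact: (@measurableT _ (g_sigma_algebraType (gen n))).
have H (Y : T -> R) : P.-integrable setT (EFin \o Y) ->
    (forall A, <<s gen n>> A -> \int[P]_(t in A) Y t = 0) ->
    0 <= \int[P]_t (eta t * Y t).
  move=> iY Y0.
  have iM : P.-integrable setT (EFin \o (eta \* Y)).
    by apply: (integrableM_bounded (M := M)) => //; exact: adapted_measurable aeta.
  have : 0 <= \int[P]_t ((eta t + M) * Y t).
    apply: (Rintegral_ge0_bounded_multiplier (@gen_measurable n) (M := 2 * M)) => //.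
    - by move=> A GA; rewrite Y0.
    - by apply/adaptedP; apply: measurable_funD.
    - by move=> t; have := etaM t; rewrite ler_norml => /andP[]; lra.
  rewrite (@eq_Rintegral _ _ _ P setT (fun t => eta t * Y t + M * Y t)); last first.
    by move=> t _; rewrite mulrDl.
  have iMY := integrableZR M iY.
  have /= -> := RintegralD (mu := P) measurableT iM iMY.
  rewrite (RintegralZl (mu := P) _ measurableT iY).
  rewrite (_ : \int[P]_t Y t = 0) ?mulr0 ?addr0//.
  by apply: Y0; exact: (@measurableT _ (g_sigma_algebraType (gen n))).
apply/eqP; rewrite eq_le H// andbT.
have iN := integrableNR iZ.
have iM : P.-integrable setT (EFin \o (eta \* Z)).
  by apply: (integrableM_bounded (M := M)) => //; exact: adapted_measurable aeta.
have : 0 <= \int[P]_t (eta t * - Z t).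
  apply: H => // A GA.
  have iA : P.-integrable A (EFin \o Z).
    apply: integrableS iZ => //; exact: gen_measurable GA.
  rewrite (@eq_Rintegral _ _ _ P A (fun t => (-1) * Z t)); last by move=> t _; rewrite mulN1r.
  by rewrite (RintegralZl (mu := P) _ (gen_measurable GA) iA) Z0// mulr0.
rewrite (@eq_Rintegral _ _ _ P setT (fun t => (-1) * (eta t * Z t))); last first.
  by move=> t _; rewrite mulN1r mulrN.
by rewrite (RintegralZl (mu := P) _ measurableT iM) mulN1r oppr_ge0.
Qed.

Section Convergence.
Variables (X : nat -> T -> R) (r M : R).
Hypothesis r1 : 1 <= r.
Hypothesis r2 : r <= 2.
Hypothesis Xint : forall n, P.-integrable setT (EFin \o X n).
Hypothesis Xadapted : forall n, adapted n.+1 (X n).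
Hypothesis Xorth : forall n eta, adapted n eta -> (forall t, `|eta t| <= 1) ->
  \int[P]_t (eta t * X n t) = 0.
Hypothesis Xrint : forall n, P.-integrable setT (EFin \o (fun t => `|X n t| `^ r)).
Hypothesis Xrsum : forall n, \sum_(j < n) \int[P]_t (`|X j t| `^ r) <= M.

(** The partial sum from time m on, frozen once its absolute value reaches eps. Freezing turns the
    maximal event into an event about the last value, so a Markov bound for the gauge takes the
    place of Doob's maximal inequality. *)
Fixpoint stopped (eps : R) (m k : nat) : T -> R :=
  if k is k'.+1 then
    fun t => stopped eps m k' t + (`|stopped eps m k' t| < eps)%R%:R * X (m + k') t
  else fun=> 0.

Lemma measurable_nat_of_bool (d' : measure_display) (T' : measurableType d') (f : T' -> bool) :
  measurable_fun setT f -> measurable_fun setT (fun t => (f t)%:R : R).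
Proof.
move=> mf; rewrite (_ : (fun t => _) = fun t => if f t then 1 else 0).
  by apply: measurable_fun_ifT => //.
by apply/funext => t; case: (f t).
Qed.

Lemma stopped_adapted eps m k : adapted (m + k) (stopped eps m k).
Proof.
elim: k => [|k IH] /=; first exact: measurable_cst.
rewrite addnS; have IH' := adapted_leq (leqnSn _) IH.
apply: measurable_funD => //; apply: measurable_funM; last exact: Xadapted.
apply: measurable_nat_of_bool; apply: measurable_fun_ltr => //.
exact: measurableT_comp.
Qed.

Lemma stopped_integrable eps m k : P.-integrable setT (EFin \o stopped eps m k).
Proof.
elim: k => [|k IH] /=; first exact: integrable0.
apply: integrableDR => //.
apply: (integrableM_bounded (M := 1)) => //.
  apply: measurable_nat_of_bool; apply: measurable_fun_ltr => //.
  apply: measurableT_comp => //; apply: adapted_measurable; exact: stopped_adapted.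
by move=> t; case: (_ < _); rewrite ?normr1 ?normr0.
Qed.

Lemma gauge_stopped_integrable eps m k :
  P.-integrable setT (EFin \o (fun t => gauge (stopped eps m k t))).
Proof.
apply: le_integrable (stopped_integrable eps m k) => //.
  apply/measurable_EFinP; apply: (measurableT_comp (@measurable_gauge R)).
  apply: adapted_measurable; exact: stopped_adapted.
move=> t _ /=; rewrite lee_fin ger0_norm ?gauge_ge0//; exact: gauge_le_norm.
Qed.

(** In one step the linear term has as coefficient [dgauge] times the indicator of not being
    stopped; it is adapted and bounded by 1, so the term integrates to zero and only the r-th moment
    remains. *)
Lemma gauge_stopped_le eps m k :
  \int[P]_t gauge (stopped eps m k t) <=
  2 * \sum_(j < k) \int[P]_t (`|X (m + j) t| `^ r).
Proof.
elim: k => [|k IH].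
  rewrite big_ord0 mulr0 (@eq_Rintegral _ _ _ P setT (fun=> 0)) ?Rintegral_cst ?mul0r//.
  by move=> t _ /=; rewrite gauge0.
rewrite big_ord_recr/= mulrDr.
set N := stopped eps m k in IH *.
have aN : adapted (m + k) N by exact: stopped_adapted.
pose ind t : R := (`|N t| < eps)%R%:R.
have aind : adapted (m + k) ind.
  apply: measurable_nat_of_bool; apply: measurable_fun_ltr => //.
  exact: measurableT_comp.
pose eta t := dgauge (N t) * ind t.
have aeta : adapted (m + k) eta.
  by apply: measurable_funM => //; apply: (measurableT_comp (@measurable_dgauge R)).
have eta1 t : `|eta t| <= 1.
  rewrite /eta /ind; case: (_ < _); rewrite ?mulr1 ?mulr0 ?normr0//.
  exact: dgauge_le1.
have iG := gauge_stopped_integrable eps m k.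
have iE : P.-integrable setT (EFin \o (eta \* X (m + k))).
  by apply: (integrableM_bounded (M := 1)) => //; exact: adapted_measurable aeta.
have iR := integrableZR 2 (Xrint (m + k)).
have le : \int[P]_t gauge (N t + ind t * X (m + k) t) <=
  \int[P]_t ((gauge (N t) + eta t * X (m + k) t) + 2 * `|X (m + k) t| `^ r).
  apply: le_Rintegral => //.
  - exact: (gauge_stopped_integrable eps m k.+1).
  - by apply: integrableDR => //; exact: integrableDR.
  move=> t _; rewrite /eta /ind; case: (_ < _); last first.
    rewrite mul0r !addr0 mulr0 mul0r addr0 lerDl mulr_ge0// powR_ge0//.
  by rewrite mul1r mulr1; exact: gaugeD_le_powR.
apply: le_trans le _.
have /= -> := RintegralD (mu := P) measurableT (integrableDR iG iE) iR.
have /= -> := RintegralD (mu := P) measurableT iG iE.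
have /= -> := RintegralZl (mu := P) 2 measurableT (Xrint (m + k)).
by rewrite lerD2r (Xorth aeta eta1) addr0.
Qed.

Lemma stoppedP eps m k t :
  ((forall i, (i <= k)%N -> `|\sum_(j < i) X (m + j) t| < eps) /\
    stopped eps m k t = \sum_(j < k) X (m + j) t) \/
  eps <= `|stopped eps m k t|.
Proof.
elim: k => [|k [[IH1 IH2]|IH]].
- have [h|h] := leP eps `|0 : R|; [by right|left; split; last by rewrite big_ord0].
  by move=> i; rewrite leqn0 => /eqP ->; rewrite big_ord0.
- have h : stopped eps m k.+1 t = \sum_(j < k.+1) X (m + j) t.
    by rewrite /= IH2 IH1// mul1r big_ord_recr.
  rewrite h; case: (leP eps `|\sum_(j < k.+1) X (m + j) t|) => [|h']; first by right.
  left; split => // i; rewrite leq_eqVlt => /orP[/eqP -> //|]; exact: IH1.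
- by right; rewrite /= ltNge IH mul0r addr0.
Qed.

Lemma stopped_mono eps m k n t : (k <= n)%N ->
  eps <= `|stopped eps m k t| -> eps <= `|stopped eps m n t|.
Proof.
move=> /subnKC <-; elim: (n - k)%N => [|i IH]; rewrite ?addn0// addnS => h.
by rewrite /= ltNge (IH h) mul0r addr0 IH.
Qed.

Let U eps m := \bigcup_k [set t | eps <= `|stopped eps m k t|].

Let mset eps m k : measurable [set t | eps <= `|stopped eps m k t|].
Proof.
have mN : measurable_fun setT (fun t => `|stopped eps m k t|).
  apply: measurableT_comp => //; apply: adapted_measurable; exact: stopped_adapted.
have -> : [set t | eps <= `|stopped eps m k t|] =
    (fun t => `|stopped eps m k t|) @^-1` `[eps, +oo[%classic.
  by apply/seteqP; split=> t /=; rewrite in_itv/= andbT.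
by rewrite -[X in measurable X]setTI; apply: mN => //; exact: measurable_itv.
Qed.

Let mU eps m : measurable (U eps m).
Proof. by apply: bigcup_measurable => k _. Qed.

Lemma stopped_prob eps m k : 0 < eps ->
  gauge eps * fine (P [set t | eps <= `|stopped eps m k t|]) <=
  2 * \sum_(j < k) \int[P]_t (`|X (m + j) t| `^ r).
Proof.
move=> e0; apply: le_trans (gauge_stopped_le eps m k).
set A := mkset _.
have mA : measurable A by exact: mset.
rewrite -(Rintegral_cst P mA) Rintegral_mkcond.
apply: le_Rintegral => //.
- have := @integrable_mkcond _ _ _ P A (EFin \o (fun=> gauge eps)) mA.
  rewrite restrict_EFin => <-; apply: measurable_bounded_integrable => //.
    by rewrite (le_lt_trans (probability_le1 P mA))// ltry.
  by exists `|gauge eps|; split; rewrite ?num_real// => x /ltW h t _.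
- exact: gauge_stopped_integrable.
- move=> t _; rewrite patchE; case: ifPn; last by rewrite gauge_ge0.
  rewrite inE /A/= => h; apply: gauge_homo.
  by rewrite ger0_norm// ltW.
Qed.

(** A start m with a small tail of r-th moments bounds the probability of passage within k steps
    uniformly in k, and these events increase with k. *)
Lemma U_prob eps e : 0 < eps -> 0 < e -> exists m, (P (U eps m) <= e%:E)%E.
Proof.
move=> eps0 e0.
have g0 := gauge_gt0 eps0.
have v0 j : 0 <= \int[P]_t (`|X j t| `^ r).
  by apply: Rintegral_ge0 => t _; exact: powR_ge0.
have e1 : 0 < e * gauge eps / 2 by rewrite !mulr_gt0// invr_gt0.
have [m hm] := bounded_series_tail v0 Xrsum e1.
exists m.
have cv : P [set t | eps <= `|stopped eps m k t|] @[k --> \oo] --> P (U eps m).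
  apply: (nondecreasing_cvg_mu (F := fun k => [set t | eps <= `|stopped eps m k t|])) => //.
    exact: mU.
  by move=> k n kn; apply/subsetPset => t /=; exact: stopped_mono.
rewrite -(cvg_lim _ cv)//; apply: lime_le; first by apply/cvg_ex; eexists; exact: cv.
near=> k.
have pf : P [set t | eps <= `|stopped eps m k t|] \is a fin_num.
  by apply: fin_num_measure; exact: mset.
rewrite -(fineK pf) lee_fin.
have := stopped_prob m k eps0; have := hm k => h1 h2.
rewrite -(ler_pM2l g0) (le_trans h2)//; lra.
Unshelve. all: by end_near. Qed.

(** The exceptional set is the union over l of the events that from every start m the sums reach
    1/(l+1). Off it the partial sums are Cauchy. *)
Lemma martingale_series_cvg : {ae P, forall t, cvgn (fun n => \sum_(j < n) X j t)}.
Proof.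
pose B l := \bigcap_m U (l.+1%:R^-1) m.
have Bneg l : P.-negligible (B l).
  have mB : measurable (B l).
    by apply: bigcap_measurable => [|k _]; [exists 0%N|exact: mU].
  apply/negligibleP => //; apply/eqP; rewrite eq_le measure_ge0 andbT.
  apply/lee_addgt0Pr => e e0; rewrite add0e.
  have l0 : 0 < l.+1%:R^-1 :> R by rewrite invr_gt0.
  have [m hm] := U_prob l0 e0.
  apply: le_trans hm; apply: le_measure; [by rewrite inE|by rewrite inE; exact: mU|].
  by move=> t; apply.
apply: negligibleS (negligible_bigcup Bneg) => t /=.
move=> ncv; apply: contrapT => nB; apply: ncv.
apply: cvgn_of_cauchy_tail => e e0.
have [l hl] : exists l : nat, l.+1%:R^-1 < e.
  exists (Num.truncn e^-1).
  rewrite -[ltRHS]invrK ltf_pV2 ?posrE ?invr_gt0//.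
  by have /truncn_itv/andP[] : 0 <= e^-1 by rewrite invr_ge0 ltW.
have : ~ B l t by move=> h; apply: nB; exists l.
move=> /existsNP[m /not_implyP[_ hm]]; exists m => k.
rewrite -(sum_shiftE (X ^~ t)).
have [[h _]|h] := stoppedP l.+1%:R^-1 m k t.
  exact: lt_trans (h _ (leqnn k)) hl.
by exfalso; apply: hm; exists k.
Qed.

End Convergence.
End Martingale.

Lemma powR_ge_norm (R : realType) (x r : R) : 1 <= r -> `|x| <= 1 + `|x| `^ r.
Proof.
move=> r1; have := powR_ge0 `|x| r; have [x1|x1] := leP 1 `|x|; last by lra.
by have := ler_powR x1 r1; rewrite powRr1//; lra.
Qed.

(** * Transforms with random weights and random moment bounds *)

Section MartingaleTransform.
Context d (T : measurableType d) (R : realType).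
Variable P : probability T R.
Variable gen : nat -> set (set T).
Hypothesis gen_mono : forall n, gen n `<=` gen n.+1.
Hypothesis gen_meas : forall n, gen n `<=` measurable.
Local Notation adapted := (adapted (R := R) gen).

(** [H n K] is an event, known at time n, on which the conditional r-th moment of [D n] is at most
    [kappa K]; [Hmom] expresses this through integrals over known sub-events. The noise itself takes
    [H] to be the whole space, the centred squares take the event that the conditional nu-th moment
    is at most K. *)
Variables (D : nat -> T -> R) (r : R) (H : nat -> nat -> set T) (kappa : nat -> R).
Hypothesis r1 : 1 <= r.
Hypothesis r2 : r <= 2.
Hypothesis Dint : forall n, P.-integrable setT (EFin \o D n).
Hypothesis Dadapted : forall n, adapted n.+1 (D n).
Hypothesis D0 : forall n A, <<s gen n>> A -> \int[P]_(t in A) D n t = 0.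
Hypothesis Hgen : forall n K, <<s gen n>> (H n K).
Hypothesis Hmono : forall n K K', (K <= K')%N -> H n K `<=` H n K'.
Hypothesis kappa0 : forall K, 0 <= kappa K.
Hypothesis Hmom : forall n K A, <<s gen n>> A -> A `<=` H n K ->
  (\int[P]_(t in A) (`|D n t| `^ r)%:E <= (kappa K)%:E * P A)%E.

Variable g : nat -> T -> R.
Hypothesis gadapted : forall n, adapted n (g n).

Let r0 : r != 0. Proof. by rewrite gt_eqF// (lt_le_trans ltr01). Qed.

Section Localized.
Variable K : nat.

(* Truncation to the event, known at time j, that the conditional moments and the
   accumulated weights are both at most K; letting K grow recovers the full series. *)
Let loc j t := (t \in H j K) && (\sum_(i < j.+1) `|g i t| `^ r <= K%:R).
Let xi j t := g j t * (loc j t)%:R.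
Let X j t := xi j t * D j t.
Let Z j := (fun t => `|D j t| `^ r) \_ (H j K).

Let mgen n A : <<s gen n>> A -> measurable A.
Proof. exact: gen_measurable. Qed.

Let loc_adapted j : measurable_fun (setT : set (g_sigma_algebraType (gen j))) (loc j).
Proof.
apply: measurable_and.
  apply: (measurable_fun_bool true); rewrite setTI.
  rewrite (_ : _ @^-1` _ = H j K); first exact: Hgen.
  by apply/seteqP; split => t /=; [exact: set_mem|exact: mem_set].
apply: measurable_fun_ler => //.
apply: measurable_sum => i.
apply: (measurableT_comp (measurable_powR r)); apply: measurableT_comp => //.
have ij : (i <= j)%N by rewrite -ltnS.
by have := adapted_leq gen_mono ij (@gadapted i).
Qed.

Let xi_adapted j : adapted j (xi j).
Proof. by apply: measurable_funM; [exact: gadapted|exact: measurable_nat_of_bool]. Qed.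

Let xi_powR j t : `|xi j t| `^ r <= K%:R.
Proof.
rewrite /xi; case: (boolP (loc j t)) => [/andP[_]|_]; last first.
  by rewrite mulr0 normr0 powR0.
rewrite mulr1; apply: le_trans; rewrite big_ord_recr/= lerDr.
by apply: sumr_ge0 => i _; exact: powR_ge0.
Qed.

Let xi_bound j t : `|xi j t| <= 1 + K%:R.
Proof. by apply: le_trans (powR_ge_norm _ r1) _; rewrite lerD2l. Qed.

Let xi_sum n t : \sum_(j < n) `|xi j t| `^ r <= K%:R.
Proof.
(* The condition in [loc] can fail at one time and hold again later, so a comparison with the
   untruncated weights is carried along; it bounds the sum whenever the condition holds. *)
suff : \sum_(j < n) `|xi j t| `^ r <= K%:R /\
   \sum_(j < n) `|xi j t| `^ r <= \sum_(j < n) `|g j t| `^ r by case.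
elim: n => [|n [IH1 IH2]]; first by rewrite !big_ord0.
rewrite !big_ord_recr/= {2 4}/xi.
case: (boolP (loc n t)) => [/andP[_ h]|_]; last first.
  by rewrite mulr0 normr0 powR0// addr0; split => //; rewrite (le_trans IH2)// lerDl powR_ge0.
rewrite mulr1; split; last by rewrite lerD2r.
by apply: le_trans h; rewrite big_ord_recr/= lerD2r.
Qed.

Let HmomR j A : <<s gen j>> A -> A `<=` H j K ->
  P.-integrable A (EFin \o (fun t => `|D j t| `^ r)) /\
  \int[P]_(t in A) (`|D j t| `^ r) <= kappa K * fine (P A).
Proof.
move=> GA AH; have mA := mgen GA.
have pf : P A \is a fin_num by exact: fin_num_measure.
have hm := Hmom GA AH.
have lt : (\int[P]_(t in A) (`|D j t| `^ r)%:E < +oo)%E.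
  by apply: le_lt_trans hm _; rewrite -(fineK pf) -EFinM ltry.
have mD : measurable_fun setT (fun t => `|D j t| `^ r).
  apply: (measurableT_comp (measurable_powR r)); apply: measurableT_comp => //.
  by have := adapted_measurable gen_meas (@Dadapted j).
split.
  apply/integrableP; split; first by apply/measurable_EFinP; exact: measurable_funTS.
  apply: le_lt_trans lt; rewrite le_eqVlt; apply/orP; left; apply/eqP.
  by apply: eq_integral => t _ /=; rewrite ger0_norm// powR_ge0.
rewrite -lee_fin /Rintegral fineK; first by rewrite EFinM fineK.
by rewrite ge0_fin_numE// integral_ge0// => t _; rewrite lee_fin powR_ge0.
Qed.

Let Zint j : P.-integrable setT (EFin \o Z j).
Proof.
have [h _] := HmomR (@Hgen j K) (@subset_refl _ _).
have mH : measurable (H j K) by have := mgen (@Hgen j K).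
by move/(integrable_mkcond _ mH): h; rewrite restrict_EFin.
Qed.

Let XrE j t : `|X j t| `^ r = `|xi j t| `^ r * Z j t.
Proof.
rewrite /X normrM powRM// /Z patchE; case: ifPn => // tH.
by rewrite /xi /loc (negbTE tH)/= mulr0 normr0 powR0// !mul0r.
Qed.

Let xir_adapted j : adapted j (fun t => `|xi j t| `^ r).
Proof.
apply: (measurableT_comp (measurable_powR r)); apply: measurableT_comp => //.
exact: xi_adapted.
Qed.

Let xirK j t : `| `|xi j t| `^ r | <= K%:R.
Proof. by rewrite ger0_norm ?powR_ge0. Qed.

Let Xrint j : P.-integrable setT (EFin \o (fun t => `|X j t| `^ r)).
Proof.
rewrite (_ : (fun t => _) = (fun t => `|xi j t| `^ r) \* Z j); last first.
  by apply/funext => t; rewrite XrE.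
apply: (integrableM_bounded (Zint j) _ (xirK j)).
by have := adapted_measurable gen_meas (@xir_adapted j).
Qed.

Let xir_int j : P.-integrable setT (EFin \o (fun t => `|xi j t| `^ r)).
Proof. by apply: integrable_bounded (xirK j); by have := adapted_measurable gen_meas (@xir_adapted j). Qed.

(** [kappa K] minus [Z j] has a nonnegative integral over every event known at time j, hence also
    against the bounded nonnegative weight |xi|^r. *)
Let Xr_le j : \int[P]_t (`|X j t| `^ r) <= kappa K * \int[P]_t (`|xi j t| `^ r).
Proof.
rewrite (@eq_Rintegral _ _ _ P setT (fun t => `|xi j t| `^ r * Z j t)); last first.
  by move=> t _; rewrite XrE.
have i1 : P.-integrable setT (EFin \o (fun t => `|xi j t| `^ r * Z j t)).
  apply: (integrableM_bounded (Zint j) _ (xirK j)).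
  by have := adapted_measurable gen_meas (@xir_adapted j).
rewrite -(RintegralZl (mu := P) (kappa K) measurableT (xir_int j)) -subr_ge0.
have /= <- := RintegralB (mu := P) measurableT (integrableZR (kappa K) (xir_int j)) i1.
rewrite (@eq_Rintegral _ _ _ P setT (fun t => `|xi j t| `^ r * (kappa K - Z j t))); last first.
  by move=> t _; rewrite mulrBr mulrC.
have iK : P.-integrable setT (EFin \o (fun=> kappa K)).
  by apply: (@integrable_bounded _ _ _ P (fun=> kappa K) `|kappa K|) => //; exact: measurable_cst.
apply: (@Rintegral_ge0_bounded_multiplier _ _ _ P _ (@mgen j) _ _ K%:R).
- exact: integrableBR iK (Zint j).
- move=> A GA; have mA := mgen GA.
  have iZA : P.-integrable A (EFin \o Z j) by apply: integrableS (Zint j).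
  have iKA : P.-integrable A (EFin \o (fun=> kappa K)) by apply: integrableS iK.
  have -> := RintegralB (mu := P) mA iKA iZA.
  rewrite Rintegral_cst// -Rintegral_mkcondr subr_ge0.
  have GAH : <<s gen j>> (A `&` H j K).
    by apply: (@measurableI _ (g_sigma_algebraType (gen j))) => //; have := @Hgen j K.
  have [_ h] := HmomR GAH (@subIsetr _ _ _).
  apply: le_trans h _; apply: ler_wpM2l => //; apply: fine_le.
  + by apply: fin_num_measure; have := mgen GAH.
  + exact: fin_num_measure.
  + by apply: le_measure; rewrite ?inE//; have := mgen GAH.
- by apply/adaptedP; exact: xir_adapted.
- by move=> t; rewrite powR_ge0 xi_powR.
Qed.

Let Xr_sum n : \sum_(j < n) \int[P]_t (`|X j t| `^ r) <= kappa K * K%:R.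
Proof.
apply: (@le_trans _ _ (kappa K * \sum_(j < n) \int[P]_t (`|xi j t| `^ r))).
  by rewrite mulr_sumr; apply: ler_sum => j _; exact: Xr_le.
apply: ler_wpM2l => //.
have -> : \sum_(j < n) \int[P]_t (`|xi j t| `^ r) =
    \int[P]_t (\sum_(j < n) (`|xi j t| `^ r)).
  elim: n => [|n IH].
    rewrite big_ord0 (@eq_Rintegral _ _ _ P setT (fun=> 0)) ?Rintegral_cst ?mul0r//.
    by move=> t _ /=; rewrite big_ord0.
  rewrite big_ord_recr/= IH -RintegralD//.
    by apply: eq_Rintegral => t _; rewrite big_ord_recr.
  exact: (integrable_sumR (X := fun j t => `|xi j t| `^ r)).
rewrite -[leRHS]mulr1 -[X in _ <= _ * X](_ : fine (P setT) = 1); last by rewrite probability_setT.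
rewrite -(Rintegral_cst P measurableT); apply: le_Rintegral => //.
  exact: (integrable_sumR (X := fun j t => `|xi j t| `^ r)).
by apply: (@integrable_bounded _ _ _ P (fun=> K%:R) `|K%:R|) => //; exact: measurable_cst.
Qed.

Lemma localized_transform_cvg : {ae P, forall t,
  cvgn (fun n => \sum_(j < n) g j t * (loc j t)%:R * D j t)}.
Proof.
apply: (martingale_series_cvg gen_mono gen_meas (X := X) r1 r2 _ _ _ Xrint Xr_sum).
- move=> n; apply: (integrableM_bounded (Dint n) _ (xi_bound n)).
  by have := adapted_measurable gen_meas (@xi_adapted n).
- move=> n; apply: measurable_funM; last exact: Dadapted.
  by have := adapted_leq gen_mono (leqnSn n) (@xi_adapted n).
- move=> n eta aeta eta1.
  rewrite (@eq_Rintegral _ _ _ P setT (fun t => (eta t * xi n t) * D n t)); last first.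
    by move=> t _; rewrite /X mulrA.
  apply: (Rintegral_bounded_multiplier_eq0 gen_meas (n := n) (M := 1 + K%:R)) => //.
  + exact: D0.
  + by apply: measurable_funM; [exact: aeta|exact: xi_adapted].
  + by move=> t; rewrite normrM -[leRHS]mul1r; apply: ler_pM.
Qed.

End Localized.

Lemma martingale_transform_cvg : {ae P, forall t,
  (exists K, forall n, H n K t) ->
  (exists M, forall n, \sum_(j < n) `|g j t| `^ r <= M) ->
  cvgn (fun n => \sum_(j < n) g j t * D j t)}.
Proof.
have := ae_foralln localized_transform_cvg; apply: filterS => t ht [K hK] [M hM].
have [K' KK' MK'] : exists2 K', (K <= K')%N & M <= K'%:R.
  exists (maxn K (Num.truncn `|M|).+1); first exact: leq_maxl.
  apply: (@le_trans _ _ ((Num.truncn `|M|).+1)%:R); last by rewrite ler_nat leq_maxr.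
  by have /truncn_itv/andP[_ /ltW] := normr_ge0 M; apply: le_trans; exact: ler_norm.
rewrite (_ : (fun n => _) = fun n => \sum_(j < n) g j t *
    ((t \in H j K') && (\sum_(i < j.+1) `|g i t| `^ r <= K'%:R))%:R * D j t) => //.
apply/funext => n; apply: eq_bigr => j _.
rewrite mem_set; last exact: (Hmono KK').
by rewrite (le_trans (hM _) MK') mulr1.
Qed.

End MartingaleTransform.

(** * Negligible sequences *)

Section Negligible.
Variable R : realType.
Implicit Types x y a b h : nat -> R.

(* x = o(a) up to a bounded error; this stays meaningful when a is bounded. *)
Definition negl x a :=
  forall e : R, 0 < e -> exists C : R, forall n, `|x n| <= C + e * a n.

Definition vanish h := forall e : R, 0 < e -> exists N, forall n, (N <= n)%N -> `|h n| <= e.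

Lemma negl_le x y a : (forall n, `|x n| <= `|y n|) -> negl y a -> negl x a.
Proof.
by move=> xy ny e /ny[C hC]; exists C => n; apply: le_trans (xy n) (hC n).
Qed.

Lemma negl_ext x y a : x =1 y -> negl x a -> negl y a.
Proof. by move=> xy; apply: negl_le => n; rewrite xy. Qed.

Lemma neglD x y a : negl x a -> negl y a -> negl (fun n => x n + y n) a.
Proof.
move=> nx ny e e0; have e2 : 0 < e / 2 by rewrite divr_gt0.
have [C1 h1] := nx _ e2; have [C2 h2] := ny _ e2.
exists (C1 + C2) => n; apply: le_trans (ler_normD _ _) _.
by have := h1 n; have := h2 n; lra.
Qed.

Lemma neglZ k x a : (forall n, 0 <= a n) -> negl x a -> negl (fun n => k * x n) a.
Proof.
move=> a0 nx e e0.
have k1 : 0 < `|k| + 1 by have := normr_ge0 k; lra.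
have [C h] := nx _ (divr_gt0 e0 k1).
exists (`|k| * `|C|) => n; rewrite normrM.
apply: (@le_trans _ _ (`|k| * (`|C| + e / (`|k| + 1) * a n))).
  by apply: ler_wpM2l => //; apply: le_trans (h n) _; rewrite lerD2r ler_norm.
rewrite mulrDr lerD2l mulrA ler_wpM2r// mulrA ler_pdivrMr// mulrC ler_wpM2l//; lra.
Qed.

Lemma neglN x a : negl x a -> negl (fun n => - x n) a.
Proof. by apply: negl_le => n; rewrite normrN. Qed.

Lemma neglB x y a : negl x a -> negl y a -> negl (fun n => x n - y n) a.
Proof. by move=> nx ny; apply: neglD => //; exact: neglN. Qed.

Lemma negl_bounded x a (C : R) :
  (forall n, 0 <= a n) -> (forall n, `|x n| <= C) -> negl x a.
Proof.
move=> a0 xC e e0; exists C => n; apply: le_trans (xC n) _.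
by rewrite lerDl mulr_ge0// ltW.
Qed.

Lemma negl_sum (I : Type) (s : seq I) (x : I -> nat -> R) a :
  (forall n, 0 <= a n) ->
  (forall i, negl (x i) a) -> negl (fun n => \sum_(i <- s) x i n) a.
Proof.
move=> a0 nx; elim: s => [|i s IH].
  by apply: (negl_bounded (C := 0)) => // n; rewrite big_nil normr0.
by apply: negl_ext (neglD (nx i) IH) => n; rewrite big_cons.
Qed.

Lemma negl_weight x a b (C K : R) : 0 <= K ->
  (forall n, a n <= C + K * b n) -> (forall n, 0 <= b n) -> negl x a -> negl x b.
Proof.
move=> K0 ab b0 nx e e0.
have k1 : 0 < K + 1 by lra.
have e1 := divr_gt0 e0 k1.
have [C' h] := nx _ e1; exists (C' + e / (K + 1) * C) => n.
apply: le_trans (h n) _; rewrite -addrA lerD2l.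
apply: (@le_trans _ _ (e / (K + 1) * (C + K * b n))).
  by rewrite ler_wpM2l// ltW.
rewrite mulrDr lerD2l mulrA ler_wpM2r// mulrAC ler_pdivrMr// ler_wpM2l//; [exact: ltW|lra].
Qed.

Lemma negl_shift x a (C : R) : (forall n, a n.+1 <= C + a n) -> (forall n, 0 <= a n) ->
  negl x a -> negl (fun n => x n.+1) a.
Proof.
move=> aC a0 nx e e0; have [C' h] := nx _ e0; exists (C' + e * C) => n.
apply: le_trans (h n.+1) _; rewrite -addrA lerD2l -mulrDr ler_wpM2l//; exact: ltW.
Qed.

Lemma negl_pred x a i : (forall n, 0 <= a n) -> {homo a : n m / (n <= m)%N >-> n <= m} ->
  negl x a -> negl (fun n => x (n - i)%N) a.
Proof.
move=> a0 ai nx e e0; have [C' h] := nx _ e0; exists C' => n.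
apply: le_trans (h _) _; rewrite lerD2l ler_wpM2l//; [exact: ltW|].
by apply: ai; exact: leq_subr.
Qed.

Lemma sum_ord_homo x : (forall j, 0 <= x j) ->
  {homo (fun n => \sum_(j < n) x j) : n m / (n <= m)%N >-> n <= m}.
Proof.
move=> x0; apply: homo_leq => // [y|n]; first exact: le_trans.
by rewrite big_ord_recr lerDl.
Qed.

Lemma sum_split_le x N n : \sum_(j < n) `|x j| <=
  \sum_(j < N) `|x j| + \sum_(j < n | (N <= j)%N) `|x j|.
Proof.
rewrite [X in _ + X]big_mkcond/=.
have x0 j : 0 <= (if (N <= j)%N then `|x j| else 0) by case: ifP.
elim: n => [|n IH]; first by rewrite !big_ord0 addr0 sumr_ge0.
have [Nn|nN] := leqP N n.
  by rewrite !big_ord_recr/= Nn addrA lerD2r.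
have h : \sum_(j < n.+1) `|x j| <= \sum_(j < N) `|x j|.
  exact: (sum_ord_homo (x := fun j => `|x j|)).
by apply: le_trans h _; rewrite lerDl sumr_ge0.
Qed.

(** The finitely many terms before h becomes small go into the constant. *)
Lemma negl_sum_vanish h x a (C K : R) : vanish h -> 0 <= K ->
  (forall n, 0 <= x n) -> (forall n, 0 <= a n) ->
  (forall n, \sum_(j < n) x j <= C + K * a n) ->
  negl (fun n => \sum_(j < n) h j * x j) a.
Proof.
move=> vh K0 x0 a0 xa e e0.
have k1 : 0 < K + 1 by lra.
have e1 := divr_gt0 e0 k1.
have [N hN] := vh _ e1.
exists (\sum_(j < N) `|h j * x j| + e / (K + 1) * C) => n.
apply: (le_trans (ler_norm_sum _ _ _)).
apply: (le_trans (sum_split_le (fun j => h j * x j) N n)); rewrite -addrA lerD2l.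
apply: (@le_trans _ _ (e / (K + 1) * \sum_(j < n) x j)).
  rewrite mulr_sumr big_mkcond/=; apply: ler_sum => j _; case: ifP => [Nj|_].
    by rewrite normrM (ger0_norm (x0 j)) ler_wpM2r// hN.
  by rewrite mulr_ge0// ltW.
apply: (@le_trans _ _ (e / (K + 1) * (C + K * a n))).
  by rewrite ler_wpM2l// ltW.
rewrite mulrDr lerD2l mulrA ler_wpM2r// mulrAC ler_pdivrMr// ler_wpM2l//; [exact: ltW|lra].
Qed.

(** Kronecker's lemma with a bounded error. If r_n is the weighted series minus its limit, then S_n
    - a_n r_n changes in one step by -(a_(n+1) - a_n) r_n, eventually at most e/2 times the increase
    of a; earlier terms go into the constant. *)
Lemma kronecker x a : (forall n, 0 < a n) -> (forall n, a n <= a n.+1) ->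
  cvgn (fun n => \sum_(j < n) x j / a j.+1) ->
  negl (fun n => \sum_(j < n) x j) a.
Proof.
move=> a0 ai cs e e0.
set s := fun n => _ in cs.
have e2 : 0 < e / 2 by rewrite divr_gt0.
have /cvgrPdist_lt/(_ _ e2)[N _ hN] := cs.
pose r n := s n - limn s.
have rN n : (N <= n)%N -> `|r n| <= e / 2.
  by move=> Nn; rewrite distrC ltW//; exact: hN.
pose S n := \sum_(j < n) x j.
pose C := `|S N - a N * r N|.
have key k : `|S (N + k)%N - a (N + k)%N * r (N + k)%N| <= C + e / 2 * a (N + k)%N.
  elim: k => [|k IH]; first by rewrite addn0 lerDl mulr_ge0 ?ltW.
  rewrite addnS; set n := (N + k)%N in IH *.
  have -> : S n.+1 - a n.+1 * r n.+1 = (S n - a n * r n) - (a n.+1 - a n) * r n.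
    rewrite /S /r /s !big_ord_recr/=; set t := limn _.
    by field; rewrite gt_eqF.
  apply: le_trans (ler_normB _ _) _.
  have ri := rN n (leq_addr _ _).
  have : `|(a n.+1 - a n) * r n| <= (a n.+1 - a n) * (e / 2).
    rewrite normrM ger0_norm ?subr_ge0//.
    by apply: ler_wpM2l ri; rewrite subr_ge0.
  lra.
exists (C + \sum_(j < N) `|x j|) => n.
have sn0 : 0 <= \sum_(j < N) `|x j| by apply: sumr_ge0.
have [Nn|nN] := leqP N n; last first.
  apply: (le_trans (ler_norm_sum _ _ _)).
  have h : \sum_(j < n) `|x j| <= \sum_(j < N) `|x j|.
    by apply: (sum_ord_homo (x := fun j => `|x j|)) => //; exact: ltnW.
  have := normr_ge0 (S N - a N * r N); rewrite -/C.
  by have := mulr_ge0 (ltW e0) (ltW (a0 n)); lra.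
have := key (n - N)%N; rewrite subnKC// => h.
have : `|a n * r n| <= e / 2 * a n.
  rewrite normrM ger0_norm ?(ltW (a0 _))// mulrC.
  by apply: ler_wpM2r; [rewrite ltW|exact: rN].
have := ler_normD (S n - a n * r n) (a n * r n); rewrite subrK /S; lra.
Qed.

Section Telescoping.
Variable g : nat -> R.
Hypothesis g0 : forall n, 0 <= g n.
Let a n := 1 + \sum_(j < n) g j.

Let aS n : a n.+1 = a n + g n.
Proof. by rewrite /a big_ord_recr/= addrA. Qed.

Let a1 n : 1 <= a n. Proof. by rewrite lerDl sumr_ge0. Qed.

(** Each term is at most 1/a_n - 1/a_(n+1). *)
Lemma sum_div_sqr_le n : \sum_(j < n) g j / (1 + \sum_(i < j.+1) g i) ^+ 2 <= 1.
Proof.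
suff : \sum_(j < n) g j / a j.+1 ^+ 2 <= 1 - (a n)^-1.
  by move=> h; apply: le_trans h _; rewrite gerBl invr_ge0 (le_trans ler01 (a1 n)).
elim: n => [|n IH]; first by rewrite big_ord0 /a big_ord0 addr0 invr1 subrr.
rewrite big_ord_recr/=; apply: le_trans (lerD IH (lexx _)) _.
have h0 := g0 n; have h1 := a1 n; have h2 := aS n.
have -> : g n = a n.+1 - a n by rewrite h2 addrAC subrr add0r.
have h3 : 1 <= a n.+1 by exact: a1.
set u := a n in h1 h2 *; set v := a n.+1 in h2 h3 *.
have -> : 1 - v^-1 = 1 - u^-1 + (v - u) / (u * v).
  by field; apply/andP; split; rewrite gt_eqF//; lra.
rewrite lerD2l; apply: ler_wpM2l; first by lra.
by rewrite lef_pV2 ?posrE ?mulr_gt0 ?exprn_gt0//; [apply: ler_wpM2r; lra|lra..].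
Qed.

(** Discrete comparison with the integral of t^(-r): each term is at most the decrease of
    a^(1-r)/(r-1). *)
Lemma sum_div_powR_le (r : R) n : 1 < r ->
  \sum_(j < n) g j / (1 + \sum_(i < j.+1) g i) `^ r <= (r - 1)^-1.
Proof.
move=> r1; have s0 : 0 < r - 1 by lra.
suff : \sum_(j < n) g j / a j.+1 `^ r <= (r - 1)^-1 * (1 - a n `^ (1 - r)).
  move=> h; apply: le_trans h _; rewrite ler_piMr// ?invr_ge0; first lra.
  by rewrite gerBl powR_ge0.
elim: n => [|n IH]; first by rewrite big_ord0 /a big_ord0 addr0 powR1 subrr mulr0.
rewrite big_ord_recr/=; apply: le_trans (lerD IH (lexx _)) _.
have h0 := g0 n; have h1 := a1 n; have h2 := aS n.
have h3 : 1 <= a n.+1 by exact: a1.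
have -> : g n = a n.+1 - a n by rewrite h2 addrAC subrr add0r.
set u := a n in h1 h2 *; set v := a n.+1 in h2 h3 *.
have u0 : 0 < u by lra. have v0 : 0 < v by lra.
have uv : u <= v by lra.
have vr : v `^ (1 - r) = v / v `^ r.
  by rewrite powRB ?powRr1 ?(ltW v0)//; apply/implyP => _; rewrite gt_eqF.
(* (u/v)^(1-r) is the exponential of (1-r) ln(u/v); it is bounded below by exp x >= 1 + x and
   ln(u/v) <= u/v - 1. *)
have key : v `^ (1 - r) * (1 + (r - 1) * (1 - u / v)) <= u `^ (1 - r).
  have -> : u `^ (1 - r) = v `^ (1 - r) * (u / v) `^ (1 - r).
    by rewrite -powRM// ?divr_ge0 ?ltW// mulrCA mulfV ?gt_eqF// mulr1.
  apply: ler_wpM2l; first exact: powR_ge0.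
  have uv0 : 0 < u / v by rewrite divr_gt0.
  rewrite /powR gt_eqF//; apply: le_trans (expR_ge1Dx _).
  rewrite lerD2l.
  have hl : ln (u / v) <= u / v - 1.
    have := @le_ln1Dx R (u / v - 1); rewrite [1 + _]addrC subrK; apply.
    by rewrite ltrBrDr addNr.
  have := ler_wpM2l (ltW s0) hl; lra.
have : v `^ (1 - r) * (1 + (r - 1) * (1 - u / v)) =
    v `^ (1 - r) + (r - 1) * ((v - u) / v `^ r).
  by rewrite vr; field; rewrite !gt_eqF// powR_gt0.
move=> E; rewrite E in key.
rewrite -(ler_pM2l s0) mulrDr !mulrA mulfV ?gt_eqF// !mul1r.
lra.
Qed.

End Telescoping.
End Negligible.

(** * Positive definite matrices *)

Section Euclidean.
Variable R : realType.

Definition dot m (x y : 'cV[R]_m) : R := \sum_i x i 0 * y i 0.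
Definition nsq m (x : 'cV[R]_m) : R := dot x x.

Lemma dotE m (x y : 'cV[R]_m) : (x^T *m y) 0 0 = dot x y.
Proof. by rewrite mxE; apply: eq_bigr => i _; rewrite mxE. Qed.

Lemma dotC m (x y : 'cV[R]_m) : dot x y = dot y x.
Proof. by apply: eq_bigr => i _; rewrite mulrC. Qed.

Lemma dotDl m (x y z : 'cV[R]_m) : dot (x + y) z = dot x z + dot y z.
Proof. by rewrite -big_split; apply: eq_bigr => i _; rewrite mxE mulrDl. Qed.

Lemma dotZl m k (x z : 'cV[R]_m) : dot (k *: x) z = k * dot x z.
Proof. by rewrite mulr_sumr; apply: eq_bigr => i _; rewrite mxE mulrA. Qed.

Lemma dotDr m (x y z : 'cV[R]_m) : dot z (x + y) = dot z x + dot z y.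
Proof. by rewrite dotC dotDl !(dotC _ z). Qed.

Lemma dotZr m k (x z : 'cV[R]_m) : dot z (k *: x) = k * dot z x.
Proof. by rewrite dotC dotZl dotC. Qed.

Lemma dot0l m (z : 'cV[R]_m) : dot 0 z = 0.
Proof. by apply: big1 => i _; rewrite mxE mul0r. Qed.

Lemma dot0r m (z : 'cV[R]_m) : dot z 0 = 0.
Proof. by rewrite dotC dot0l. Qed.

Lemma dotNl m (x z : 'cV[R]_m) : dot (- x) z = - dot x z.
Proof. by rewrite -scaleN1r dotZl mulN1r. Qed.

Lemma dotNr m (x z : 'cV[R]_m) : dot z (- x) = - dot z x.
Proof. by rewrite dotC dotNl dotC. Qed.

Lemma dotBl m (x y z : 'cV[R]_m) : dot (x - y) z = dot x z - dot y z.
Proof. by rewrite dotDl dotNl. Qed.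

Lemma dotBr m (x y z : 'cV[R]_m) : dot z (x - y) = dot z x - dot z y.
Proof. by rewrite dotDr dotNr. Qed.

Lemma dot_suml m (I : Type) (s : seq I) (x : I -> 'cV[R]_m) (z : 'cV[R]_m) :
  dot (\sum_(i <- s) x i) z = \sum_(i <- s) dot (x i) z.
Proof.
elim: s => [|i s IH]; first by rewrite !big_nil dot0l.
by rewrite !big_cons dotDl IH.
Qed.

Lemma dot_sumr m (I : Type) (s : seq I) (x : I -> 'cV[R]_m) (z : 'cV[R]_m) :
  dot z (\sum_(i <- s) x i) = \sum_(i <- s) dot z (x i).
Proof. by rewrite dotC dot_suml; apply: eq_bigr => i _; rewrite dotC. Qed.

Lemma dot_mulmx m n (A : 'M[R]_(m, n)) (x : 'cV[R]_m) (y : 'cV[R]_n) :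
  dot x (A *m y) = dot (A^T *m x) y.
Proof. by rewrite -!dotE trmx_mul trmxK mulmxA. Qed.

Lemma nsq_ge0 m (x : 'cV[R]_m) : 0 <= nsq x.
Proof. by apply: sumr_ge0 => i _; rewrite -expr2 sqr_ge0. Qed.

Lemma nsq_eq0 m (x : 'cV[R]_m) : nsq x = 0 -> x = 0.
Proof.
move=> /eqP; rewrite psumr_eq0 => [/allP h|i _]; last by rewrite -expr2 sqr_ge0.
apply/matrixP => i j; rewrite ord1 mxE.
by have /implyP/(_ isT) := h i (mem_index_enum _); rewrite mulf_eq0 orbb => /eqP.
Qed.

Lemma nsq_coord m (x : 'cV[R]_m) i : x i 0 ^+ 2 <= nsq x.
Proof.
rewrite /nsq /dot (bigD1 i)//= -expr2 lerDl; apply: sumr_ge0 => j _.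
by rewrite -expr2 sqr_ge0.
Qed.

Lemma nsqZ m k (x : 'cV[R]_m) : nsq (k *: x) = k ^+ 2 * nsq x.
Proof. by rewrite /nsq dotZl dotZr mulrA expr2. Qed.

Lemma nsqN m (x : 'cV[R]_m) : nsq (- x) = nsq x.
Proof. by rewrite /nsq dotNl dotNr opprK. Qed.

Lemma nsq0 m : nsq (0 : 'cV[R]_m) = 0.
Proof. exact: dot0l. Qed.

Lemma nsqD m (x y : 'cV[R]_m) : nsq (x + y) = nsq x + 2 * dot x y + nsq y.
Proof. by rewrite /nsq !dotDl !dotDr (dotC y x); ring. Qed.

Lemma nsqD_le m (x y : 'cV[R]_m) : nsq (x + y) <= 2 * nsq x + 2 * nsq y.
Proof.
have := nsq_ge0 (x - y); rewrite !nsqD nsqN dotNr; lra.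
Qed.

Lemma cauchy_schwarz_dot m (x y : 'cV[R]_m) : dot x y ^+ 2 <= nsq x * nsq y.
Proof.
have [y0|y0] := eqVneq (nsq y) 0.
  by rewrite (nsq_eq0 y0) dot0r nsq0 mulr0 expr0n.
have yp : 0 < nsq y by rewrite lt0r y0 nsq_ge0.
have := nsq_ge0 (nsq y *: x - dot x y *: y).
rewrite nsqD nsqN !nsqZ dotNr dotZl dotZr.
have -> : nsq y ^+ 2 * nsq x + 2 * - (nsq y * (dot x y * dot x y)) + dot x y ^+ 2 * nsq y =
  nsq y * (nsq x * nsq y - dot x y ^+ 2) by ring.
by rewrite pmulr_rge0// subr_ge0.
Qed.

Lemma qf_upper_bound m (M : 'M[R]_m) :
  exists2 C : R, 0 <= C & forall x, dot x (M *m x) <= C * nsq x.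
Proof.
exists (\sum_i \sum_j `|M i j|) => [|x].
  by apply: sumr_ge0 => i _; apply: sumr_ge0.
rewrite /dot mulr_suml; apply: ler_sum => i _; rewrite mxE mulr_sumr mulr_suml.
apply: ler_sum => j _; apply: le_trans (ler_norm _) _.
rewrite mulrCA normrM; apply: ler_wpM2l => //.
rewrite normrM -/(nsq x).
have := nsq_coord x i; have := nsq_coord x j.
rewrite -(real_normK (num_real (x i 0))) -(real_normK (num_real (x j 0))).
have := sqr_ge0 (`|x i 0| - `|x j 0|); lra.
Qed.

Section Definite.
Variables (m : nat) (G : 'M[R]_m) (lam : R).
Hypothesis Gsym : G^T = G.
Hypothesis lam0 : 0 < lam.
Hypothesis Glow : forall x, lam * nsq x <= dot x (G *m x).

Lemma definite_unitmx : G \in unitmx.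
Proof.
rewrite -row_free_unit -kermx_eq0; apply/rowV0P => v /sub_kermxP vG.
have : lam * nsq v^T <= 0.
  apply: le_trans (Glow _) _.
  by rewrite -{1}Gsym -trmx_mul vG trmx0 dot0r.
rewrite pmulr_rle0// => v0; apply: trmx_inj; rewrite trmx0; apply: nsq_eq0.
by apply/eqP; rewrite eq_le v0 nsq_ge0.
Qed.

Let y (z : 'cV[R]_m) := invmx G *m z.

Lemma mulmx_invmxE (z : 'cV[R]_m) : G *m (invmx G *m z) = z.
Proof. by rewrite mulmxA mulmxV ?mul1mx// definite_unitmx. Qed.

Lemma invmx_sym : (invmx G)^T = invmx G.
Proof. by rewrite trmx_inv Gsym. Qed.

Lemma dot_invmxE z : dot z (invmx G *m z) = dot (y z) (G *m y z).
Proof. by rewrite mulmx_invmxE dotC. Qed.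

Lemma dot_invmx_ge0 z : 0 <= dot z (invmx G *m z).
Proof.
by rewrite dot_invmxE; apply: le_trans (Glow _); rewrite mulr_ge0 ?nsq_ge0// ltW.
Qed.

Lemma nsq_invmx_le z : lam * nsq (invmx G *m z) <= dot z (invmx G *m z).
Proof. by rewrite dot_invmxE. Qed.

Lemma dot_invmx_le z : lam * dot z (invmx G *m z) <= nsq z.
Proof.
have h := nsq_invmx_le z.
have := nsq_ge0 (z - lam *: (invmx G *m z)).
rewrite nsqD nsqN nsqZ dotNr dotZr.
have : lam * (lam * nsq (invmx G *m z)) <= lam * dot z (invmx G *m z).
  by apply: ler_wpM2l => //; exact: ltW.
rewrite expr2 -mulrA; lra.
Qed.

(** With y = G^-1 z, positivity of G at y - z/Lam gives 2 |z|^2/Lam - z^T G z/Lam^2 <= z^T y; the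
    upper bound on G at z finishes. *)
Lemma nsq_le_dot_invmx (Lam : R) : 0 < Lam -> (forall x, dot x (G *m x) <= Lam * nsq x) ->
  forall z, nsq z <= Lam * dot z (invmx G *m z).
Proof.
move=> L0 Gup z.
have := Glow (y z - Lam^-1 *: z).
have h : 0 <= lam * nsq (y z - Lam^-1 *: z) by rewrite mulr_ge0 ?nsq_ge0// ltW.
move=> /(le_trans h); rewrite mulmxBr -scalemxAr mulmx_invmxE.
have E : dot (y z) (G *m z) = nsq z by rewrite dot_mulmx Gsym mulmx_invmxE.
rewrite dotBl !dotBr !dotZl !dotZr E -/(nsq z) (dotC (y z) z).
have : Lam^-1 * (Lam^-1 * dot z (G *m z)) <= Lam^-1 * nsq z.
  apply: ler_wpM2l; first by rewrite invr_ge0 ltW.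
  by rewrite ler_pdivrMl.
move=> h1 h2.
have : Lam^-1 * nsq z <= dot z (y z) by lra.
by rewrite ler_pdivrMl.
Qed.

Lemma invmx_eq (x b : 'cV[R]_m) : G *m x = b -> invmx G *m b = x.
Proof. by move=> <-; rewrite mulmxA mulVmx ?mul1mx// definite_unitmx. Qed.

Section RankOne.
Variables (z S : 'cV[R]_m) (w : R).
Let G' := G + z *m z^T.
Let S' := S + w *: z.
Let h := dot z (invmx G *m z).
Let f := dot S (invmx G *m z).
Let beta := invmx G *m S.

Lemma rank_one_mulmx (x : 'cV[R]_m) : G' *m x = G *m x + dot z x *: z.
Proof.
rewrite mulmxDl -mulmxA; congr (_ + _).
by rewrite [z^T *m x]mx11_scalar dotE mul_mx_scalar.
Qed.

Lemma rank_one_sym : G'^T = G'.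
Proof. by rewrite linearD/= Gsym trmx_mul trmxK. Qed.

Lemma rank_one_low x : lam * nsq x <= dot x (G' *m x).
Proof.
rewrite rank_one_mulmx dotDr dotZr (dotC x z) -expr2.
by apply: le_trans (Glow x) _; rewrite lerDl sqr_ge0.
Qed.

Lemma dot_S_beta : dot z beta = f.
Proof. by rewrite /beta /f dot_mulmx invmx_sym dotC. Qed.

End RankOne.
End Definite.

Section Update.
Variables (m : nat) (G : 'M[R]_m) (lam : R).
Hypothesis Gsym : G^T = G.
Hypothesis lam0 : 0 < lam.
Hypothesis Glow : forall x, lam * nsq x <= dot x (G *m x).
Variables (z S : 'cV[R]_m) (w : R).
Let G' := G + z *m z^T.
Let S' := S + w *: z.
Let h := dot z (invmx G *m z).
Let f := dot S (invmx G *m z).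
Let beta := invmx G *m S.
Let h0 : 0 <= h := dot_invmx_ge0 Gsym lam0 Glow z.
Let h1 : 1 + h != 0. Proof. by rewrite gt_eqF// (lt_le_trans ltr01)// lerDl. Qed.

(** Checked by substitution: the right-hand side solves the linear system with matrix [G'] and
    right-hand side [S']. *)
Lemma rank_one_beta :
  invmx G' *m S' = beta + ((w - f) / (1 + h)) *: (invmx G *m z).
Proof.
apply: (invmx_eq (rank_one_sym Gsym z) lam0 (rank_one_low Glow z)).
rewrite mulmxDr !rank_one_mulmx -scalemxAr !(mulmx_invmxE Gsym lam0 Glow) dotZr -/h.
rewrite [dot z beta](dot_S_beta Gsym z S) -/f -addrA /S' -!scalerDl; congr (_ + _ *: _).
by field.
Qed.

Lemma rank_one_lyapunov :
  dot S' (invmx G' *m S') = dot S beta - f ^+ 2 / (1 + h)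
    + 2 * (w * (f / (1 + h))) + w ^+ 2 * (h / (1 + h)).
Proof.
rewrite rank_one_beta /S' dotDl !dotDr !dotZl !dotZr [dot z beta](dot_S_beta Gsym z S) -/f -/h.
by field.
Qed.

End Update.

(** Two block triangular factorizations of one matrix, one for each diagonal block that can be
    eliminated. *)
Lemma det_rank_one m (y z : 'cV[R]_m) : \det (1%:M + y *m z^T) = 1 + dot z y.
Proof.
pose A : 'M[R]_(1 + m) := block_mx 1%:M (- z^T) y 1%:M.
have E1 : A = block_mx 1%:M 0 y 1%:M *m block_mx 1%:M (- z^T) 0 (1%:M + y *m z^T).
  rewrite mulmx_block !(mul1mx, mulmx1, mul0mx, mulmx0, addr0, add0r).
  by rewrite mulmxN addrCA addNr addr0.
have E2 : A = block_mx 1%:M (- z^T) 0 1%:M *m block_mx (1%:M + z^T *m y) 0 y 1%:M.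
  rewrite mulmx_block !(mul1mx, mulmx1, mul0mx, mulmx0, addr0, add0r).
  by rewrite mulNmx addrK.
have : \det A = \det A by [].
rewrite {1}E1 E2 !det_mulmx !det_ublock !det_lblock !det1 !mul1r mulr1.
move=> ->; rewrite det_mx11 mxE; congr (_ + _); last by rewrite dotE.
by rewrite mxE.
Qed.

Lemma det_update m (G : 'M[R]_m) (z : 'cV[R]_m) : G \in unitmx ->
  \det (G + z *m z^T) = \det G * (1 + dot z (invmx G *m z)).
Proof.
move=> uG; rewrite -det_rank_one -det_mulmx mulmxDr mulmx1.
by rewrite !mulmxA mulmxV// mul1mx.
Qed.

Lemma dot_col_mx m1 m2 (x x' : 'cV[R]_m1) (y y' : 'cV[R]_m2) :
  dot (col_mx x y) (col_mx x' y') = dot x x' + dot y y'.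
Proof.
rewrite /dot big_split_ord/=; congr (_ + _); apply: eq_bigr => i _.
  by rewrite !col_mxEu.
by rewrite !col_mxEd.
Qed.

Lemma dot_scalar_mx (a b : R) : dot (a%:M : 'cV[R]_1) b%:M = a * b.
Proof. by rewrite /dot big_ord1 !mxE/= !mulr1n. Qed.

(** Stands in for the product of the eigenvalues. Eliminating the first coordinate gives det G = a
    det K, with a the corner entry and K its Schur complement; both inherit the bounds lam and
    Lam. *)
Lemma det_bounds m (G : 'M[R]_m) (lam Lam : R) : G^T = G -> 0 < lam ->
  (forall x, lam * nsq x <= dot x (G *m x)) ->
  (forall x, dot x (G *m x) <= Lam * nsq x) ->
  lam ^+ m <= \det G /\ \det G <= Lam ^+ m.
Proof.
elim: m G => [|m IH] G Gsym lam0 low up; first by rewrite det_mx00 !expr0.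
pose G1 : 'M[R]_(1 + m) := G.
pose al := ulsubmx G1; pose v := dlsubmx G1; pose H := drsubmx G1.
have vT : ursubmx G1 = v^T by rewrite /v trmx_dlsub (Gsym : G1^T = G1).
have HT : H^T = H by rewrite /H trmx_drsub (Gsym : G1^T = G1).
pose a : R := al 0 0.
have GE : G1 = block_mx a%:M v^T v H by rewrite -vT -mx11_scalar submxK.
have qf s x : dot (col_mx s%:M x) (G1 *m col_mx s%:M x) =
    a * s ^+ 2 + 2 * s * dot v x + dot x (H *m x).
  rewrite GE mul_block_col dot_col_mx -scalar_mxM mul_mx_scalar.
  rewrite [v^T *m x]mx11_scalar dotE !dotDr !dot_scalar_mx dotZr (dotC x v); ring.
have nq s x : nsq (col_mx (s%:M : 'cV[R]_1) x) = s ^+ 2 + nsq x.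
  by rewrite /nsq dot_col_mx dot_scalar_mx expr2.
have a_low : lam <= a.
  have := low (col_mx 1%:M 0 : 'cV[R]_(1 + m)).
  by rewrite (qf 1 0) nq nsq0 dot0r mulmx0 dot0r expr1n; lra.
have a_up : a <= Lam.
  have := up (col_mx 1%:M 0 : 'cV[R]_(1 + m)).
  by rewrite (qf 1 0) nq nsq0 dot0r mulmx0 dot0r expr1n; lra.
have a0 : 0 < a by exact: lt_le_trans a_low.
pose K := H - a^-1 *: (v *m v^T).
have KT : K^T = K by rewrite /K linearB linearZ/= HT trmx_mul trmxK.
have Kq x : dot x (K *m x) = dot x (H *m x) - a^-1 * dot v x ^+ 2.
  rewrite mulmxBl -scalemxAl -mulmxA [v^T *m x]mx11_scalar dotE mul_mx_scalar.
  by rewrite dotBr !dotZr (dotC x v) expr2.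
have K_low x : lam * nsq x <= dot x (K *m x).
  (* The first coordinate -(v^T x)/a minimizes the form of G over that coordinate, and the minimum
     is the form of K. *)
  have := low (col_mx (- (a^-1 * dot v x))%:M x : 'cV[R]_(1 + m)).
  rewrite (qf _ x) nq Kq => h.
  have : 0 <= lam * (- (a^-1 * dot v x)) ^+ 2 by rewrite mulr_ge0 ?sqr_ge0// ltW.
  have E : a * (- (a^-1 * dot v x)) ^+ 2 + 2 * - (a^-1 * dot v x) * dot v x =
    - (a^-1 * dot v x ^+ 2) by field; rewrite gt_eqF.
  by move: h; rewrite E; lra.
have K_up x : dot x (K *m x) <= Lam * nsq x.
  have := up (col_mx 0%:M x : 'cV[R]_(1 + m)).
  rewrite (qf 0 x) nq Kq expr0n/= => h.
  have : 0 <= a^-1 * dot v x ^+ 2 by rewrite mulr_ge0 ?sqr_ge0// invr_ge0 ltW.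
  lra.
have [IH1 IH2] := IH K KT lam0 K_low K_up.
have GK : \det G = a * \det K.
  have -> : \det G = \det G1 by [].
  have -> : G1 = block_mx 1%:M 0 (a^-1 *: v) 1%:M *m block_mx a%:M v^T 0 K.
    rewrite mulmx_block !(mul1mx, mul0mx, mulmx0, addr0) GE.
    by rewrite mul_mx_scalar scalerA mulfV ?gt_eqF// scale1r -scalemxAl addrC subrK.
  by rewrite det_mulmx det_ublock det_lblock !det1 !mul1r det_scalar1.
rewrite GK !exprS; split; apply: ler_pM => //.
- exact: ltW.
- by rewrite exprn_ge0// ltW.
- exact: ltW.
- by apply: le_trans IH1; rewrite exprn_ge0// ltW.
Qed.

(** An upper bound C for the form of M^-1 yields the lower bound 1/(C+1) for that of M: use
    positivity of M at x - M^-1 x/(C+1). *)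
Lemma posdef_lower_bound m (M : 'M[R]_m) : sym_posdef M ->
  exists2 c : R, 0 < c & forall x, c * nsq x <= dot x (M *m x).
Proof.
move=> [Msym Mpos].
have Mp x : x != 0 -> 0 < dot x (M *m x).
  by move=> /Mpos; rewrite -mulmxA dotE.
have M0 x : 0 <= dot x (M *m x).
  have [->|/Mp/ltW//] := eqVneq x 0; by rewrite dot0l.
have uM : M \in unitmx.
  rewrite -row_free_unit -kermx_eq0; apply/rowV0P => v /sub_kermxP vM.
  apply/eqP/negPn/negP => v0.
  have : v^T != 0 by apply: contra v0 => /eqP h; rewrite -[v]trmxK h trmx0.
  by move=> /Mp; rewrite -{1}Msym -trmx_mul vM trmx0 dot0r ltxx.
have [C C0 hC] := qf_upper_bound (invmx M).
have K0 : 0 < C + 1 by lra.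
exists (C + 1)^-1 => [|x]; first by rewrite invr_gt0.
pose y := invmx M *m x.
have My : M *m y = x by rewrite mulmxA mulmxV// mul1mx.
have yM : dot y x <= (C + 1) * nsq x.
  rewrite dotC; apply: le_trans (hC x) _; apply: ler_wpM2r; [exact: nsq_ge0|lra].
have := M0 (x - (C + 1)^-1 *: y).
rewrite mulmxBr -scalemxAr My dotBl !dotBr !dotZl !dotZr -/(nsq x).
have -> : dot y (M *m x) = nsq x by rewrite dot_mulmx Msym My.
have : (C + 1)^-1 * ((C + 1)^-1 * dot y x) <= (C + 1)^-1 * nsq x.
  by apply: ler_wpM2l; rewrite ?invr_ge0 ?(ltW K0)// ler_pdivrMl.
lra.
Qed.

End Euclidean.

(** * Measurability of matrix-valued maps *)

Section MeasurableMatrix.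
Context d (T : measurableType d) (R : realType).

Definition mx_measurable m n (M : T -> 'M[R]_(m, n)) :=
  forall i j, measurable_fun setT (fun t => M t i j).

Lemma mx_measurable_cst m n (A : 'M[R]_(m, n)) : mx_measurable (fun=> A).
Proof. by move=> i j; exact: measurable_cst. Qed.

Lemma mx_measurable_tr m n (M : T -> 'M[R]_(m, n)) :
  mx_measurable M -> mx_measurable (fun t => (M t)^T).
Proof.
move=> mM i j; rewrite (_ : (fun t => _) = fun t => M t j i); first exact: mM.
by apply/funext => t; rewrite mxE.
Qed.

Lemma mx_measurableD m n (M N : T -> 'M[R]_(m, n)) :
  mx_measurable M -> mx_measurable N -> mx_measurable (fun t => M t + N t).
Proof.
move=> mM mN i j; rewrite (_ : (fun t => _) = (fun t => M t i j + N t i j)).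
  by apply: measurable_funD; [exact: mM|exact: mN].
by apply/funext => t; rewrite mxE.
Qed.

Lemma mx_measurableZ m n (f : T -> R) (M : T -> 'M[R]_(m, n)) :
  measurable_fun setT f -> mx_measurable M -> mx_measurable (fun t => f t *: M t).
Proof.
move=> mf mM i j; rewrite (_ : (fun t => _) = (fun t => f t * M t i j)).
  by apply: measurable_funM => //; exact: mM.
by apply/funext => t; rewrite mxE.
Qed.

Lemma mx_measurableM m n k (M : T -> 'M[R]_(m, n)) (N : T -> 'M[R]_(n, k)) :
  mx_measurable M -> mx_measurable N -> mx_measurable (fun t => M t *m N t).
Proof.
move=> mM mN i j; rewrite (_ : (fun t => _) = (fun t => \sum_l M t i l * N t l j)).
  apply: measurable_sum => l.
  by apply: measurable_funM; [exact: mM|exact: mN].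
by apply/funext => t; rewrite mxE.
Qed.

Lemma mx_measurable_sum m n k (M : nat -> T -> 'M[R]_(m, n)) :
  (forall i, (i < k)%N -> mx_measurable (M i)) -> mx_measurable (fun t => \sum_(i < k) M i t).
Proof.
move=> mM i j; rewrite (_ : (fun t => _) = (fun t => \sum_(l < k) M l t i j)).
  by apply: measurable_sum => l; exact: mM.
by apply/funext => t; rewrite summxE.
Qed.

Lemma measurable_det m (M : T -> 'M[R]_m) :
  mx_measurable M -> measurable_fun setT (fun t => \det (M t)).
Proof.
move=> mM; apply: measurable_sum => s; apply: measurable_funM; first exact: measurable_cst.
by apply: measurable_prod => i _; exact: mM.
Qed.

Lemma measurable_inv (f : T -> R) : measurable_fun setT f -> (forall t, 0 <= f t) ->
  measurable_fun setT (fun t => (f t)^-1).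
Proof.
move=> mf f0; rewrite (_ : (fun t => _) = fun t => f t `^ (-1)); last first.
  by apply/funext => t; rewrite powR_inv1.
exact: (measurableT_comp (measurable_powR (-1))).
Qed.

(** By the cofactor formula the entries are rational functions of those of M; a positive determinant
    excludes the default value of [invmx]. *)
Lemma mx_measurable_inv m (M : T -> 'M[R]_m) : (forall t, 0 < \det (M t)) ->
  mx_measurable M -> mx_measurable (fun t => invmx (M t)).
Proof.
move=> M0 mM i j.
rewrite (_ : (fun t => _) = (fun t => (\det (M t))^-1 * cofactor (M t) j i)).
  apply: measurable_funM.
    by apply: measurable_inv => [|t]; [exact: measurable_det|exact: ltW].
  apply: measurable_funM; first exact: measurable_cst.
  apply: measurable_det => k l.
  by rewrite (_ : (fun t => _) = (fun t => M t (lift j k) (lift i l))) //; apply/funext => t; rewrite !mxE.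
apply/funext => t; rewrite /invmx unitmxE unitfE gt_eqF//.
by rewrite mxE mxE.
Qed.

Lemma measurable_dot m (x y : T -> 'cV[R]_m) : mx_measurable x -> mx_measurable y ->
  measurable_fun setT (fun t => dot (x t) (y t)).
Proof.
move=> mx my; apply: measurable_sum => i.
by apply: measurable_funM; [exact: mx|exact: my].
Qed.

End MeasurableMatrix.

(** * Martingale laws for the noise *)

Section Noise.
Context d (T : measurableType d) (R : realType).
Variable P : probability T R.
Variable w : int -> {RV P >-> R}.

Definition noise_gen (n : nat) : set (set T) :=
  [set A | exists k : nat, [/\ (1 <= k)%N, (k <= n)%N &
        exists2 B : set R, measurable B & A = w k%:Z @^-1` B]].

Lemma noise_gen_mono n : noise_gen n `<=` noise_gen n.+1.
Proof. by move=> A [k [k1 kn h]]; exists k; split => //; rewrite (leq_trans kn). Qed.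

Lemma noise_gen_meas n : noise_gen n `<=` measurable.
Proof.
move=> A [k [_ _ [B mB ->]]]; rewrite -[X in measurable X]setTI.
exact: (measurable_funPT (w k%:Z)).
Qed.

Local Notation adapted := (adapted (R := R) noise_gen).

Lemma noise_adapted k n : (1 <= k)%N -> (k <= n)%N -> adapted n (w k%:Z).
Proof.
move=> k1 kn; apply/adaptedP => B mB; apply: sub_sigma_algebra.
by exists k; split => //; exists B.
Qed.

Variable sigma2 : R.
Hypothesis hsigma2 : 0 < sigma2.
Hypothesis hmean : forall n : nat,
  cond_exp P (noise_filtration w n) (w (n.+1)%:Z) (fun=> 0).
Hypothesis hvar : forall n : nat,
  cond_exp P (noise_filtration w n)
    (fun t => w (n.+1)%:Z t ^+ 2) (fun=> sigma2).

Lemma noise_sq_integral n A : <<s noise_gen n>> A ->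
  (\int[P]_(t in A) (`|w (n.+1)%:Z t| `^ 2)%:E = sigma2%:E * P A)%E.
Proof.
move=> GA; have mA : measurable A by have := gen_measurable noise_gen_meas GA.
have [_ _ _ h] := hvar n.
rewrite -(integral_cst P mA) -(h A GA).
by apply: eq_integral => t _; rewrite powR_mulrn// real_normK ?num_real.
Qed.

Lemma noise_transform_cvg (g : nat -> T -> R) : (forall n, adapted n (g n)) ->
  {ae P, forall t, (exists M, forall n, \sum_(j < n) g j t ^+ 2 <= M) ->
    cvgn (fun n => \sum_(j < n) g j t * w (j.+1)%:Z t)}.
Proof.
move=> ag.
have := @martingale_transform_cvg _ _ _ P _ noise_gen_mono noise_gen_meas
  (fun n => w (n.+1)%:Z) 2 (fun _ _ => setT) (fun=> sigma2) _ _ _ _ _ _ _ _ _ g ag.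
have H : (1 : R) <= 2 /\ (2 : R) <= 2 by rewrite ler1n lexx.
case: H => H1 H2 /(_ H1 H2) h.
have : {ae P, forall t, (exists K : nat, forall n : nat, [set: T] t) ->
    (exists M : R, forall n, \sum_(j < n) `|g j t| `^ 2 <= M) ->
    cvgn (fun n => \sum_(j < n) g j t * w j.+1 t)}.
  apply: h.
  - by move=> n; have [] := hmean n.
  - by move=> n; exact: noise_adapted.
  - move=> n A GA; have [_ _ _ h'] := hmean n.
    by rewrite /Rintegral (h' A GA) integral0.
  - by move=> n _; exact: (@measurableT _ (g_sigma_algebraType (noise_gen n))).
  - by [].
  - by move=> _; exact: ltW.
  - by move=> n K A GA _; rewrite noise_sq_integral.
apply: filterS => t ht [M hM]; apply: ht; first by exists 0%N.
exists M => n; apply: (le_trans _ (hM n)); rewrite le_eqVlt; apply/orP; left; apply/eqP.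
by apply: eq_bigr => j _; rewrite powR_mulrn// real_normK ?num_real.
Qed.

Lemma adapted_sum n m (f : nat -> T -> R) : (forall i, (i < n)%N -> adapted m (f i)) ->
  adapted m (fun t => \sum_(i < n) f i t).
Proof. by move=> af; apply: measurable_sum => i; apply: af. Qed.

(** A self-normalized strong law: the weights g_n/a_(n+1) are known at time n, because a_(n+1) ends
    with g_n, and they are square summable by telescoping; Kronecker's lemma concludes. *)
Lemma noise_transform_negl (g : nat -> T -> R) : (forall n, adapted n (g n)) ->
  {ae P, forall t, negl (fun n => \sum_(j < n) g j t * w (j.+1)%:Z t)
    (fun n => 1 + \sum_(j < n) g j t ^+ 2)}.
Proof.
move=> ag.
pose a n t := 1 + \sum_(j < n) g j t ^+ 2.
have a1 n t : 1 <= a n t by rewrite lerDl sumr_ge0// => i _; exact: sqr_ge0.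
have aa n : adapted n (a n.+1).
  apply: measurable_funD => //; apply: (adapted_sum (f := fun i t => g i t ^+ 2)) => i.
  rewrite ltnS => le_in; apply: measurable_funX.
  by have := adapted_leq noise_gen_mono le_in (@ag i).
have ah n : adapted n (fun t => g n t / a n.+1 t).
  apply: measurable_funM; first exact: ag.
  apply: measurable_inv => [|t]; first exact: aa.
  exact: le_trans ler01 (a1 _ t).
have := @noise_transform_cvg (fun n t => g n t / a n.+1 t) ah; apply: filterS => t ht.
apply: (@kronecker _ (fun j => g j t * w j.+1 t) (a ^~ t)) => [n|n|].
- exact: lt_le_trans ltr01 (a1 n t).
- by rewrite lerD2l big_ord_recr lerDl sqr_ge0.
rewrite (_ : (fun n => _) = (fun n => \sum_(j < n) g j t / a j.+1 t * w j.+1 t)); last first.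
  by apply/funext => n; apply: eq_bigr => j _; rewrite mulrAC.
apply: ht; exists 1 => n.
apply: (le_trans _ (sum_div_sqr_le (fun j => sqr_ge0 (g j t)) n)).
by apply: ler_sum => j _; rewrite exprMn exprVn.
Qed.

Variable nu : R.
Hypothesis hnu : 2 < nu.
Variable V : nat -> T -> \bar R.
Hypothesis hV : forall n : nat,
  cond_exp_ge0 P (noise_filtration w n)
    (fun t => `|w (n.+1)%:Z t| `^ nu) (V n).
Hypothesis hmom :
  {ae P, forall t, (ereal_sup (range (fun n : nat => V n t)) < +oo)%E}.

(** The exponent for the centred squares: 2r <= nu lets the nu-th moment of the noise control their
    r-th moment, r <= 2 is what the gauge admits, and r > 1 makes the telescoping bound for powers
    finite. *)
Let r : R := Num.min (nu / 2) 2.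
Let r1 : 1 < r.
Proof. by rewrite lt_min ltr_pdivlMr// mul1r hnu ltr1n. Qed.
Let r2 : r <= 2.
Proof. by rewrite ge_min lexx orbT. Qed.
Let rnu : 2 * r <= nu.
Proof. by rewrite mulrC -ler_pdivlMr// ge_min lexx. Qed.

Let c1 : R := (2 * sigma2) `^ r + 2 `^ r.
Let c10 : 0 <= c1. Proof. by rewrite addr_ge0// powR_ge0. Qed.

Let centered_sq_powR (x : R) : `|x ^+ 2 - sigma2| `^ r <= c1 * (1 + `|x| `^ nu).
Proof.
have r0 : 0 <= r by apply: ltW; apply: lt_trans r1.
have nn := powR_ge0 `|x| nu.
have := sqr_ge0 x; have [xs|sx] := leP (x ^+ 2) sigma2 => x2.
  apply: (@le_trans _ _ ((2 * sigma2) `^ r)).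
    by apply: ge0_ler_powR; rewrite ?nnegrE//; [lra|rewrite ler_norml; apply/andP; split; lra].
  have := powR_ge0 2 r; have := powR_ge0 (2 * sigma2) r; rewrite /c1.
  by move=> h1 h2; rewrite -[leLHS]mulr1; apply: ler_pM => //; lra.
apply: (@le_trans _ _ ((2 * x ^+ 2) `^ r)).
  have h : `|x ^+ 2 - sigma2| <= 2 * x ^+ 2.
    have s0 := hsigma2; rewrite ler_norml; move: (x ^+ 2) x2 sx => y y0 sy.
    by apply/andP; split; lra.
  by apply: ge0_ler_powR; rewrite ?nnegrE// mulr_ge0.
rewrite powRM//; apply: ler_pM; rewrite ?powR_ge0// ?lerDr ?powR_ge0//.
rewrite -real_normK ?num_real// -powR_mulrn// -powRrM.
have [x1|x1] := leP 1 `|x|.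
  by have := ler_powR x1 rnu; lra.
have : `|x| `^ (2 * r) <= 1; last by lra.
have E : (1 : R) `^ (2 * r) = 1 by rewrite powR1.
rewrite -[leRHS]E.
by apply: ge0_ler_powR; rewrite ?nnegrE ?mulr_ge0// ltW.
Qed.

Lemma noise_sq_transform_cvg (g : nat -> T -> R) : (forall n, adapted n (g n)) ->
  {ae P, forall t, (exists M, forall n, \sum_(j < n) `|g j t| `^ r <= M) ->
    cvgn (fun n => \sum_(j < n) g j t * (w (j.+1)%:Z t ^+ 2 - sigma2))}.
Proof.
move=> ag.
have h : {ae P, forall t, (exists K : nat, forall n : nat, [set t | (V n t <= K%:R%:E)%E] t) ->
    (exists M : R, forall n, \sum_(j < n) `|g j t| `^ r <= M) ->
    cvgn (fun n => \sum_(j < n) g j t * (w j.+1 t ^+ 2 - sigma2))}.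
  apply: (@martingale_transform_cvg _ _ _ P _ noise_gen_mono noise_gen_meas
  (fun n t => w (n.+1)%:Z t ^+ 2 - sigma2) r (fun n K => [set t | (V n t <= K%:R%:E)%E])
  (fun K => c1 * (1 + K%:R)) (ltW r1) r2) => //.
  - by move=> n; have [h1 h2 _ _] := hvar n; exact: integrableBR h1 h2.
  - move=> n; apply: measurable_funB => //; apply: measurable_funX; exact: noise_adapted.
  - move=> n A GA; have [h1 h2 _ h] := hvar n.
    have mA : measurable A by have := gen_measurable noise_gen_meas GA.
    have i1 : P.-integrable A (EFin \o (fun t => w n.+1 t ^+ 2)) by apply: integrableS h1.
    have i2 : P.-integrable A (EFin \o (fun=> sigma2)) by apply: integrableS h2.
    have /= -> := RintegralB (mu := P) mA i1 i2.
    by rewrite /Rintegral h ?subrr//; exact: GA.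
  - move=> n K; have [_ _ h _] := hV n.
    have := h `]-oo, K%:R%:E]%classic (emeasurable_itv _).
    rewrite (_ : V n @^-1` _ = [set t | (V n t <= K%:R%:E)%E]) => [h'|]; first exact: h'.
    by apply/seteqP; split => t /=; rewrite in_itv.
  - by move=> n K K' KK' t /= h; apply: le_trans h _; rewrite lee_fin ler_nat.
  - by move=> K; rewrite mulr_ge0// addr_ge0.
  - move=> n K A GA AH.
    have mA : measurable A by have := gen_measurable noise_gen_meas GA.
    have [_ V0 Vm hVn] := hV n.
    have mw : measurable_fun setT (fun t => `|w n.+1 t| `^ nu).
      apply: (measurableT_comp (measurable_powR nu)); apply: measurableT_comp => //.
    have mwA : measurable_fun A (fun t => `|w n.+1 t| `^ nu) by exact: measurable_funTS.
    have md : measurable_fun A (fun t => `|w n.+1 t ^+ 2 - sigma2| `^ r).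
      apply: measurable_funTS.
      apply: (measurableT_comp (measurable_powR r)); apply: measurableT_comp => //.
      apply: measurable_funB => //; exact: measurable_funX.
    apply: (@le_trans _ _ (\int[P]_(t in A) (c1 * (1 + `|w n.+1 t| `^ nu))%:E)%E).
      have m1 : measurable_fun A (EFin \o (fun t => `|w n.+1 t ^+ 2 - sigma2| `^ r)).
        exact: measurableT_comp.
      have m2 : measurable_fun A (EFin \o (fun t => c1 * (1 + `|w n.+1 t| `^ nu))).
        by apply: measurableT_comp => //; apply: measurable_funM => //; apply: measurable_funD.
      apply: (ge0_le_integral P mA _ m1 m2) => t _; first by rewrite lee_fin powR_ge0.
      by rewrite lee_fin; exact: centered_sq_powR.
    have m3 : measurable_fun A (EFin \o (fun t => 1 + `|w n.+1 t| `^ nu)).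
      by apply: measurableT_comp => //; apply: measurable_funD.
    have m4 : measurable_fun A (EFin \o (fun t => `|w n.+1 t| `^ nu)).
      exact: measurableT_comp.
    under eq_integral do rewrite EFinM.
    rewrite (ge0_integralZl P mA m3); first last.
    + by rewrite lee_fin.
    + by move=> t _; rewrite lee_fin addr_ge0// powR_ge0.
    rewrite EFinM -muleA; apply: lee_wpmul2l; first by rewrite lee_fin.
    rewrite (eq_integral (fun t => (1%:E + (`|w n.+1 t| `^ nu)%:E)%E)); last by move=> t _; rewrite /= EFinD.
    rewrite (ge0_integralD (f1 := fun=> 1%:E) P mA _ _ _ m4)//; last first.
      by move=> t _; rewrite lee_fin powR_ge0.
    rewrite integral_cst// mul1e EFinD ge0_muleDl ?lee_fin// mul1e; apply: leeD2l.
    rewrite (hVn A GA) -integral_cst//.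
    have mV : measurable_fun A (V n).
      apply: measurable_funTS => _ B mB; rewrite setTI.
      by have := gen_measurable noise_gen_meas (Vm B mB).
    by apply: (ge0_le_integral P mA _ mV) => // t /AH.
apply: filterS2 h hmom => t ht Vt hM; apply: ht => //.
have Vle n : (V n t <= ereal_sup (range (fun n => V n t)))%E.
  by apply: ereal_sup_ubound; exists n.
set s := ereal_sup _ in Vt Vle.
have s0 : (0 <= s)%E by apply: (le_trans _ (Vle 0%N)); have [_ V0 _ _] := hV 0%N; exact: V0.
have sf : s \is a fin_num by rewrite ge0_fin_numE.
exists (Num.truncn (fine s)).+1 => n /=; apply: le_trans (Vle n) _.
rewrite -(fineK sf) lee_fin.
by have /truncn_itv/andP[_ /ltW] : 0 <= fine s by exact: fine_ge0.
Qed.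

(** Absolutely summable weights are r-summable: if the sum is at most M, then |g_j|^r <= M^(r-1)
    |g_j|. *)
Lemma noise_sq_transform_cvg1 (g : nat -> T -> R) : (forall n, adapted n (g n)) ->
  {ae P, forall t, (exists M, forall n, \sum_(j < n) `|g j t| <= M) ->
    cvgn (fun n => \sum_(j < n) g j t * (w (j.+1)%:Z t ^+ 2 - sigma2))}.
Proof.
move=> /noise_sq_transform_cvg; apply: filterS => t ht [M hM]; apply: ht.
have gM j : `|g j t| <= M.
  by apply: (le_trans _ (hM j.+1)); rewrite big_ord_recr/= lerDr sumr_ge0.
have M0 : 0 <= M by apply: (le_trans _ (gM 0%N)).
exists (M `^ (r - 1) * M) => n.
apply: (le_trans _ (ler_wpM2l (powR_ge0 _ _) (hM n))); rewrite mulr_sumr.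
apply: ler_sum => j _; have [->|g0] := eqVneq `|g j t| 0.
  by rewrite powR0 ?mulr0// gt_eqF// (lt_trans ltr01 r1).
have -> : `|g j t| `^ r = `|g j t| `^ (r - 1) * `|g j t|.
  have := @powRD _ `|g j t| (r - 1) 1; rewrite g0 implybT subrK powRr1//; exact.
apply: ler_wpM2r => //.
by apply: ge0_ler_powR; rewrite ?nnegrE// subr_ge0 ltW.
Qed.

(** The argument of [noise_transform_negl] with exponent r; weights at most 1 satisfy g^r <= g, so
    the telescoping bound for powers applies. *)
Lemma noise_sq_transform_negl (g : nat -> T -> R) : (forall n, adapted n (g n)) ->
  (forall n t, 0 <= g n t <= 1) ->
  {ae P, forall t, negl (fun n => \sum_(j < n) g j t * (w (j.+1)%:Z t ^+ 2 - sigma2))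
    (fun n => 1 + \sum_(j < n) g j t)}.
Proof.
move=> ag g01.
have g0 j t : 0 <= g j t by have /andP[] := g01 j t.
pose a n t := 1 + \sum_(j < n) g j t.
have a1 n t : 1 <= a n t by rewrite lerDl sumr_ge0.
have aa n : adapted n (a n.+1).
  apply: measurable_funD => //; apply: (adapted_sum (f := g)) => i.
  rewrite ltnS => le_in.
  by have := adapted_leq noise_gen_mono le_in (@ag i).
have ah n : adapted n (fun t => g n t / a n.+1 t).
  apply: measurable_funM; first exact: ag.
  apply: measurable_inv => [|t]; first exact: aa.
  exact: le_trans ler01 (a1 _ t).
have := @noise_sq_transform_cvg (fun n t => g n t / a n.+1 t) ah; apply: filterS => t ht.
apply: (@kronecker _ (fun j => g j t * (w j.+1 t ^+ 2 - sigma2)) (a ^~ t)) => [n|n|].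
- exact: lt_le_trans ltr01 (a1 n t).
- by rewrite lerD2l big_ord_recr lerDl g0.
rewrite (_ : (fun n => _) =
  (fun n => \sum_(j < n) g j t / a j.+1 t * (w j.+1 t ^+ 2 - sigma2))); last first.
  by apply/funext => n; apply: eq_bigr => j _; rewrite mulrAC.
apply: ht; exists ((r - 1)^-1) => n.
apply: (le_trans _ (sum_div_powR_le (fun j => g0 j t) n r1)).
apply: ler_sum => j _.
have a0 : 0 < a j.+1 t by exact: lt_le_trans ltr01 (a1 _ t).
rewrite ger0_norm ?divr_ge0 ?(ltW a0)// powRM ?invr_ge0 ?(ltW a0)//.
rewrite -powR_inv1 ?(ltW a0)// -powRrM mulN1r powRN.
apply: ler_wpM2r; first by rewrite invr_ge0 powR_ge0.
have [->|gn0] := eqVneq (g j t) 0; first by rewrite powR0// gt_eqF// (lt_trans ltr01 r1).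
have /andP[_ gle1] := g01 j t.
rewrite -[leRHS]powRr1//; apply: ger_powR; last exact: ltW.
by rewrite gle1 lt0r gn0 g0.
Qed.

End Noise.

(** * Stable filters *)

Section Filter.
Variable K : comNzRingType.
Implicit Types (F G : {poly K}) (v : int -> K).

(* Convertible to shift_app over a real field, but also needed over the complex
   numbers, where B splits. *)
Definition filt F v (n : int) : K := \sum_(i < size F) F`_i * v (n - (i : nat)%:Z).

Lemma filt_wide N F v n : (size F <= N)%N ->
  filt F v n = \sum_(i < N) F`_i * v (n - (i : nat)%:Z).
Proof.
move=> FN; rewrite /filt -(big_mkord xpredT (fun i => F`_i * v (n - i%:Z))).
rewrite -(big_mkord xpredT (fun i => F`_i * v (n - i%:Z))).
rewrite [RHS](@big_cat_nat _ _ _ (size F))//=.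
rewrite [X in _ + X]big_nat_cond [X in _ + X]big1 ?addr0// => i /andP[/andP[h _] _].
by rewrite nth_default// mul0r.
Qed.

Lemma filtDl F G v n : filt (F + G) v n = filt F v n + filt G v n.
Proof.
have h := size_polyD F G; set N := maxn _ _ in h.
rewrite (filt_wide v n h) (filt_wide (N := N) v n (leq_maxl _ _)).
rewrite (filt_wide (N := N) v n (leq_maxr _ _)) -big_split.
by apply: eq_bigr => i _; rewrite coefD mulrDl.
Qed.

Lemma filt0l v n : filt 0 v n = 0.
Proof. by rewrite /filt size_poly0 big_ord0. Qed.

Lemma filtC c v n : filt c%:P v n = c * v n.
Proof.
rewrite (filt_wide (N := 1) v n); last exact: size_polyC_leq1.
by rewrite big_ord1 coefC subr0.
Qed.

Lemma filtZl c F v n : filt (c *: F) v n = c * filt F v n.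
Proof.
rewrite (filt_wide (N := size F) v n); last exact: size_scale_leq.
by rewrite /filt mulr_sumr; apply: eq_bigr => i _; rewrite coefZ mulrA.
Qed.

Lemma filtMX F v n : filt (F * 'X) v n = filt F v (n - 1).
Proof.
rewrite (filt_wide (N := (size F).+1) v n); last first.
  have [->|F0] := eqVneq F 0; first by rewrite mul0r size_poly0.
  by rewrite size_mulX.
rewrite big_ord_recl coefMX mul0r add0r; apply: eq_bigr => i _.
by rewrite coefMX /= -addrA -opprD -intS; congr (_ * v (n - _)); rewrite /bump/= add1n.
Qed.

Lemma filtM F G v n : filt (F * G) v n = filt F (filt G v) n.
Proof.
elim/poly_ind: F n => [|F c IH] n; first by rewrite mul0r !filt0l.
by rewrite mulrDl -mulrA (mulrC 'X) mulrA !filtDl !filtMX IH mul_polyC filtZl filtC.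
Qed.

Lemma filt_ext F v v' n : (forall k, v k = v' k) -> filt F v n = filt F v' n.
Proof. by move=> e; apply: eq_bigr => i _; rewrite e. Qed.

Lemma filt_neg F v n : (forall k, k < 0 -> v k = 0) -> n < 0 -> filt F v n = 0.
Proof.
move=> v0 n0; apply: big1 => i _; rewrite v0 ?mulr0//.
by rewrite ltrBlDr (lt_le_trans n0).
Qed.

Lemma filtDr F v v' n : filt F (fun k => v k + v' k) n = filt F v n + filt F v' n.
Proof. by rewrite -big_split; apply: eq_bigr => i _; rewrite mulrDr. Qed.

End Filter.

(** * Inversion of a stable filter through its complex roots *)

Section Stability.
Variable R : realType.
Local Notation C := R[i].
Local Notation normc := (@ComplexField.Normc.normc R).
Implicit Types (x : int -> C) (E : nat -> R).

Lemma normc_norm (z : C) : `|z| = (normc z)%:C%C.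
Proof. by case: z. Qed.

Lemma normc_ge0 (z : C) : 0 <= normc z.
Proof. by case: z => a b; exact: sqrtr_ge0. Qed.

Lemma normcD_le (z z' : C) : normc (z + z') <= normc z + normc z'.
Proof. by rewrite -lecR rmorphD/= -!normc_norm ler_normD. Qed.

Lemma normc_opp (z : C) : normc (- z) = normc z.
Proof. by apply/eqP; rewrite eq_le -!lecR -!normc_norm normrN lexx. Qed.

Lemma normc_real (c : R) : normc (c%:C%C) = `|c|.
Proof. by rewrite /ComplexField.Normc.normc/= expr0n/= addr0 sqrtr_sqr. Qed.

(** One root at a time: the factor ['X - z%:P] sends y to y_(n-1) - z y_n, so y_n is recovered by
    dividing by z, a contraction with ratio |z|^-1 < rho. The envelope E shrinks at most by the
    factor rho per step, so the recursion preserves bounds by multiples of E. *)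
Lemma stable_roots_bound (rs : seq C) (rho : R) (E : nat -> R) x (C0 : R) :
  0 < rho -> (forall n, 0 <= E n) -> (forall n, rho * E n <= E n.+1) ->
  (forall z, z \in rs -> 0 < normc z /\ (normc z)^-1 < rho) ->
  0 <= C0 -> (forall n, n < 0 -> x n = 0) ->
  (forall n : nat, normc (filt (\prod_(z <- rs) ('X - z%:P)) x n%:Z) <= C0 * E n) ->
  exists2 C1 : R, 0 <= C1 & forall n : nat, normc (x n%:Z) <= C1 * E n.
Proof.
move=> rho0 E0 EM; elim: rs C0 => [|z rs IH] C0 hrs C00 x0 hx.
  exists C0 => // n; have := hx n; by rewrite big_nil -[1]/(1%:P) filtC mul1r.
have [zp zr] := hrs z (mem_head _ _).
pose y := filt (\prod_(z <- rs) ('X - z%:P)) x.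
have y0 n : n < 0 -> y n = 0 by exact: filt_neg.
set kap := (normc z)^-1 in zr.
have kap0 : 0 < kap by rewrite invr_gt0.
have kr : kap / rho < 1 by rewrite ltr_pdivrMr// mul1r.
have k0 : 0 < kap / rho by rewrite divr_gt0.
have dk : 0 < 1 - kap / rho by lra.
(* The fixed point of C1 = kap (C1/rho + C0), the constant that one step of the recursion
   reproduces. *)
pose C1 := kap * C0 / (1 - kap / rho).
have C1E : kap * (C1 / rho + C0) = C1.
  by rewrite /C1; field; rewrite gt_eqF//= subr_eq0 gt_eqF.
have C10 : 0 <= C1 by rewrite /C1 divr_ge0// ?mulr_ge0// ltW.
clearbody C1.
have step (n : nat) : normc (y n%:Z) <= kap * (normc (y (n%:Z - 1)) + C0 * E n).
  have := hx n; rewrite big_cons filtM -/y filtDl -[X in filt X _ _ + _]mul1r filtMX.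
  rewrite -[1]/(1%:P) filtC mul1r -polyCN filtC => h.
  have zn : normc z != 0 by rewrite gt_eqF.
  rewrite -(ler_pM2l zp) mulrA mulfV// mul1r -ComplexField.Normc.normcM.
  have -> : z * y n%:Z = y (n%:Z - 1) - (y (n%:Z - 1) + - z * y n%:Z) by ring.
  apply: le_trans (normcD_le _ _) _.
  by rewrite lerD2l normc_opp.
have yE n : normc (y n%:Z) <= C1 * E n.
  elim: n => [|n IHn].
    apply: le_trans (step 0%N) _.
    rewrite y0// ComplexField.Normc.normc0 add0r mulrA ler_wpM2r//.
    by rewrite -[leRHS]C1E; apply: ler_wpM2l; [exact: ltW|rewrite lerDr divr_ge0// ltW].
  apply: le_trans (step n.+1) _.
  rewrite -[X in _ <= X * _]C1E -mulrA; apply: ler_wpM2l; first exact: ltW.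
  rewrite mulrDl lerD2r -addn1 PoszD addrK.
  apply: le_trans IHn _; rewrite -mulrA; apply: ler_wpM2l => //.
  by rewrite ler_pdivlMl// addn1.
by apply: (IH C1) => // z' hz'; apply: hrs; rewrite inE hz' orbT.
Qed.

Lemma stable_rate (rs : seq C) : (forall z, z \in rs -> 1 < normc z) ->
  exists2 rho : R, 0 < rho < 1 & forall z, z \in rs -> 0 < normc z /\ (normc z)^-1 < rho.
Proof.
elim: rs => [|z rs IH] hrs; first by exists 2^-1 => //; apply/andP; split; lra.
have [|rho /andP[r0 r1] hr] := IH; first by move=> z' hz'; apply: hrs; rewrite inE hz' orbT.
have z1 := hrs z (mem_head _ _).
have zi : (normc z)^-1 < 1 by rewrite invf_lt1// (lt_trans ltr01).
have zp : 0 < (normc z)^-1 by rewrite invr_gt0 (lt_trans ltr01).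
exists (Num.max rho ((1 + (normc z)^-1) / 2)).
  by rewrite lt_max r0/= gt_max r1/=; lra.
move=> z'; rewrite inE => /orP[/eqP ->|/hr[h1 h2]].
  by split; [exact: lt_trans z1|rewrite lt_max; apply/orP; right; lra].
by split => //; rewrite lt_max h2.
Qed.

Lemma map_filt (F : {poly R}) (v : int -> R) n :
  (filt F v n)%:C%C = filt (map_poly (real_complex R) F) (fun k => (v k)%:C%C) n.
Proof.
rewrite /filt size_map_poly rmorph_sum; apply: eq_bigr => i _.
by rewrite rmorphM coef_map.
Qed.

(** The envelope is left free because it serves twice: powers of rho for the impulse response of
    1/B, and the exponentially smoothed noise for the ideal input. *)
Lemma stable_filter_bound (F : {poly R}) :
  (forall x : C, `|x| <= 1 -> ~~ root (map_poly (real_complex R) F) x) ->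
  exists2 rho : R, 0 < rho < 1 &
  forall E : nat -> R, (forall n, 0 <= E n) -> (forall n, rho * E n <= E n.+1) ->
  forall (C0 : R) (v : int -> R), 0 <= C0 -> (forall n, n < 0 -> v n = 0) ->
  (forall n : nat, `|filt F v n%:Z| <= C0 * E n) ->
  exists2 C1 : R, 0 <= C1 & forall n : nat, `|v n%:Z| <= C1 * E n.
Proof.
move=> hF; set G := map_poly _ F in hF.
have [rs hrs] := closed_field_poly_normal G.
have G0 : lead_coef G != 0.
  rewrite lead_coef_eq0; apply: contraTneq isT => G0.
  by have := hF 0; rewrite normr0 ler01 G0 root0 => /(_ isT).
have rs1 z : z \in rs -> 1 < normc z.
  move=> zrs; have rz : root G z by rewrite hrs rootZ// root_prod_XsubC.
  rewrite ltNge; apply/negP => z1; have h := hF z; rewrite rz in h; suff: ~~ true by []; apply: h.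
  by rewrite normc_norm -(rmorph1 (real_complex R)) lecR.
have [rho rho01 hrho] := stable_rate rs1.
exists rho => // E E0 EM C0 v C00 v0 hv.
have /andP[rho0 _] := rho01.
have lc0 : 0 < normc (lead_coef G).
  rewrite lt0r normc_ge0 andbT; apply: contra G0 => /eqP h; apply/eqP.
  exact: ComplexField.Normc.eq0_normc.
have [|||C1 C10 h] := @stable_roots_bound rs rho E (fun k => (v k)%:C%C)
    (C0 / normc (lead_coef G)) rho0 E0 EM hrho.
- by rewrite divr_ge0// ltW.
- by move=> n n0; rewrite v0.
- move=> n; have := hv n; rewrite -normc_real map_filt -/G [X in filt X _ _]hrs filtZl.
  rewrite ComplexField.Normc.normcM => h.
  by rewrite mulrAC ler_pdivlMr// mulrC.
exists C1 => // n; by have := h n; rewrite normc_real.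
Qed.

End Stability.

(** * Excitation *)

Section NegligibleMore.
Variable R : realType.
Implicit Types x y a : nat -> R.

Lemma negl_of_succ x a : (forall n, 0 <= a n) -> (forall n, a n <= a n.+1) ->
  negl (fun n => x n.+1) a -> negl x a.
Proof.
move=> a0 ai nx e e0; have [C h] := nx _ e0; exists (`|x 0%N| + `|C|) => -[|n].
  by rewrite -addrA lerDl addr_ge0// mulr_ge0// ltW.
apply: le_trans (h n) _; have := ler_norm C; have := normr_ge0 (x 0%N).
have := ler_wpM2l (ltW e0) (ai n); lra.
Qed.

Lemma sum_lag (F : int -> R) (i n : nat) : (forall k, k < 0 -> F k = 0) ->
  \sum_(j < n) F (j%:Z - i%:Z) = \sum_(j < (n - i)%N) F j%:Z.
Proof.
move=> F0; elim: n => [|n IH]; first by rewrite sub0n !big_ord0.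
rewrite big_ord_recr/= IH; have [ni|i_n] := ltnP n i.
  have -> : (n.+1 - i = 0)%N by apply/eqP; rewrite subn_eq0.
  have -> : (n - i = 0)%N by apply/eqP; rewrite subn_eq0 ltnW.
  by rewrite big_ord0 F0 ?addr0// subr_lt0.
by rewrite subSn// big_ord_recr/= subzn.
Qed.

Lemma sum_lag_le (F : int -> R) (i n : nat) : (forall k, k < 0 -> F k = 0) ->
  (forall k, 0 <= F k) -> \sum_(j < n) F (j%:Z - i%:Z) <= \sum_(j < n) F j%:Z.
Proof.
move=> F0 Fp; rewrite sum_lag//.
by apply: (sum_ord_homo (x := fun j => F j%:Z)) => //; exact: leq_subr.
Qed.

Lemma sum_ord_sqr_le (n : nat) (c x : 'I_n -> R) :
  (\sum_i c i * x i) ^+ 2 <= (\sum_i c i ^+ 2) * \sum_i x i ^+ 2.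
Proof.
have := cauchy_schwarz_dot (\col_i c i) (\col_i x i).
rewrite /nsq /dot.
under eq_bigr do rewrite !mxE.
under [X in _ <= X * _]eq_bigr do rewrite !mxE -expr2.
by under [X in _ <= _ * X]eq_bigr do rewrite !mxE -expr2.
Qed.

End NegligibleMore.

Section Noise.
Variable R : realType.
Variables (w : int -> R) (sigma2 : R).
Hypothesis sigma2_gt0 : 0 < sigma2.
Hypothesis w0 : forall n, n <= 0 -> w n = 0.
Hypothesis w_sq : negl (fun n => \sum_(j < n) (w (j.+1)%:Z ^+ 2 - sigma2)) (fun n => 1 + n%:R).
Hypothesis w_corr : forall i : nat,
  negl (fun n => \sum_(j < n) w (j%:Z - i%:Z) * w (j.+1)%:Z)
       (fun n => 1 + \sum_(j < n) w (j%:Z - i%:Z) ^+ 2).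

Local Notation nR := (fun n : nat => n%:R : R).

Lemma sum_w_sq_negl : negl (fun n => \sum_(j < n) w j%:Z ^+ 2 - sigma2 * n%:R) nR.
Proof.
apply: negl_of_succ => [n|n|]; [exact: ler0n|by rewrite ler_nat|].
have h : negl (fun n => \sum_(j < n) (w (j.+1)%:Z ^+ 2 - sigma2)) nR.
  by apply: (negl_weight (C := 1) (K := 1)) w_sq => // n; rewrite mul1r.
apply: negl_ext (neglB h (negl_bounded (x := fun=> sigma2) (a := nR) (C := `|sigma2|) _ _)) => // n.
rewrite sumrB sumr_const card_ord -mulr_natr big_ord_recl/= w0// expr0n/= add0r -natr1.
by rewrite (eq_bigr (fun i : 'I_n => w (i.+1)%:Z ^+ 2))//; ring.
Qed.

Lemma sum_w_sq_le : exists2 C : R, 0 <= C & forall n, \sum_(j < n) w j%:Z ^+ 2 <= C * (n%:R + 1).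
Proof.
have s0 := sigma2_gt0.
have [C h] := sum_w_sq_negl ltr01; exists (`|C| + sigma2 + 1) => [|n].
  by have := normr_ge0 C; lra.
have := h n; rewrite ler_norml => /andP[_]; have := ler_norm C.
have := ler0n R n; have := normr_ge0 C => h1 h2 h3.
have := mulr_ge0 h1 h2; lra.
Qed.

Lemma w_sq_negl : negl (fun n => w n%:Z ^+ 2) nR.
Proof.
have h := sum_w_sq_negl.
have h' : negl (fun n => \sum_(j < n.+1) w j%:Z ^+ 2 - sigma2 * n.+1%:R) nR.
  by apply: (negl_shift (x := fun n => \sum_(j < n) w j%:Z ^+ 2 - sigma2 * n%:R) (C := 1)) => // n;
    rewrite -natr1 addrC.
apply: negl_ext (neglD (neglB h' h) (negl_bounded (x := fun=> sigma2) (a := nR) (C := `|sigma2|) _ _)) => // n.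
by rewrite big_ord_recr/= -natr1; ring.
Qed.

(** The law of large numbers for empirical autocovariances. Shifting time by the smaller lag brings
    the off-diagonal sums to the form of [w_corr]; the noise vanishes at nonpositive times, so the
    shift leaves no boundary terms at the start. *)
Lemma w_gram_negl (i k : nat) : negl (fun n =>
  \sum_(j < n) w (j%:Z - i%:Z) * w (j%:Z - k%:Z) - sigma2 * n%:R * (i == k)%:R) nR.
Proof.
wlog ik : i k / (i <= k)%N.
  move=> H; have [|/ltnW] := leqP i k; first exact: H.
  move=> /H; apply: negl_ext => n; rewrite eq_sym; congr (_ - _).
  by apply: eq_bigr => j _; rewrite mulrC.
have wneg n : n < 0 -> w n = 0 by move=> /ltW; exact: w0.
have nR_homo : {homo nR : n m / (n <= m)%N >-> n <= m} by move=> n m; rewrite ler_nat.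
have [<-|ne] := eqVneq i k.
  have h1 := negl_pred i (fun n => ler0n R n) nR_homo sum_w_sq_negl.
  have h2 : negl (fun n => - sigma2 * (n%:R - (n - i)%:R)) nR.
    apply: neglZ => //; apply: (negl_bounded (C := i%:R)) => // n.
    have [ni|i_n] := leqP n i.
      by rewrite (eqP ni) subr0 ger0_norm// ler_nat.
    by rewrite natrB 1?ltnW// opprB addrCA subrr addr0 ger0_norm.
  apply: negl_ext (neglD h1 h2) => n /=; rewrite mulr1.
  rewrite (sum_lag (F := fun k => w k * w k)) => [|j j0]; last by rewrite wneg// mul0r.
  by under [in RHS]eq_bigr do rewrite -expr2; ring.
have {ne ik} ik : (i < k)%N by rewrite ltn_neqAle ne.
have [l kE] : exists l, k = (i + l).+1 by exists (k - i.+1)%N; rewrite -addSn subnKC.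
have h : negl (fun n => \sum_(j < n) w (j%:Z - l%:Z) * w (j.+1)%:Z) nR.
  have [C C0 hC] := sum_w_sq_le.
  apply: (negl_weight (C := 1 + C) (K := C)) (w_corr l) => // n.
  rewrite -addrA lerD2l; have := hC n; rewrite mulrDr mulr1 addrC; apply: le_trans.
  by apply: (sum_lag_le (F := fun k => w k ^+ 2)) => [j j0|j];
    [rewrite wneg// expr0n|exact: sqr_ge0].
have h' : negl (fun n => \sum_(j < n) w j%:Z * w (j%:Z - (l.+1)%:Z)) nR.
  apply: negl_of_succ => // [n|]; first by rewrite ler_nat.
  apply: negl_ext h => n; rewrite big_ord_recl/= [w 0]w0// mul0r add0r.
  apply: eq_bigr => j _; rewrite mulrC; congr (w _ * w _).
  by rewrite /bump/= !intS opprD addrACA subrr add0r.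
apply: negl_ext (negl_pred i (fun n => ler0n R n) nR_homo h') => n /=.
rewrite mulr0 subr0.
rewrite -(sum_lag (F := fun j => w j * w (j - l.+1%:Z))) => [|j j0]; last by rewrite wneg// mul0r.
by apply: eq_bigr => j _; congr (_ * w _); rewrite kE; lia.
Qed.

(** C is independent of c because |c_i c_k| is at most the sum of the squares; half of sigma^2 is
    given up to absorb the o(n) errors of the K^2 autocovariances. *)
Lemma moving_average_energy (K : nat) : exists C : R, forall (c : 'I_K -> R) (n : nat),
  (\sum_k c k ^+ 2) * (sigma2 / 2 * n%:R - C) <=
  \sum_(j < n) (\sum_k c k * w (j%:Z - (k : nat)%:Z)) ^+ 2.
Proof.
pose r (i k : 'I_K) n : R :=
  \sum_(j < n) w (j%:Z - (i : nat)%:Z) * w (j%:Z - (k : nat)%:Z) - sigma2 * n%:R * (i == k)%:R.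
pose r' n : R := \sum_i \sum_k `|r i k n|.
have nr' : negl r' nR.
  apply: negl_sum => // i; apply: negl_sum => // k.
  by apply: negl_le (w_gram_negl i k) => n; rewrite normr_id.
have s2 : 0 < sigma2 / 2 by rewrite divr_gt0.
have [C hC] := nr' _ s2; exists C => c n.
have -> : \sum_(j < n) (\sum_k c k * w (j%:Z - (k : nat)%:Z)) ^+ 2 =
  \sum_i \sum_k c i * c k * (r i k n + sigma2 * n%:R * (i == k)%:R).
  under eq_bigr do rewrite expr2 big_distrlr/=.
  rewrite exchange_big/=; apply: eq_bigr => i _.
  rewrite exchange_big/=; apply: eq_bigr => k _.
  by rewrite /r subrK mulr_sumr; apply: eq_bigr => j _; ring.
have -> : \sum_i \sum_k c i * c k * (r i k n + sigma2 * n%:R * (i == k)%:R) =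
  \sum_i \sum_k c i * c k * r i k n + sigma2 * n%:R * \sum_k c k ^+ 2.
  rewrite mulr_sumr -big_split/=; apply: eq_bigr => i _.
  under eq_bigr do rewrite mulrDr.
  rewrite big_split/=; congr (_ + _).
  rewrite (bigD1 i)//= eqxx mulr1 big1 => [|k ki].
    by rewrite addr0 expr2 mulrC.
  by rewrite eq_sym (negbTE ki) !mulr0.
set N := \sum_k c k ^+ 2.
have N0 : 0 <= N by apply: sumr_ge0 => k _; exact: sqr_ge0.
have cN i : `|c i| ^+ 2 <= N.
  rewrite real_normK ?num_real// /N (bigD1 i)//= lerDl; apply: sumr_ge0 => k _; exact: sqr_ge0.
have bnd : - (N * r' n) <= \sum_i \sum_k c i * c k * r i k n.
  suff : `|\sum_i \sum_k c i * c k * r i k n| <= N * r' n by rewrite ler_norml => /andP[].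
  rewrite /r' mulr_sumr; apply: le_trans (ler_norm_sum _ _ _) _; apply: ler_sum => i _.
  rewrite mulr_sumr; apply: le_trans (ler_norm_sum _ _ _) _; apply: ler_sum => k _.
  rewrite !normrM; apply: ler_wpM2r => //.
  have := cN i; have := cN k; have := sqr_ge0 (`|c i| - `|c k|); lra.
have := ler_wpM2l N0 (le_trans (ler_norm _) (hC n)); lra.
Qed.

End Noise.

(** * Exponential smoothing of the noise, used as an envelope *)

Section Smoothing.
Variable R : realType.
Variables (w : nat -> R) (rho : R) (E : nat -> R).
Hypothesis rho01 : 0 < rho < 1.
Hypothesis E0 : E 0%N = `|w 0%N|.
Hypothesis ES : forall n, E n.+1 = rho * E n + `|w n.+1|.

Let r0 : 0 < rho. Proof. by have /andP[] := rho01. Qed.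
Let r1 : rho < 1. Proof. by have /andP[] := rho01. Qed.
Let d0 : 0 < 1 - rho. Proof. by rewrite subr_gt0. Qed.

Lemma smooth_ge0 n : 0 <= E n.
Proof. by elim: n => [|n IH]; rewrite ?E0 ?ES// addr_ge0// mulr_ge0// ltW. Qed.

Lemma smooth_decay n : rho * E n <= E n.+1.
Proof. by rewrite ES lerDl. Qed.

Lemma smooth_ge_norm n : `|w n| <= E n.
Proof. by case: n => [|n]; rewrite ?E0 ?ES// lerDr mulr_ge0 ?smooth_ge0// ltW. Qed.

Lemma smooth_lag i n : rho ^+ i * E n <= E (n + i)%N.
Proof.
elim: i => [|i IH]; first by rewrite expr0 mul1r addn0.
rewrite addnS exprS -mulrA; apply: le_trans (smooth_decay _).
by apply: ler_wpM2l => //; exact: ltW.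
Qed.

(** Convexity of the square: rho e + v is the average of e and v/(1 - rho) with weights rho and 1 -
    rho. *)
Lemma smooth_sqr n : E n.+1 ^+ 2 <= rho * E n ^+ 2 + w n.+1 ^+ 2 / (1 - rho).
Proof.
rewrite ES -(real_normK (num_real (w n.+1))).
set e := E n; set v := `|_|; rewrite -subr_ge0.
have -> : rho * e ^+ 2 + v ^+ 2 / (1 - rho) - (rho * e + v) ^+ 2 =
    rho * (1 - rho) * (e - v / (1 - rho)) ^+ 2.
  by field; rewrite gt_eqF.
by rewrite mulr_ge0 ?sqr_ge0// mulr_ge0// ltW.
Qed.

Lemma smooth_energy n : \sum_(j < n) E j ^+ 2 <= (1 - rho)^-1 ^+ 2 * \sum_(j < n) w j ^+ 2.
Proof.
case: n => [|n]; first by rewrite !big_ord0 mulr0.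
(* The extra term -rho E_n^2 closes the induction: it cancels the rho E_n^2 that enters the bound on
   the next square. *)
suff h : (1 - rho) * \sum_(j < n.+1) E j ^+ 2 <=
    (1 - rho)^-1 * \sum_(j < n.+1) w j ^+ 2 - rho * E n ^+ 2.
  rewrite expr2 -mulrA -ler_pdivrMl ?invr_gt0// invrK; apply: le_trans h _.
  by rewrite gerBl mulr_ge0 ?sqr_ge0// ltW.
elim: n => [|n IH].
  rewrite !big_ord_recr !big_ord0/= !add0r E0 real_normK ?num_real//.
  set v := w 0%N ^+ 2.
  have v0 : 0 <= v by exact: sqr_ge0.
  have : v <= (1 - rho)^-1 * v.
    by rewrite ler_peMl// invf_ge1//; have := r0; lra.
  lra.
rewrite big_ord_recr/= [X in _ * X - _]big_ord_recr/= !mulrDr.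
have h := smooth_sqr n; rewrite mulrC in h.
rewrite [w _ ^+ 2 / _]mulrC in h.
lra.
Qed.

Lemma smooth_negl : negl (fun n => w n ^+ 2) (fun n => n%:R) ->
  negl (fun n => E n ^+ 2) (fun n => n%:R).
Proof.
move=> hw e e0.
have e1 : 0 < e * (1 - rho) ^+ 2 by rewrite mulr_gt0// exprn_gt0.
have [C hC] := hw _ e1.
pose K := `|C| / (1 - rho) ^+ 2.
exists (K + E 0%N ^+ 2) => n; rewrite ger0_norm ?sqr_ge0//.
have K0 : 0 <= K by rewrite divr_ge0// sqr_ge0.
elim: n => [|n IH]; first by rewrite mulr0 addr0 lerDr.
apply: le_trans (smooth_sqr n) _.
have h1 : w n.+1 ^+ 2 <= `|C| + e * (1 - rho) ^+ 2 * n.+1%:R.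
  have := hC n.+1; rewrite ger0_norm ?sqr_ge0// => h; apply: le_trans h _.
  by rewrite lerD2r ler_norm.
have h2 : w n.+1 ^+ 2 / (1 - rho) <= (1 - rho) * (K + e * n.+1%:R).
  rewrite ler_pdivrMr//; apply: le_trans h1 _; rewrite le_eqVlt; apply/orP; left.
  by apply/eqP; rewrite /K; field; rewrite gt_eqF.
have h3 := ler_wpM2l (ltW r0) IH.
have h4 : rho * E 0%N ^+ 2 <= E 0%N ^+ 2 by rewrite ler_piMl ?sqr_ge0// ltW.
have h5 : rho * (e * n%:R) <= rho * (e * n.+1%:R).
  by rewrite !ler_pM2l// ler_nat.
lra.
Qed.

End Smoothing.

(** * Linear growth of the matrices G_n *)

Section Gram.
Variable R : realType.
Variables (w : int -> R) (sigma2 : R).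
Hypothesis sigma2_gt0 : 0 < sigma2.
Hypothesis w0 : forall n, n <= 0 -> w n = 0.
Hypothesis w_sq : negl (fun n => \sum_(j < n) (w (j.+1)%:Z ^+ 2 - sigma2)) (fun n => 1 + n%:R).
Hypothesis w_corr : forall i : nat,
  negl (fun n => \sum_(j < n) w (j%:Z - i%:Z) * w (j.+1)%:Z)
       (fun n => 1 + \sum_(j < n) w (j%:Z - i%:Z) ^+ 2).
Variables (m : nat) (z : int -> 'cV[R]_m) (B : {poly R}) (Cp : 'I_m -> {poly R}) (K : nat).
Hypothesis zneg : forall n, n < 0 -> z n = 0.
Hypothesis zB : forall i n, filt B (fun k => z k i 0) n = filt (Cp i) w n.
Hypothesis CpK : forall i, (size (Cp i) <= K)%N.
Hypothesis Cfree : row_free (\matrix_(i < m, k < K) (Cp i)`_k).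
Variables (G0 : 'M[R]_m) (g0 : R).
Hypothesis g0_gt0 : 0 < g0.
Hypothesis G0low : forall x, g0 * nsq x <= dot x (G0 *m x).

Definition gram n := G0 + \sum_(j < n) z j%:Z *m (z j%:Z)^T.

Lemma gram_dot n x : dot x (gram n *m x) = dot x (G0 *m x) + \sum_(j < n) dot x (z j%:Z) ^+ 2.
Proof.
rewrite mulmxDl dotDr mulmx_suml dot_sumr; congr (_ + _); apply: eq_bigr => j _.
by rewrite -mulmxA [_^T *m x]mx11_scalar dotE mul_mx_scalar dotZr dotC expr2.
Qed.

Lemma gramS n : gram n.+1 = gram n + z n%:Z *m (z n%:Z)^T.
Proof. by rewrite /gram big_ord_recr addrA. Qed.

Lemma filt_dot x n : filt B (fun k => dot x (z k)) n =
  \sum_(k < K) (\sum_i x i 0 * (Cp i)`_k) * w (n - (k : nat)%:Z).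
Proof.
have -> : filt B (fun k => dot x (z k)) n = \sum_i x i 0 * filt B (fun k => z k i 0) n.
  rewrite /filt /dot; under eq_bigr do rewrite mulr_sumr.
  rewrite exchange_big/=; apply: eq_bigr => i _; rewrite mulr_sumr.
  by apply: eq_bigr => j _; rewrite mulrCA.
under eq_bigr do rewrite zB (filt_wide _ _ (CpK _)) mulr_sumr.
rewrite exchange_big/=; apply: eq_bigr => k _; rewrite mulr_suml.
by apply: eq_bigr => i _; rewrite mulrA.
Qed.

Lemma filt_energy_le (y : int -> R) n : (forall k, k < 0 -> y k = 0) ->
  \sum_(j < n) filt B y j%:Z ^+ 2 <=
  (\sum_(i < size B) B`_i ^+ 2) * (size B)%:R * \sum_(j < n) y j%:Z ^+ 2.
Proof.
move=> y0; set S := \sum_(i < size B) _.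
have S0 : 0 <= S by apply: sumr_ge0 => i _; exact: sqr_ge0.
apply: (@le_trans _ _ (\sum_(j < n) S * \sum_(i < size B) y (j%:Z - (i : nat)%:Z) ^+ 2)).
  by apply: ler_sum => j _; exact: sum_ord_sqr_le.
rewrite -mulr_sumr -mulrA; apply: ler_wpM2l => //.
rewrite exchange_big/= -[X in _ <= X%:R * _]card_ord -sum1_card natr_sum mulr_suml.
apply: ler_sum => i _; rewrite mul1r.
by apply: (sum_lag_le (F := fun k => y k ^+ 2)) => [k k0|k]; [rewrite y0// expr0n|exact: sqr_ge0].
Qed.

(** Filtering by B multiplies energy by at most KB and turns x^T z_j into a moving average with
    coefficient vector Cm^T x, whose energy is bounded below. Independence of the rows of Cm gives a
    right inverse D, hence |x|^2 <= (KD+1) |Cm^T x|^2. *)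
Lemma excitation : exists c C : R, [/\ 0 < c, 0 <= C &
  forall n x, (c * n%:R - C) * nsq x <= \sum_(j < n) dot x (z j%:Z) ^+ 2].
Proof.
have [C hC] := moving_average_energy sigma2_gt0 w0 w_sq w_corr K.
pose Cm := \matrix_(i < m, k < K) (Cp i)`_k.
have /row_freeP[D CD] : row_free Cm by exact: Cfree.
have [KD KD0 hKD] := qf_upper_bound (D *m D^T).
have nD x : nsq x <= (KD + 1) * nsq (Cm^T *m x).
  have {1}-> : x = D^T *m (Cm^T *m x) by rewrite mulmxA -trmx_mul CD trmx1 mul1mx.
  rewrite /nsq -dot_mulmx mulmxA; apply: le_trans (hKD _) _.
  by apply: ler_wpM2r; [exact: nsq_ge0|lra].
set KB := (\sum_(i < size B) B`_i ^+ 2) * (size B)%:R.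
have KB0 : 0 <= KB by rewrite mulr_ge0// sumr_ge0// => i _; exact: sqr_ge0.
have p0 : 0 < (KB + 1) * (KD + 1) by rewrite mulr_gt0//; lra.
have s0 := sigma2_gt0.
exists (sigma2 / 2 / ((KB + 1) * (KD + 1))), (`|C| / ((KB + 1) * (KD + 1))); split.
- by rewrite !divr_gt0.
- by rewrite divr_ge0// ltW.
move=> n x; set q := sigma2 / 2.
set S := \sum_(j < n) _.
have S0 : 0 <= S by apply: sumr_ge0 => j _; exact: sqr_ge0.
have -> : q / ((KB + 1) * (KD + 1)) * n%:R - `|C| / ((KB + 1) * (KD + 1)) =
   (q * n%:R - `|C|) / ((KB + 1) * (KD + 1)) by rewrite mulrBl mulrAC.
rewrite mulrAC ler_pdivrMr//.
set t := q * n%:R - `|C|.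
have [t0|t0] := leP t 0.
  apply: (@le_trans _ _ 0); last by rewrite mulr_ge0// ltW.
  by rewrite mulr_le0_ge0// nsq_ge0.
have h1 : nsq (Cm^T *m x) * t <= KB * S.
  have eB : \sum_(j < n) filt B (fun k => dot x (z k)) j%:Z ^+ 2 <= KB * S.
    by apply: filt_energy_le => k k0; rewrite zneg// dot0r.
  apply: le_trans eB; under eq_bigr do rewrite filt_dot.
  apply: le_trans (hC _ n).
  have -> : nsq (Cm^T *m x) = \sum_(k < K) (\sum_i x i 0 * (Cp i)`_k) ^+ 2.
    apply: eq_bigr => k _; rewrite -expr2 mxE; congr (_ ^+ 2).
    by apply: eq_bigr => i _; rewrite !mxE mulrC.
  apply: ler_wpM2l; first by apply: sumr_ge0 => k _; exact: sqr_ge0.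
  by rewrite lerD2l lerN2 ler_norm.
have h2 := ler_wpM2l (ltW t0) (nD x).
apply: le_trans h2 _.
have h3 : (KD + 1) * (nsq (Cm^T *m x) * t) <= (KD + 1) * (KB * S).
  by apply: ler_wpM2l => //; lra.
have h4 : 0 <= (KD + 1) * S by rewrite mulr_ge0//; lra.
lra.
Qed.

(** [G0] covers the early times, where the bound of [excitation] may be negative; the constant
    merges the factors g0 and c n - C into one multiple of n+1. *)
Lemma gram_low : exists2 c : R, 0 < c &
  forall n x, c * n.+1%:R * nsq x <= dot x (gram n *m x).
Proof.
have [c [C [c0 C0 h]]] := excitation.
have g0' := g0_gt0.
have s0 : 0 < g0 + C + c by lra.
exists (g0 * c / (g0 + C + c)) => [|n x]; first by rewrite divr_gt0// mulr_gt0.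
rewrite gram_dot; have := h n x; have := G0low x.
set S := \sum_(j < n) _; set N := nsq x.
have N0 : 0 <= N by exact: nsq_ge0.
have S0 : 0 <= S by apply: sumr_ge0 => j _; exact: sqr_ge0.
move=> h1 h2; apply: (@le_trans _ _ (g0 * N + S)); last by rewrite lerD2r.
have -> : g0 * c / (g0 + C + c) * n.+1%:R * N = g0 * (c * n.+1%:R * N) / (g0 + C + c).
  by field; rewrite gt_eqF.
rewrite ler_pdivrMr// -natr1.
have h3 := ler_wpM2l (ltW g0') h2.
have h4 : 0 <= g0 * (g0 * N) by rewrite !mulr_ge0// ltW.
have h5 : 0 <= C * S by rewrite mulr_ge0.
have h6 : 0 <= c * S by rewrite mulr_ge0// ltW.
lra.
Qed.

Variables (rho : R) (E : nat -> R) (Cz : R).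
Hypothesis rho01 : 0 < rho < 1.
Hypothesis E0 : E 0%N = `|w 0|.
Hypothesis ES : forall n, E n.+1 = rho * E n + `|w n.+1%:Z|.
Hypothesis Cz0 : 0 <= Cz.
Hypothesis zE : forall i (n : nat), `|z n%:Z i 0| <= Cz * E n.

Lemma nsq_z_le (n : nat) : nsq (z n%:Z) <= m%:R * Cz ^+ 2 * E n ^+ 2.
Proof.
rewrite -mulrA -exprMn -[X in X%:R]card_ord -sum1_card natr_sum mulr_suml.
apply: ler_sum => i _; rewrite mul1r -expr2 -real_normK ?num_real//.
have CE : 0 <= Cz * E n.
  by rewrite mulr_ge0//; exact: (smooth_ge0 (w := fun n => w n%:Z) rho01).
by apply: lerXn2r; rewrite ?nnegrE//; exact: zE.
Qed.

Lemma sum_nsq_z_le : exists2 C : R, 0 <= C & forall n, \sum_(j < n) nsq (z j%:Z) <= C * n.+1%:R.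
Proof.
have [C C0 hC] := sum_w_sq_le sigma2_gt0 w0 w_sq.
have m0 : 0 <= m%:R * Cz ^+ 2 :> R by rewrite mulr_ge0// sqr_ge0.
exists (m%:R * Cz ^+ 2 * ((1 - rho)^-1 ^+ 2 * C)) => [|n].
  by rewrite mulr_ge0// mulr_ge0// sqr_ge0.
apply: (@le_trans _ _ (m%:R * Cz ^+ 2 * \sum_(j < n) E j ^+ 2)).
  by rewrite mulr_sumr; apply: ler_sum => j _; exact: nsq_z_le.
rewrite -[leRHS]mulrA; apply: ler_wpM2l => //.
apply: le_trans (smooth_energy (w := fun n => w n%:Z) rho01 E0 ES n) _.
by rewrite -[leRHS]mulrA; apply: ler_wpM2l; [exact: sqr_ge0|rewrite -natr1].
Qed.

Lemma gram_up : exists2 C : R, 0 < C &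
  forall n x, dot x (gram n *m x) <= C * n.+1%:R * nsq x.
Proof.
have [C C0 hC] := sum_nsq_z_le.
have [Cg Cg0 hCg] := qf_upper_bound G0.
exists (C + Cg + 1) => [|n x]; first lra.
rewrite gram_dot.
have N0 := nsq_ge0 x.
have h1 : \sum_(j < n) dot x (z j%:Z) ^+ 2 <= C * n.+1%:R * nsq x.
  apply: (@le_trans _ _ (\sum_(j < n) nsq (z j%:Z) * nsq x)).
    by apply: ler_sum => j _; rewrite mulrC; exact: cauchy_schwarz_dot.
  by rewrite -mulr_suml; apply: ler_wpM2r.
have h2 := hCg x.
have n1 : 1 <= n.+1%:R :> R by rewrite ler1n.
have h3 : Cg * nsq x <= Cg * nsq x * n.+1%:R by rewrite ler_peMr// mulr_ge0.
have h4 : 0 <= nsq x * n.+1%:R by rewrite mulr_ge0.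
lra.
Qed.

Lemma E_sq_negl : negl (fun n => E n ^+ 2) (fun n => n%:R).
Proof.
have h := w_sq_negl w0 w_sq.
by have := smooth_negl (w := fun n => w n%:Z) rho01 ES h.
Qed.

End Gram.

(** * The Lyapunov identity *)

Section Asymptotics.
Variable R : realType.

(* Shifted, because ln 0 = 0 is a junk value. *)
Definition lnS (n : nat) : R := ln n.+1%:R.

Lemma lnS_ge0 n : 0 <= lnS n.
Proof. by rewrite ln_ge0// ler1n. Qed.

Lemma lnS_homo : {homo lnS : n m / (n <= m)%N >-> n <= m}.
Proof. by move=> n m nm; rewrite /lnS ler_ln ?posrE// ler_nat. Qed.

Lemma lnS_step n : lnS n.+1 <= lnS n + n.+1%:R^-1.
Proof.
have -> : lnS n.+1 = lnS n + ln (1 + n.+1%:R^-1).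
  rewrite /lnS -lnM ?posrE ?addr_gt0 ?invr_gt0//; congr ln.
  by rewrite mulrDr mulr1 mulfV ?pnatr_eq0// natr1.
by rewrite lerD2l le_ln1Dx// (lt_le_trans (ltrN10 _))// invr_ge0.
Qed.

Lemma lnS_step1 n : lnS n.+1 <= 1 + lnS n.
Proof.
apply: le_trans (lnS_step n) _; rewrite addrC lerD2r invf_le1// ler1n//.
Qed.

Lemma lnS_unbounded (C : R) : exists N, forall n, (N <= n)%N -> C <= lnS n.
Proof.
exists (Num.truncn (expR C)) => n Nn; rewrite -[C]expRK ler_ln ?posrE ?expR_gt0//.
have /truncn_itv/andP[_ /ltW h] := ltW (expR_gt0 C).
by apply: le_trans h _; rewrite ler_nat.
Qed.

(** Rounding costs at most a factor 2, since N + 1 <= 2x when N <= x and x >= 1. *)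
Lemma lnS_pow (kap : R) n : 0 < kap ->
  let N := Num.truncn (n.+1%:R `^ kap : R) in
  kap * lnS n <= lnS N /\ lnS N <= kap * lnS n + ln 2.
Proof.
move=> k0 N; have p0 : 0 < n.+1%:R `^ kap :> R by rewrite powR_gt0.
have /truncn_itv/andP[h1 h2] := ltW p0.
have p1 : 1 <= n.+1%:R `^ kap :> R.
  have E : (1 : R) `^ kap = 1 by rewrite powR1.
  by rewrite -[leLHS]E; apply: ge0_ler_powR; rewrite ?nnegrE ?ler1n//; exact: ltW.
rewrite /lnS -ln_powR; split; first by rewrite ler_ln ?posrE// ltW.
rewrite addrC -lnM ?posrE// ler_ln ?posrE ?mulr_gt0//.
by rewrite -natr1; lra.
Qed.

Lemma negl_vanish (x : nat -> R) : negl x (fun n => n%:R) -> vanish (fun n => x n / n.+1%:R).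
Proof.
move=> nx e e0; have e2 : 0 < e / 2 by rewrite divr_gt0.
have [C hC] := nx _ e2.
exists (Num.truncn (`|C| / (e / 2))) => n Nn.
have n0 : 0 < n.+1%:R :> R by rewrite ltr0n.
rewrite normrM normfV (ger0_norm (ltW n0)) ler_pdivrMr//.
apply: le_trans (hC n) _.
have /truncn_itv/andP[_] : 0 <= `|C| / (e / 2) by rewrite divr_ge0// ltW.
rewrite ltr_pdivrMr// => h.
have h' : (Num.truncn (`|C| / (e / 2))).+1%:R * (e / 2) <= n.+1%:R * (e / 2).
  by apply: ler_wpM2r; [exact: ltW|rewrite ler_nat].
have := ler_norm C; have : e / 2 * n%:R <= e / 2 * n.+1%:R by rewrite ler_pM2l// ler_nat.
lra.
Qed.

Lemma vanish_bounded (h : nat -> R) : vanish h -> exists2 C, 0 <= C & forall n, `|h n| <= C.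
Proof.
move=> /(_ 1 ltr01)[N hN]; exists (1 + \sum_(j < N) `|h j|) => [|n].
  by rewrite addr_ge0// sumr_ge0.
have [Nn|nN] := leqP N n; first by apply: le_trans (hN _ Nn) _; rewrite lerDl sumr_ge0.
rewrite (bigD1 (Ordinal nN))//= addrCA lerDl addr_ge0// sumr_ge0//.
Qed.

Lemma vanish_scale (h : nat -> R) (C : R) k : (forall n, `|k n| <= C * `|h n|) ->
  vanish h -> vanish k.
Proof.
move=> kh vh e e0.
have C1 : 0 < `|C| + 1 by have := normr_ge0 C; lra.
have [N hN] := vh _ (divr_gt0 e0 C1); exists N => n Nn.
apply: le_trans (kh n) _.
apply: (@le_trans _ _ ((`|C| + 1) * `|h n|)).
  by apply: ler_wpM2r => //; have := ler_norm C; lra.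
by rewrite mulrC -ler_pdivlMr// hN.
Qed.

Lemma cvgn_bounded (x : nat -> R) : cvgn x -> exists C, forall n, `|x n| <= C.
Proof.
move=> /cvgrPdist_lt/(_ _ ltr01)[N _ hN].
have [|C C0 h] := @vanish_bounded (fun n => if (n < N)%N then x n else 0).
  by move=> e e0; exists N => n Nn; rewrite ltnNge Nn/= normr0 ltW.
exists (C + `|limn x| + 1) => n; have := h n; have l0 := normr_ge0 (limn x).
case: ltnP => [_|Nn _]; first lra.
have := hN n Nn => /=; rewrite distrC => h1.
have := ler_normD (x n - limn x) (limn x); rewrite subrK; lra.
Qed.

End Asymptotics.
Arguments lnS {R} n.

Lemma window_sum (R : realType) (x : nat -> R) (N n : nat) : (N <= n)%N ->
  \sum_(N <= j < n) x j = \sum_(j < n) x j - \sum_(j < N) x j.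
Proof.
move=> Nn; have -> : \sum_(j < n) x j = \sum_(j < N) x j + \sum_(N <= j < n) x j.
  by rewrite -!(big_mkord xpredT x) (@big_cat_nat _ _ _ N).
by rewrite addrAC subrr add0r.
Qed.

Lemma sum_inv_ge (R : realType) (N n : nat) : (N <= n)%N ->
  lnS n - lnS N <= \sum_(N <= j < n) j.+1%:R^-1 :> R.
Proof.
elim: n => [|n IH]; first by rewrite leqn0 => /eqP ->; rewrite subrr big_geq.
rewrite leq_eqVlt => /orP[/eqP ->|]; first by rewrite subrr big_geq.
rewrite ltnS => Nn; rewrite big_nat_recr//=.
by have := lnS_step R n; have := IH Nn; set v := _^-1; lra.
Qed.

Section Lyapunov.
Variable R : realType.
Variables (m : nat) (W : nat -> R) (z S : nat -> 'cV[R]_m) (G : nat -> 'M[R]_m).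
Variables (sigma2 cl cu Cz : R) (E2 : nat -> R).
Hypothesis m0 : (0 < m)%N.
Hypothesis sigma2_gt0 : 0 < sigma2.
Hypothesis GS : forall n, G n.+1 = G n + z n *m (z n)^T.
Hypothesis SS : forall n, S n.+1 = S n + W n *: z n.
Hypothesis Gsym : forall n, (G n)^T = G n.
Hypothesis cl0 : 0 < cl.
Hypothesis cu0 : 0 < cu.
Hypothesis Glow : forall n x, cl * n.+1%:R * nsq x <= dot x (G n *m x).
Hypothesis Gup : forall n x, dot x (G n *m x) <= cu * n.+1%:R * nsq x.
Hypothesis Cz0 : 0 <= Cz.
Hypothesis E20 : forall n, 0 <= E2 n.
Hypothesis zE2 : forall n, nsq (z n) <= Cz * E2 n.
Hypothesis E2negl : negl E2 (fun n => n%:R).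

(** In the notation of the overview, [lev] is h_n, [lspred] is f_n, [bet] is beta_n and [lyap] is
    V_n. *)
Definition lev n := dot (z n) (invmx (G n) *m z n).
Definition lspred n := dot (S n) (invmx (G n) *m z n).
(* rlev n = z^T G_(n+1)^-1 z, with sums growing like m * ln n. *)
Definition rlev n := lev n / (1 + lev n).
Definition wlev n := 1 + \sum_(j < n) rlev j.
Definition bet n := invmx (G n) *m S n.
Definition lyap n := dot (S n) (bet n).
Definition wpred n := lspred n / (1 + lev n).
(** The index n+1 of [wlev] still leaves this weight known at time n, because [rlev n] depends on
    the past only. *)
Definition omega n := (wlev n.+1 ^+ 2)^-1.

Let clS n : 0 < cl * n.+1%:R. Proof. by rewrite mulr_gt0. Qed.
Let cuS n : 0 < cu * n.+1%:R. Proof. by rewrite mulr_gt0. Qed.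

Lemma lev_ge0 n : 0 <= lev n.
Proof. exact: dot_invmx_ge0 (Gsym n) (clS n) (Glow n) _. Qed.

Let lev1 n : 0 < 1 + lev n. Proof. by have := lev_ge0 n; lra. Qed.

Lemma rlev_ge0 n : 0 <= rlev n.
Proof. by rewrite divr_ge0 ?lev_ge0// ltW. Qed.

Lemma rlev_le1 n : rlev n <= 1.
Proof. by rewrite ler_pdivrMr// mul1r lerDr. Qed.

Lemma levE n : lev n = rlev n + lev n * rlev n.
Proof. by rewrite /rlev; field; rewrite gt_eqF. Qed.

Lemma wlev_ge1 n : 1 <= wlev n.
Proof. by rewrite lerDl sumr_ge0// => j _; exact: rlev_ge0. Qed.

(** |z_n|^2 is o(n), while G_n is at least of order n. *)
Lemma lev_vanish : vanish lev.
Proof.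
apply: (vanish_scale (C := Cz / cl)) (negl_vanish E2negl) => n.
have n0 : 0 < n.+1%:R :> R by rewrite ltr0n.
rewrite ger0_norm ?lev_ge0// ger0_norm ?divr_ge0// ?(ltW n0)//.
have := dot_invmx_le (Gsym n) (clS n) (Glow n) (z n); rewrite -/(lev n).
rewrite mulrC -ler_pdivlMr// => h; apply: le_trans h _.
rewrite ler_pdivrMr//; apply: le_trans (zE2 n) _; rewrite le_eqVlt; apply/orP; left; apply/eqP.
by move: (n.+1%:R) n0 => N n0; field; rewrite !gt_eqF.
Qed.

Lemma lev_bounded : exists2 H, 0 <= H & forall n, lev n <= H * rlev n.
Proof.
have [H H0 hH] := vanish_bounded lev_vanish; exists (1 + H) => [|n]; first lra.
rewrite {1}levE -{1}[rlev n]mul1r -mulrDl ler_wpM2r ?rlev_ge0// lerD2l.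
by apply: le_trans (hH n); exact: ler_norm.
Qed.

Let D n : R := ln (\det (G n)).

Let det_gt0 n : 0 < \det (G n).
Proof.
have [h _] := det_bounds (Gsym n) (clS n) (Glow n) (Gup n).
by apply: lt_le_trans h; rewrite exprn_gt0.
Qed.

Lemma lndet_sum n : \sum_(j < n) ln (1 + lev j) = D n - D 0%N.
Proof.
elim: n => [|n IH]; first by rewrite big_ord0 subrr.
rewrite big_ord_recr/= IH /D GS det_update; last exact: definite_unitmx (Gsym n) (clS n) (Glow n).
by rewrite -/(lev n) lnM ?posrE//; ring.
Qed.

Lemma lndet_bounded : exists C, forall n, `|D n - m%:R * lnS n| <= C.
Proof.
exists (m%:R * (`|ln cl| + `|ln cu|)) => n.
have [h1 h2] := det_bounds (Gsym n) (clS n) (Glow n) (Gup n).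
have lnE c : 0 < c -> ln ((c * n.+1%:R) ^+ m) = m%:R * (ln c + lnS n) :> R.
  by move=> c0; rewrite lnXn ?mulr_gt0// lnM ?posrE// mulr_natl.
have l1 : m%:R * (ln cl + lnS n) <= D n.
  by rewrite -lnE// ler_ln ?posrE// exprn_gt0.
have l2 : D n <= m%:R * (ln cu + lnS n).
  by rewrite -lnE// ler_ln ?posrE// exprn_gt0.
have mn : 0 <= m%:R :> R by [].
have a1 : m%:R * - `|ln cl| <= m%:R * ln cl by rewrite ler_wpM2l// lerNl -normrN ler_norm.
have a2 : m%:R * ln cu <= m%:R * `|ln cu| by rewrite ler_wpM2l// ler_norm.
have b1 : 0 <= m%:R * `|ln cl| by rewrite mulr_ge0.
have b2 : 0 <= m%:R * `|ln cu| by rewrite mulr_ge0.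
by rewrite ler_norml; apply/andP; split; lra.
Qed.

Let lnS0 n : 0 <= lnS n :> R. Proof. exact: lnS_ge0. Qed.

Lemma ln1lev_bounds n : rlev n <= ln (1 + lev n) /\ ln (1 + lev n) - rlev n <= lev n * rlev n.
Proof.
split.
  have -> : ln (1 + lev n) = - ln (1 + - rlev n).
    have -> : 1 + - rlev n = (1 + lev n)^-1 by rewrite /rlev; field; rewrite gt_eqF.
    by rewrite lnV ?posrE// opprK.
  by rewrite lerNr le_ln1Dx// ltrNr opprK ltr_pdivrMr// mul1r ltrDr.
rewrite lerBlDl -levE; apply: le_ln1Dx.
exact: lt_le_trans (ltrN10 _) (lev_ge0 n).
Qed.

Lemma sum_rlev_le : exists C, forall n, \sum_(j < n) rlev j <= C + m%:R * lnS n.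
Proof.
have [C hC] := lndet_bounded; exists (C - D 0%N) => n.
apply: (@le_trans _ _ (\sum_(j < n) ln (1 + lev j))).
  by apply: ler_sum => j _; have [] := ln1lev_bounds j.
by rewrite lndet_sum; have := hC n; rewrite ler_norml => /andP[]; lra.
Qed.

(** The logarithms ln(1 + h_j) telescope to ln det G_n, which is m ln n up to a constant. They
    differ from h_j/(1+h_j) by at most h_j times the latter, which is negligible in sum because h_j
    vanishes. *)
Lemma sum_rlev_negl : negl (fun n => \sum_(j < n) rlev j - m%:R * lnS n) lnS.
Proof.
have [C hC] := lndet_bounded; have [C' hC'] := sum_rlev_le.
have h1 : negl (fun n => \sum_(j < n) (ln (1 + lev j) - rlev j)) lnS.
  have := negl_sum_vanish lev_vanish (ler0n R m) rlev_ge0 lnS0 hC'.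
  apply: negl_le => n; rewrite !ger0_norm.
  - by apply: ler_sum => j _; have [] := ln1lev_bounds j.
  - by apply: sumr_ge0 => j _; rewrite mulr_ge0 ?lev_ge0 ?rlev_ge0.
  - by apply: sumr_ge0 => j _; rewrite subr_ge0; have [] := ln1lev_bounds j.
have h2 : negl (fun n => D n - m%:R * lnS n) lnS by apply: negl_bounded hC.
have h3 : negl (fun n => D 0%N) lnS by apply: (negl_bounded (C := `|D 0%N|)).
apply: negl_ext (neglB h2 (neglD h1 h3)) => n.
by rewrite sumrB lndet_sum; ring.
Qed.

Lemma lnS_le_wlev : exists2 C : R, 0 <= C & forall n, lnS n <= C * wlev n.
Proof.
have [C hC] := sum_rlev_negl (ltac:(lra) : (0 : R) < 2^-1).
exists (2 * (1 + `|C|)) => [|n]; first by have := normr_ge0 C; lra.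
have m1 : lnS n <= m%:R * lnS n :> R by rewrite ler_peMl// ler1n.
have := hC n; rewrite ler_norml => /andP[h _].
have := wlev_ge1 n; rewrite /wlev; set s := \sum_(j < n) _ in h * => s1.
have := ler_norm C; have C0 := normr_ge0 C => CC.
have : `|C| * 1 <= `|C| * (1 + s) by apply: ler_wpM2l.
lra.
Qed.

Lemma wlev_le : exists2 C : R, 0 <= C & forall n, wlev n <= C * (1 + lnS n).
Proof.
have [C hC] := sum_rlev_le; exists (1 + `|C| + m%:R) => [|n].
  by rewrite !addr_ge0.
have := hC n; have := ler_norm C; have := normr_ge0 C; have := lnS0 n.
rewrite /wlev => l0 c0 c1 c2.
have := mulr_ge0 c0 l0; have : 0 <= m%:R :> R by [].
lra.
Qed.

Hypothesis rlev_noise : negl (fun n => \sum_(j < n) rlev j * (W j ^+ 2 - sigma2)) wlev.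
Hypothesis wpred_noise : negl (fun n => \sum_(j < n) wpred j * W j)
  (fun n => 1 + \sum_(j < n) wpred j ^+ 2).

Definition penergy n := \sum_(j < n) lspred j ^+ 2 / (1 + lev j).

Lemma sum_rlev_sq_negl :
  negl (fun n => \sum_(j < n) rlev j * W j ^+ 2 - m%:R * sigma2 * lnS n) lnS.
Proof.
have [C C0 hC] := wlev_le.
have h1 : negl (fun n => \sum_(j < n) rlev j * (W j ^+ 2 - sigma2)) lnS.
  apply: (negl_weight (C := C) (K := C)) rlev_noise => // n.
  by have := hC n; rewrite mulrDr mulr1.
have h2 := neglZ sigma2 lnS0 sum_rlev_negl.
apply: negl_ext (neglD h1 h2) => n.
have -> : \sum_(j < n) rlev j * (W j ^+ 2 - sigma2) =
    \sum_(j < n) rlev j * W j ^+ 2 - sigma2 * \sum_(j < n) rlev j.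
  by rewrite mulr_sumr -sumrB; apply: eq_bigr => j _; ring.
ring.
Qed.

Lemma penergy_ge0 n : 0 <= penergy n.
Proof. by apply: sumr_ge0 => j _; rewrite divr_ge0 ?sqr_ge0// ltW. Qed.

Lemma penergy_homo : {homo penergy : n k / (n <= k)%N >-> n <= k}.
Proof.
apply: (sum_ord_homo (x := fun j => lspred j ^+ 2 / (1 + lev j))) => j.
by rewrite divr_ge0 ?sqr_ge0// ltW.
Qed.

Lemma lyap_ge0 n : 0 <= lyap n.
Proof. exact: dot_invmx_ge0 (Gsym n) (clS n) (Glow n) _. Qed.

Lemma lyapunov_identity n : lyap n + penergy n =
  lyap 0 + 2 * (\sum_(j < n) wpred j * W j) + \sum_(j < n) rlev j * W j ^+ 2.
Proof.
elim: n => [|n IH]; first by rewrite /penergy !big_ord0 mulr0 !addr0.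
rewrite /penergy !big_ord_recr/= -/(penergy n).
have -> : lyap n.+1 = lyap n - lspred n ^+ 2 / (1 + lev n) + 2 * (W n * wpred n)
    + W n ^+ 2 * rlev n.
  by rewrite /lyap /bet GS SS (rank_one_lyapunov (Gsym n) (clS n) (Glow n)).
lra.
Qed.

Lemma wpred_sq_le n : \sum_(j < n) wpred j ^+ 2 <= penergy n.
Proof.
apply: ler_sum => j _; rewrite /wpred exprMn ler_wpM2l ?sqr_ge0// exprVn.
rewrite lef_pV2 ?posrE ?exprn_gt0//.
by rewrite expr2 ler_peMl ?(ltW (lev1 j))// lerDl lev_ge0.
Qed.

(** A self-bounding step: the noise sum is at most a constant plus a quarter of the energy of
    [wpred], which [penergy] dominates; doubled, it costs half of [penergy], and that half moves to
    the left-hand side. *)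
Lemma lyap_penergy_le : exists2 C, 0 <= C & forall n, lyap n + penergy n <= C * (1 + lnS n).
Proof.
have [C1 h1] := sum_rlev_sq_negl ltr01.
have [C2 h2] := wpred_noise (ltac:(lra) : (0 : R) < 4^-1).
have mn : 0 <= m%:R :> R by [].
have s0 := sigma2_gt0.
have ms : 0 <= m%:R * sigma2 by rewrite mulr_ge0// ltW.
pose K := `|lyap 0| + `|C1| + 2 * `|C2| + 1 + m%:R * sigma2 + 1.
have K0 : 0 <= K by rewrite /K; have := normr_ge0 (lyap 0); have := normr_ge0 C1; have := normr_ge0 C2; lra.
exists (2 * K) => [|n]; first lra.
have e := lyapunov_identity n.
have := h1 n; rewrite ler_norml => /andP[_ a1].
have := h2 n; rewrite ler_norml => /andP[_ a2].
have a3 := wpred_sq_le n.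
have a4 := lyap_ge0 n; have a5 := penergy_ge0 n.
have l0 := lnS0 n.
have b1 := ler_norm C1; have b2 := ler_norm C2; have b3 := ler_norm (lyap 0).
have c1 := mulr_ge0 (normr_ge0 C1) l0; have c2 := mulr_ge0 (normr_ge0 C2) l0.
have c3 := mulr_ge0 (normr_ge0 (lyap 0)) l0.
rewrite /K; lra.
Qed.

Lemma lyap_le : exists2 C, 0 <= C & forall n, lyap n <= C * (1 + lnS n).
Proof.
have [C C0 h] := lyap_penergy_le; exists C => // n.
by have := h n; have := penergy_ge0 n; lra.
Qed.

Lemma penergy_le : exists2 C, 0 <= C & forall n, penergy n <= C * (1 + lnS n).
Proof.
have [C C0 h] := lyap_penergy_le; exists C => // n.
by have := h n; have := lyap_ge0 n; lra.
Qed.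

Lemma lyap_penergy_negl :
  negl (fun n => lyap n + penergy n - m%:R * sigma2 * lnS n) lnS.
Proof.
have [C C0 hC] := penergy_le.
have h1 : negl (fun n => \sum_(j < n) wpred j * W j) lnS.
  apply: (negl_weight (C := 1 + C) (K := C)) wpred_noise => // n.
  by have := hC n; have := wpred_sq_le n; rewrite mulrDr mulr1; lra.
have h2 := neglZ 2 lnS0 h1.
have h3 : negl (fun n => lyap 0) lnS by apply: (negl_bounded (C := `|lyap 0|)).
apply: negl_ext (neglD h3 (neglD h2 sum_rlev_sq_negl)) => n.
by rewrite lyapunov_identity; ring.
Qed.

(** [fluct] is the coefficient of W^2, and twice [drift] that of W, in the expansion of omega
    |S_(n+1)|^2/(n+2) around S_n. *)
Definition fluct n := omega n * nsq (z n) / n.+2%:R.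
Definition drift n := omega n * dot (S n) (z n) / n.+2%:R.

Hypothesis fluct_noise : (exists M, forall n, \sum_(j < n) `|fluct j| <= M) ->
  cvgn (fun n => \sum_(j < n) fluct j * (W j ^+ 2 - sigma2)).
Hypothesis drift_noise : (exists M, forall n, \sum_(j < n) drift j ^+ 2 <= M) ->
  cvgn (fun n => \sum_(j < n) drift j * W j).

Lemma omega_gt0 n : 0 < omega n.
Proof. by rewrite invr_gt0 exprn_gt0// (lt_le_trans ltr01 (wlev_ge1 _)). Qed.

Let omega_ge0 n : 0 <= omega n. Proof. exact: ltW (omega_gt0 n). Qed.

Lemma omega_le n : omega n.+1 <= omega n.
Proof.
have h k : 0 < wlev k by exact: lt_le_trans ltr01 (wlev_ge1 k).
rewrite lef_pV2 ?posrE ?exprn_gt0// lerXn2r ?nnegrE ?(ltW (h _))//.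
by rewrite /wlev [in leRHS]big_ord_recr/= addrA lerDl rlev_ge0.
Qed.

Lemma nsq_z_le_lev n : nsq (z n) <= cu * n.+1%:R * lev n.
Proof. by have := nsq_le_dot_invmx (Gsym n) (clS n) (Glow n) (cuS n) (Gup n) (z n). Qed.

Lemma nsq_S_le_lyap n : nsq (S n) <= cu * n.+1%:R * lyap n.
Proof. by have := nsq_le_dot_invmx (Gsym n) (clS n) (Glow n) (cuS n) (Gup n) (S n). Qed.

Let nS12 n : n.+1%:R <= n.+2%:R :> R. Proof. by rewrite ler_nat. Qed.

Lemma fluct_ge0 n : 0 <= fluct n.
Proof. by rewrite /fluct divr_ge0// mulr_ge0// nsq_ge0. Qed.

(** |z_n|^2 is at most of order n h_n, and h_n at most of order [rlev], so the terms are dominated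
    by rlev/wlev^2, whose sum telescopes. *)
Lemma fluct_sum_le : exists M, forall n, \sum_(j < n) fluct j <= M.
Proof.
have [H H0 hH] := lev_bounded; exists (cu * H) => n.
apply: (@le_trans _ _ (cu * H * \sum_(j < n) rlev j / (1 + \sum_(i < j.+1) rlev i) ^+ 2)).
  rewrite mulr_sumr; apply: ler_sum => j _; rewrite /fluct -/(wlev j.+1) -/(omega j).
  rewrite ler_pdivrMr//.
  have h1 := nsq_z_le_lev j; have h2 := hH j.
  have o0 := omega_gt0 j.
  apply: (@le_trans _ _ (omega j * (cu * j.+2%:R * (H * rlev j)))); last first.
    by rewrite le_eqVlt; apply/orP; left; apply/eqP; ring.
  apply: ler_wpM2l; first exact: ltW.
  apply: le_trans h1 _; apply: ler_pM => //; first exact: ltW.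
    exact: lev_ge0.
  by rewrite ler_pM2l.
by rewrite ler_piMr ?mulr_ge0 ?(ltW cu0)//; exact: sum_div_sqr_le rlev_ge0 n.
Qed.

(** Cauchy-Schwarz with |S_n|^2 = O(n V_n) and V_n = O(wlev); this factor [wlev] is absorbed by one
    factor omega = wlev^-2. *)
Lemma drift_sq_le : exists2 C, 0 <= C & forall n, drift n ^+ 2 <= C * fluct n.
Proof.
have [C C0 hC] := lyap_le; have [C' C'0 hC'] := lnS_le_wlev.
exists (cu * (C * (1 + C'))) => [|n]; first by rewrite !mulr_ge0 ?addr_ge0 ?(ltW cu0).
have w1 := wlev_ge1 n.+1; have o0 := omega_gt0 n.
have wm : wlev n <= wlev n.+1 by rewrite /wlev [in leRHS]big_ord_recr/= addrA lerDl rlev_ge0.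
have hV : lyap n <= C * (1 + C') * wlev n.+1.
  apply: le_trans (hC n) _; rewrite -mulrA; apply: ler_wpM2l => //.
  have := hC' n; have : C' * wlev n <= C' * wlev n.+1 by exact: ler_wpM2l.
  lra.
have hS : nsq (S n) <= cu * n.+2%:R * (C * (1 + C') * wlev n.+1).
  apply: le_trans (nsq_S_le_lyap n) _; apply: ler_pM => //; first exact: ltW.
    exact: lyap_ge0.
  by rewrite ler_pM2l.
rewrite /drift /fluct; set N := n.+2%:R in hS *.
have N0 : 0 < N by rewrite ltr0n.
have -> : (omega n * dot (S n) (z n) / N) ^+ 2 =
    omega n ^+ 2 * dot (S n) (z n) ^+ 2 / N ^+ 2 by field; rewrite gt_eqF.
apply: (@le_trans _ _ (omega n ^+ 2 * (nsq (S n) * nsq (z n)) / N ^+ 2)).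
  apply: ler_wpM2r; first by rewrite invr_ge0 sqr_ge0.
  by apply: ler_wpM2l; [exact: sqr_ge0|exact: cauchy_schwarz_dot].
have ow : omega n * wlev n.+1 <= 1.
  by rewrite /omega ler_pdivrMl ?exprn_gt0 ?(lt_le_trans ltr01)// mulr1 expr2 ler_peMl// (le_trans ler01).
apply: (@le_trans _ _ (omega n ^+ 2 * (cu * N * (C * (1 + C') * wlev n.+1) * nsq (z n)) / N ^+ 2)).
  apply: ler_wpM2r; first by rewrite invr_ge0 sqr_ge0.
  apply: ler_wpM2l; first exact: sqr_ge0.
  by apply: ler_wpM2r => //; exact: nsq_ge0.
have -> : omega n ^+ 2 * (cu * N * (C * (1 + C') * wlev n.+1) * nsq (z n)) / N ^+ 2 =
  (omega n * wlev n.+1) * (cu * (C * (1 + C')) * (omega n * nsq (z n) / N)).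
  by field; rewrite gt_eqF.
apply: ler_piMl => //; apply: mulr_ge0; first by rewrite !mulr_ge0 ?addr_ge0 ?(ltW cu0).
exact: fluct_ge0.
Qed.

(* Summable, by telescoping omega * nsq (S n) / n: the weights omega are of the order
   of (ln n)^-2, which absorbs the sum of nsq (z n) / n^2. *)
Definition wS n := omega n * nsq (S n) / (n.+1%:R * n.+2%:R).

Lemma wS_ge0 n : 0 <= wS n.
Proof. by rewrite /wS divr_ge0 ?mulr_ge0// nsq_ge0. Qed.

Lemma wS_sum_le : exists M, forall n, \sum_(j < n) wS j <= M.
Proof.
have [M1 hM1] := fluct_sum_le.
have [C C0 hC] := drift_sq_le.
have [B1 hB1] : exists B, forall n, `|\sum_(j < n) fluct j * (W j ^+ 2 - sigma2)| <= B.
  apply: cvgn_bounded; apply: fluct_noise; exists M1 => n.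
  by under eq_bigr do rewrite ger0_norm ?fluct_ge0//; exact: hM1.
have [B2 hB2] : exists B, forall n, `|\sum_(j < n) drift j * W j| <= B.
  apply: cvgn_bounded; apply: drift_noise; exists (C * M1) => n.
  apply: (@le_trans _ _ (C * \sum_(j < n) fluct j)); last exact: ler_wpM2l.
  by rewrite mulr_sumr; apply: ler_sum => j _; exact: hC.
exists (omega 0 * nsq (S 0) + 2 * B2 + B1 + sigma2 * M1) => n.
have key : \sum_(j < n) wS j + omega n * (nsq (S n) / n.+1%:R) <=
    omega 0 * nsq (S 0) + 2 * (\sum_(j < n) drift j * W j)
    + \sum_(j < n) fluct j * (W j ^+ 2 - sigma2) + sigma2 * \sum_(j < n) fluct j.
  elim: n => [|n IH]; first by rewrite !big_ord0 !(mulr0, addr0) add0r divr1.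
  rewrite !big_ord_recr/=.
  have h : omega n.+1 * (nsq (S n.+1) / n.+2%:R) <= omega n * (nsq (S n.+1) / n.+2%:R).
    by apply: ler_wpM2r; [rewrite divr_ge0 ?nsq_ge0|exact: omega_le].
  (* The difference 1/(n+1) - 1/(n+2) = 1/((n+1)(n+2)) is what produces [wS]. *)
  have E : wS n + omega n * (nsq (S n.+1) / n.+2%:R) =
      omega n * (nsq (S n) / n.+1%:R) + 2 * (drift n * W n) + fluct n * (W n ^+ 2 - sigma2)
      + sigma2 * fluct n.
    rewrite SS nsqD nsqZ dotZr /wS /drift /fluct -(natr1 n.+1).
    have : 0 < n.+1%:R :> R by rewrite ltr0n.
    move: (n.+1%:R) => N N0; field; rewrite !gt_eqF//; lra.
  move: h E IH.
  set t1 := omega n.+1 * _; set t2 := omega n * _; set t3 := omega n * (nsq (S n) / _).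
  lra.
have k0 : 0 <= omega n * (nsq (S n) / n.+1%:R).
  by rewrite mulr_ge0// divr_ge0// nsq_ge0.
have := hB1 n; rewrite ler_norml => /andP[_ b1].
have := hB2 n; rewrite ler_norml => /andP[_ b2].
have := ler_wpM2l (ltW sigma2_gt0) (hM1 n).
move: key k0; set k := omega n * _.
lra.
Qed.

(** V_j is at most |S_j|^2/(cl (j+1)); the factor 2 pays for j+2 <= 2(j+1), and the monotone
    [wlev n] removes the weight omega at j. *)
Lemma lyap_div_le n j : (j < n)%N ->
  lyap j / j.+1%:R <= 2 / cl * wlev n ^+ 2 * wS j.
Proof.
move=> jn.
have w1 k : 0 < wlev k by exact: lt_le_trans ltr01 (wlev_ge1 k).
have wjn : wlev j.+1 <= wlev n.
  by rewrite lerD2l; apply: (sum_ord_homo rlev_ge0).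
have o1 : 1 <= wlev n ^+ 2 * omega j.
  by rewrite ler_pdivlMr ?exprn_gt0// mul1r lerXn2r// nnegrE ltW.
have h := dot_invmx_le (Gsym j) (clS j) (Glow j) (S j).
rewrite -/(lyap j) in h.
have N0 : 0 < j.+1%:R :> R by rewrite ltr0n.
have N1 : 1 <= j.+1%:R :> R by rewrite ler1n.
rewrite /wS -(natr1 j.+1).
move: (j.+1%:R) N0 N1 h => N N0 N1 h.
have q0 := nsq_ge0 (S j).
have h2 : lyap j / N <= 2 / cl * (nsq (S j) / (N * (N + 1))).
  have -> : 2 / cl * (nsq (S j) / (N * (N + 1))) = (2 * nsq (S j)) / (cl * N * (N + 1)).
    by field; rewrite !gt_eqF//; lra.
  rewrite ler_pdivlMr ?mulr_gt0//; last lra.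
  have -> : lyap j / N * (cl * N * (N + 1)) = cl * lyap j * (N + 1) by field; rewrite gt_eqF.
  have : cl * lyap j * (N + 1) <= cl * lyap j * (2 * N).
    apply: ler_wpM2l; last lra.
    by rewrite mulr_ge0 ?lyap_ge0// ltW.
  lra.
apply: le_trans h2 _.
have -> : 2 / cl * wlev n ^+ 2 * (omega j * nsq (S j) / (N * (N + 1))) =
  (wlev n ^+ 2 * omega j) * (2 / cl * (nsq (S j) / (N * (N + 1)))) by ring.
by rewrite ler_peMl// mulr_ge0 ?divr_ge0// ?(ltW cl0)// mulr_ge0//; lra.
Qed.

(* Summability of wS yields a time j in [n^(1-dk), n] at which lyap j is a small
   multiple of ln n; the energy up to j already exceeds (1 - dk) m sigma2 ln n - o(ln n). *)
Lemma penergy_ge e : 0 < e ->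
  exists C, forall n, m%:R * sigma2 * lnS n - penergy n <= C + e * lnS n.
Proof.
move=> e0; set M := m%:R * sigma2.
have M0 : 0 <= M by rewrite mulr_ge0// ltW.
have d0 : 0 < 3 * (M + e) by lra.
(* Giving up the fraction dk of the logarithm costs dk M <= e/3. The other two thirds of e go to the
   error of the Lyapunov identity and to V. *)
pose dk := e / (3 * (M + e)).
have dk0 : 0 < dk by rewrite divr_gt0.
have dkM : dk * M <= e / 3.
  rewrite /dk mulrAC ler_pdivrMr//.
  have -> : e / 3 * (3 * (M + e)) = e * M + e * e by field.
  by rewrite lerDl mulr_ge0// ltW.
have dk1 : dk <= 2^-1.
  by rewrite /dk ler_pdivrMr//; lra.
pose kap := 1 - dk.
have kap0 : 0 < kap by rewrite /kap; lra.
have e3 : 0 < e / 3 by rewrite divr_gt0.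
have [C1 h1] := lyap_penergy_negl e3.
have [Ca Ca0 hCa] := wlev_le.
have [Mw hMw] := wS_sum_le.
pose Q := 8 * Ca ^+ 2 / cl.
have Q0 : 0 <= Q by rewrite divr_ge0 ?mulr_ge0 ?sqr_ge0// ltW.
(* Makes Q del l^2 at most (dk l/2)(e l/3), the harmonic mass of the window times the admissible
   size of V. *)
pose del := e * dk / 6 / (Q + 1).
have Q1 : 0 < Q + 1 by rewrite ltr_wpDl.
have del0 : 0 < del by rewrite /del divr_gt0// divr_gt0// mulr_gt0.
have [N0 hN0] := bounded_series_tail wS_ge0 hMw del0.
(* N1 ensures that l >= 1, that the window starts after N0, and that dk l >= 2 ln 2, so that its
   harmonic mass is at least dk l/2 in spite of rounding. *)
have [N1 hN1] := lnS_unbounded (1 + 2 * ln 2 / dk + (lnS N0 + 1) / kap).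
exists (`|C1| + M * lnS N1) => n.
have ln2 : 0 <= ln 2 :> R by rewrite ln_ge0// ler1n.
have l0 := lnS0 n; have l1 := lnS0 N1.
have Ml1 := mulr_ge0 M0 l1.
have [nN1|] := ltnP n N1.
  have := ler_wpM2l M0 (lnS_homo R (ltnW nN1)).
  have := mulr_ge0 (ltW e0) l0; have := penergy_ge0 n; have := normr_ge0 C1; lra.
move=> /hN1 big.
set l := lnS n in l0 big *.
have t1 : 0 <= 2 * ln 2 / dk.
  by apply: divr_ge0; [exact: mulr_ge0|exact: ltW].
have t2 : 0 <= (lnS N0 + 1) / kap.
  by apply: divr_ge0; [rewrite addr_ge0// lnS_ge0|exact: ltW].
set u1 := 2 * ln 2 / dk in t1 big; set u2 := (lnS N0 + 1) / kap in t2 big.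
have lge1 : 1 <= l by lra.
have lk : lnS N0 + 1 <= kap * l.
  by rewrite mulrC -ler_pdivrMr// -/u2; lra.
have ld : 2 * ln 2 <= dk * l.
  by rewrite [dk * l]mulrC -ler_pdivrMr// -/u1; lra.
clear d0 ln2 l1 big t1 t2.
have := @lnS_pow R kap n kap0; set N := Num.truncn _ => /= -[a1 a2].
rewrite -/l in a1 a2.
have NN0 : (N0 <= N)%N.
  rewrite leqNgt; apply/negP => /ltnW /(lnS_homo R); lra.
have Nn : (N <= n)%N.
  rewrite leqNgt; apply/negP => /ltnW /(lnS_homo R); rewrite -/l /kap in a2 *.
  have : 0 < dk * l by rewrite mulr_gt0// (lt_le_trans ltr01).
  have : 0 < ln 2 :> R by rewrite ln_gt0// ltr1n.
  lra.
set Hs : R := \sum_(N <= j < n) j.+1%:R^-1.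
have Hs_ge : dk * l / 2 <= Hs.
  by apply: le_trans (sum_inv_ge R Nn); rewrite -/l /kap in a2 *; lra.
have Hs0 : 0 < Hs.
  by apply: lt_le_trans Hs_ge; rewrite divr_gt0// mulr_gt0// (lt_le_trans ltr01).
pose X := M * lnS N - e / 3 * l - `|C1|.
have wtail : \sum_(N <= j < n) wS j <= del.
  rewrite window_sum//; have := hN0 (n - N0)%N; rewrite sum_shiftE subnKC ?(leq_trans NN0)//.
  have := sum_ord_homo wS_ge0 NN0; lra.
(* The good time is not selected: the inequality is averaged over the window with weights 1/(j+1),
   for which the tail of [wS] bounds the contribution of V. *)
have Fj j : (N <= j < n)%N -> (X - lyap j) / j.+1%:R <= penergy n / j.+1%:R.
  move=> /andP[Nj jn]; apply: ler_wpM2r; first by rewrite invr_ge0.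
  have := h1 j; rewrite ler_norml => /andP[b1 _].
  have := penergy_homo (ltnW jn); have := ler_norm C1.
  have := ler_wpM2l M0 (lnS_homo R Nj).
  have := ler_wpM2l (ltW e3) (lnS_homo R (ltnW jn)).
  rewrite /X -/l -/M in b1 *; lra.
have sumF : Hs * X - \sum_(N <= j < n) lyap j / j.+1%:R <= Hs * penergy n.
  rewrite /Hs !mulr_suml -sumrB; apply: ler_sum_nat => j /Fj.
  by rewrite mulrBl ![_ / j.+1%:R]mulrC.
have sumV : \sum_(N <= j < n) lyap j / j.+1%:R <= Hs * (e / 3 * l).
  apply: (@le_trans _ _ (\sum_(N <= j < n) 2 / cl * wlev n ^+ 2 * wS j)).
    by apply: ler_sum_nat => j /andP[_ jn]; exact: lyap_div_le.
  rewrite -mulr_sumr.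
  apply: (@le_trans _ _ (2 / cl * (Ca * (2 * l)) ^+ 2 * del)).
    apply: ler_pM => //.
    - by rewrite mulr_ge0 ?sqr_ge0// divr_ge0// ltW.
    - by apply: sumr_ge0 => j _; exact: wS_ge0.
    - apply: ler_wpM2l; first by rewrite divr_ge0// ltW.
      rewrite lerXn2r ?nnegrE ?mulr_ge0//; first by apply: le_trans (wlev_ge1 n).
      by apply: le_trans (hCa n) _; apply: ler_wpM2l => //; rewrite -/l mulr_natl mulr2n lerD2r.
  have -> : 2 / cl * (Ca * (2 * l)) ^+ 2 * del = Q * del * l ^+ 2.
    by rewrite /Q; field; rewrite gt_eqF.
  have Qd : Q * del <= e * dk / 6.
    rewrite /del mulrA ler_pdivrMr//.
    rewrite mulrC ler_wpM2l ?lerDl//.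
    by rewrite divr_ge0// mulr_ge0// ltW.
  apply: (@le_trans _ _ (e * dk / 6 * l ^+ 2)); first by apply: ler_wpM2r; rewrite ?sqr_ge0.
  have -> : e * dk / 6 * l ^+ 2 = dk * l / 2 * (e / 3 * l) by field.
  by apply: ler_wpM2r => //; rewrite mulr_ge0// ltW.
have : Hs * (X - e / 3 * l) <= Hs * penergy n.
  by rewrite mulrBr; apply: le_trans sumF; rewrite lerD2l lerN2.
rewrite ler_pM2l// => fin.
have := ler_wpM2l M0 a1.
have : M * (kap * l) = M * l - dk * M * l by rewrite /kap; ring.
have : dk * M * l <= e / 3 * l by apply: ler_wpM2r.
rewrite /X in fin; lra.
Qed.

Lemma penergy_negl : negl (fun n => penergy n - m%:R * sigma2 * lnS n) lnS.
Proof.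
move=> e e0; have [C1 h1] := penergy_ge e0; have [C2 h2] := lyap_penergy_negl e0.
exists (`|C1| + `|C2|) => n.
have := h1 n; have := h2 n; rewrite !ler_norml => /andP[_ a2] a1.
have := lyap_ge0 n; have := ler_norm C1; have := ler_norm C2.
have := normr_ge0 C1; have := normr_ge0 C2.
by move=> *; apply/andP; split; lra.
Qed.

Let pe0 j : 0 <= lspred j ^+ 2 / (1 + lev j).
Proof. by rewrite divr_ge0 ?sqr_ge0// ltW. Qed.

Lemma pred_sq_negl :
  negl (fun n => \sum_(j < n) lspred j ^+ 2 - m%:R * sigma2 * lnS n) lnS.
Proof.
have [C C0 hC] := penergy_le.
have hC' n : \sum_(j < n) lspred j ^+ 2 / (1 + lev j) <= C + C * lnS n.
  by have := hC n; rewrite mulrDr mulr1.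
have h := negl_sum_vanish lev_vanish C0 pe0 lnS0 hC'.
apply: negl_ext (neglD penergy_negl h) => n.
rewrite addrAC -big_split; congr (_ - _); apply: eq_bigr => j _ /=.
by field; rewrite gt_eqF.
Qed.

(** |beta_j|^2 is at most |S_j|^2/(cl (j+1))^2, so the summability of [wS] carries over. It provides
    the square summability of the cross-term martingale after division by [wlev]. *)
Lemma bet_sum_le : exists M, forall n, \sum_(j < n) omega j * nsq (bet j) <= M.
Proof.
have [M hM] := wS_sum_le; exists (2 / cl ^+ 2 * M) => n.
apply: (@le_trans _ _ (2 / cl ^+ 2 * \sum_(j < n) wS j)); last first.
  by apply: ler_wpM2l => //; rewrite divr_ge0// sqr_ge0.
rewrite mulr_sumr; apply: ler_sum => j _.
have h1 := nsq_invmx_le (Gsym j) (clS j) (Glow j) (S j).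
have h2 := dot_invmx_le (Gsym j) (clS j) (Glow j) (S j).
rewrite -/(bet j) -/(lyap j) in h1 h2.
rewrite /wS -[omega j * nsq (S j) / _]mulrA mulrCA; apply: ler_wpM2l => //.
have N0 : 0 < j.+1%:R :> R by rewrite ltr0n.
have N1 : 1 <= j.+1%:R :> R by rewrite ler1n.
rewrite -(natr1 j.+1).
move: (j.+1%:R) N0 N1 h1 h2 => N N0 N1 h1 h2.
have -> : 2 / cl ^+ 2 * (nsq (S j) / (N * (N + 1))) = (2 * nsq (S j)) / (cl ^+ 2 * N * (N + 1)).
  by field; rewrite !gt_eqF//; lra.
rewrite ler_pdivlMr; last by rewrite !mulr_gt0 ?exprn_gt0//; lra.
have h3 : cl * N * (cl * N * nsq (bet j)) <= nsq (S j).
  by apply: le_trans h2; rewrite ler_pM2l// mulr_gt0.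
have h4 : nsq (bet j) * (cl ^+ 2 * N * (N + 1)) <= nsq (bet j) * (cl ^+ 2 * N * (2 * N)).
  apply: ler_wpM2l; first exact: nsq_ge0.
  by apply: ler_wpM2l; [rewrite mulr_ge0 ?sqr_ge0// ltW|lra].
lra.
Qed.

(** beta moves by (W - f)/(1 + h) times G^-1 z. In the cross term the factor 1/(n+1) offsets an
    envelope whose square is o(n), and the bracket sums to O(log n). *)
Lemma bet_step n : nsq (bet n.+1 - bet n) <=
  2 / (cl * n.+1%:R) * (rlev n * W n ^+ 2 + lspred n ^+ 2).
Proof.
have -> : bet n.+1 - bet n = ((W n - lspred n) / (1 + lev n)) *: (invmx (G n) *m z n).
  by rewrite /bet GS SS (rank_one_beta (Gsym n) (clS n) (Glow n)) addrAC subrr add0r.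
rewrite nsqZ.
have h1 := nsq_invmx_le (Gsym n) (clS n) (Glow n) (z n).
rewrite -/(lev n) mulrC -ler_pdivlMr// in h1.
apply: (@le_trans _ _ (((W n - lspred n) / (1 + lev n)) ^+ 2 * (lev n / (cl * n.+1%:R)))).
  by apply: ler_wpM2l => //; exact: sqr_ge0.
have -> : 2 / (cl * n.+1%:R) * (rlev n * W n ^+ 2 + lspred n ^+ 2) =
  (2 * (rlev n * W n ^+ 2 + lspred n ^+ 2)) / (cl * n.+1%:R) by rewrite mulrAC.
rewrite mulrA; apply: ler_wpM2r; first by rewrite invr_ge0 ltW.
have r0 := rlev_ge0 n; have r1 := rlev_le1 n; have l0 := lev_ge0 n.
have rE : lev n / (1 + lev n) ^+ 2 <= rlev n.
  rewrite /rlev; apply: ler_wpM2l => //; rewrite lef_pV2 ?posrE ?exprn_gt0//.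
  by rewrite expr2 ler_peMl// ?lerDl// ltW.
have -> : ((W n - lspred n) / (1 + lev n)) ^+ 2 * lev n =
  (W n - lspred n) ^+ 2 * (lev n / (1 + lev n) ^+ 2) by field; rewrite gt_eqF.
apply: (@le_trans _ _ ((W n - lspred n) ^+ 2 * rlev n)); first by apply: ler_wpM2l; rewrite ?sqr_ge0.
apply: (@le_trans _ _ (2 * (W n ^+ 2 + lspred n ^+ 2) * rlev n)).
  by apply: ler_wpM2r => //; have := sqr_ge0 (W n + lspred n); lra.
have : lspred n ^+ 2 * rlev n <= lspred n ^+ 2 by apply: ler_piMr; rewrite ?sqr_ge0.
lra.
Qed.

Lemma bet_step_sum : exists2 C, 0 <= C & forall n,
  \sum_(j < n) (rlev j * W j ^+ 2 + lspred j ^+ 2) <= C * (1 + lnS n).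
Proof.
have [C1 h1] := sum_rlev_sq_negl ltr01; have [C2 h2] := pred_sq_negl ltr01.
have ms : 0 <= m%:R * sigma2 by rewrite mulr_ge0// ltW.
exists (`|C1| + `|C2| + 2 * (m%:R * sigma2) + 2) => [|n].
  by have := normr_ge0 C1; have := normr_ge0 C2; lra.
rewrite big_split/=.
have := h1 n; have := h2 n; rewrite !ler_norml => /andP[_ a2] /andP[_ a1].
have := ler_norm C1; have := ler_norm C2; have := lnS0 n.
move=> l0; have := mulr_ge0 (normr_ge0 C1) l0; have := mulr_ge0 (normr_ge0 C2) l0.
lra.
Qed.

End Lyapunov.

(** * The cross term *)

Section BackwardFilter.
Variable R : realType.

Lemma geometric_cvg0 (rho K : R) : 0 < rho < 1 -> 0 <= K ->
  forall e, 0 < e -> exists N : nat, K * rho ^+ N <= e.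
Proof.
move=> /andP[r0 r1] K0 e e0.
have : K * rho ^+ n @[n --> \oo] --> K * 0.
  apply: cvgM; first exact: cvg_cst.
  by apply: cvg_expr; rewrite ger0_norm// ltW.
move=> /cvgrPdist_le/(_ _ e0)[N _ h]; exists N; have := h N (leqnn N) => /=.
by rewrite mulr0 sub0r normrN; apply: le_trans; exact: ler_norm.
Qed.

(** Relations between infinite sums are checked on truncations, with a geometric error, and passed
    to the limit by this lemma. *)
Lemma le_geometric (rho K x : R) : 0 < rho < 1 -> 0 <= K ->
  (forall N : nat, x <= K * rho ^+ N) -> x <= 0.
Proof.
move=> r01 K0 h; apply/ler_addgt0Pr => e e0; rewrite add0r.
by have [N hN] := geometric_cvg0 r01 K0 e0; apply: le_trans (h N) hN.
Qed.

Lemma geometric_series (rho M : R) (c : nat -> R) : 0 < rho < 1 -> 0 <= M ->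
  (forall k, `|c k| <= M * rho ^+ k) ->
  exists s, forall N, `|s - \sum_(k < N) c k| <= M / (1 - rho) * rho ^+ N.
Proof.
move=> r01 M0 hc; have /andP[r0 r1] := r01.
have d0 : 0 < 1 - rho by rewrite subr_gt0.
pose u n := \sum_(k < n) c k.
have tail N k : `|u (N + k)%N - u N| <= M / (1 - rho) * rho ^+ N.
  rewrite /u -sum_shiftE; apply: (le_trans (ler_norm_sum _ _ _)).
  apply: (@le_trans _ _ (\sum_(j < k) M * rho ^+ N * rho ^+ j)).
    by apply: ler_sum => j _; apply: le_trans (hc _) _; rewrite exprD mulrA.
  rewrite -mulr_sumr [leRHS]mulrAC; apply: ler_wpM2l.
    by rewrite mulr_ge0// exprn_ge0// ltW.
  have -> : \sum_(j < k) rho ^+ j = (1 - rho ^+ k) / (1 - rho).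
    apply: (mulIf (lt0r_neq0 d0)); rewrite mulfVK ?gt_eqF//.
    have := subrX1 rho k; rewrite -opprB => /eqP; rewrite eqr_oppLR => /eqP ->.
    by rewrite -[in LHS]opprB mulrN; congr (- _); rewrite mulrC.
  by rewrite ler_pdivrMr// mulVf ?gt_eqF// gerBl exprn_ge0// ltW.
have K0 : 0 <= M / (1 - rho) by rewrite divr_ge0// ltW.
have cu : cvgn u.
  apply: cvgn_of_cauchy_tail => e e0.
  have [N hN] := geometric_cvg0 r01 K0 (divr_gt0 e0 (ltr0n R 2 : 0 < 2)).
  by exists N => k; apply: le_lt_trans (tail N k) _; apply: le_lt_trans hN _; lra.
exists (limn u) => N; apply/ler_addgt0Pr => e e0.
have /cvgrPdist_lt/(_ _ e0)[N' _ hN'] := cu.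
have := hN' (N + N')%N (leq_addl _ _) => /= h1; have := tail N N'.
have := ler_normD (limn u - u (N + N')%N) (u (N + N')%N - u N).
rewrite addrA subrK -/(u N); set t := _ * _; lra.
Qed.

(** The power series coefficients of 1/B. Each depends on all earlier ones, so the recursion extends
    the list [L], whose existing entries never change. *)
Lemma impulse_response (B : {poly R}) : B`_0 != 0 ->
  exists psi : int -> R, (forall n, n < 0 -> psi n = 0) /\
    forall n : nat, filt B psi n%:Z = (n == 0%N)%:R.
Proof.
move=> B0.
pose step (l : seq R) : R := ((size l == 0%N)%:R -
  \sum_(i < size l) B`_i.+1 * l`_(size l - i.+1)) / B`_0.
pose L n := iter n (fun l => rcons l (step l)) [::].
have sL n : size (L n) = n by elim: n => //= n IH; rewrite size_rcons IH.
pose psi' n := step (L n).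
have nL m n : (n < m)%N -> (L m)`_n = psi' n.
  elim: m => // m IH; rewrite ltnS /= nth_rcons sL leq_eqVlt => /orP[/eqP ->|nm].
    by rewrite ltnn eqxx.
  by rewrite nm IH.
pose psi (k : int) := if k is Posz n then psi' n else 0.
have psineg n : n < 0 -> psi n = 0 by case: n.
exists psi; split => // n.
rewrite (filt_wide (N := (size B + n.+1)%N) psi n%:Z); last exact: leq_addr.
rewrite addnC big_split_ord/= [X in _ + X]big1 ?addr0; last first.
  by move=> i _; rewrite psineg ?mulr0//; lia.
rewrite big_ord_recl.
have -> : n%:Z - (nat_of_ord (ord0 : 'I_n.+1))%:Z = n%:Z by rewrite subr0.
rewrite {1}/psi {1}/psi' /step sL.
set s1 := \sum_(i < n) _ * (L n)`_ _; set s2 := \sum_(i < n) _.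
have -> : s2 = s1.
  apply: eq_bigr => i _; rewrite !lift0; congr (_ * _).
  rewrite nL; last by have := ltn_ord i; lia.
  by have -> : n%:Z - i.+1%:Z = (n - i.+1)%N%:Z by have := ltn_ord i; lia.
by rewrite mulrC mulfVK// subrK.
Qed.

(* The causal impulse response of 1/B, which decays geometrically, is run
   backwards in time. *)
Lemma backward_filter (B : {poly R}) (y : nat -> R) (M : R) :
  (forall x : R[i], `|x| <= 1 -> ~~ root (map_poly (real_complex R) B) x) ->
  (forall j, `|y j| <= M) ->
  exists yt : nat -> R, [/\ exists My, forall j, `|yt j| <= My,
    forall j, \sum_(i < size B) B`_i * yt (j + i)%N = y j &
    exists2 C, 0 <= C & forall N n, (N <= n)%N ->
      \sum_(N <= l < n) yt l ^+ 2 <= C * (1 + \sum_(N <= l < n) y l ^+ 2)].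
Proof.
move=> hB yM.
have M0 : 0 <= M by apply: le_trans (yM 0%N).
have B0 : B`_0 != 0.
  have := hB 0; rewrite normr0 ler01 => /(_ isT).
  rewrite -[0 : R[i]](rmorph0 (real_complex R)) fmorph_root /root horner_coef0//.
have [psi [psineg hpsi]] := impulse_response B0.
have [rho r01 bnd] := stable_filter_bound hB.
have /andP[r0 r1] := r01.
have d0 : 0 < 1 - rho by rewrite subr_gt0.
have [C C0 psiC] : exists2 C, 0 <= C & forall n : nat, `|psi n%:Z| <= C * rho ^+ n.
  apply: (bnd _ _ _ 1) => //.
  - by move=> n; rewrite exprn_ge0// ltW.
  - by move=> n; rewrite exprS.
  - move=> n; rewrite hpsi mul1r; case: n => [|n]; first by rewrite expr0 normr1.
    by rewrite normr0 exprn_ge0// ltW.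
have CM : 0 <= C * M by rewrite mulr_ge0.
have conv j k : `|psi k%:Z * y (j + k)%N| <= C * M * rho ^+ k.
  rewrite normrM mulrAC; apply: ler_pM => //.
have convE j k : `|C * rho ^+ k * `|y (j + k)%N| | <= C * M * rho ^+ k.
  have p0 : 0 <= rho ^+ k by rewrite exprn_ge0// ltW.
  rewrite ger0_norm ?mulr_ge0// [leLHS]mulrAC; apply: ler_wpM2r => //.
  exact: ler_wpM2l.
(* [yt] sums psi_k y_(j+k). The majorant [e], with |psi_k| and y replaced by C rho^k and |y|, is
   kept because it obeys a one-step recursion. *)
have [yt hyt] := choice (fun j => geometric_series r01 CM (conv j)).
have [e he] := choice (fun j => geometric_series r01 CM (convE j)).
set K := C * M / (1 - rho) in hyt he.
have K0 : 0 <= K by rewrite divr_ge0// ltW.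
have ytK j : `|yt j| <= K.
  by have := hyt j 0%N; rewrite big_ord0 subr0 expr0 mulr1.
have eK j : `|e j| <= K.
  by have := he j 0%N; rewrite big_ord0 subr0 expr0 mulr1.
have yte j : `|yt j| <= e j.
  rewrite -subr_le0; apply: (@le_geometric rho (2 * K)) => //; first by rewrite mulr_ge0.
  move=> N; have h1 := hyt j N; have h2 := he j N.
  have h3 : `|\sum_(k < N) psi k%:Z * y (j + k)%N| <= \sum_(k < N) C * rho ^+ k * `|y (j + k)%N|.
    apply: (le_trans (ler_norm_sum _ _ _)); apply: ler_sum => k _.
    by rewrite normrM; apply: ler_wpM2r.
  have := ler_normD (yt j - \sum_(k < N) psi k%:Z * y (j + k)%N) (\sum_(k < N) psi k%:Z * y (j + k)%N).
  rewrite subrK; move: h2; rewrite ler_norml => /andP[h2 _].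
  set t := K * _ in h1 h2 *; rewrite -mulrA -/t; lra.
have eS j : e j <= C * `|y j| + rho * e j.+1.
  rewrite -subr_le0; apply: (@le_geometric rho (2 * K)) => //; first by rewrite mulr_ge0.
  move=> N; have := he j N.+1; have := he j.+1 N.
  rewrite big_ord_recl/= expr0 mulr1 addn0.
  have -> : \sum_(i < N) C * rho ^+ bump 0 i * `|y (j + bump 0 i)%N| =
     rho * \sum_(k < N) C * rho ^+ k * `|y (j.+1 + k)%N|.
    rewrite mulr_sumr; apply: eq_bigr => i _.
    by rewrite /bump/= add1n exprS addnS addSn; ring.
  set s := \sum_(k < N) _; rewrite !ler_norml exprS => /andP[_ h1] /andP[_ h2].
  have t0 : 0 <= K * rho ^+ N by rewrite mulr_ge0// exprn_ge0// ltW.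
  rewrite mulrCA in h2.
  set t := K * rho ^+ N in h1 h2 t0 *; rewrite -mulrA -/t.
  have e0 : - t <= e j.+1 - s.
    by have := he j.+1 N; rewrite ler_norml => /andP[].
  have : rho * (e j.+1 - s) >= rho * - t by rewrite ler_pM2l.
  have : rho * t <= t by rewrite ler_piMl// ltW.
  lra.
exists yt; split; first by exists K.
  move=> j; apply/eqP; rewrite -subr_eq0 -normr_le0.
  pose Q := \sum_(i < size B) `|B`_i| * K.
  have Q0 : 0 <= Q by apply: sumr_ge0 => i _; rewrite mulr_ge0.
  apply: (@le_geometric rho Q) => // N.
  (* With this n at least N terms survive in each inner sum after the shift by i < size B. *)
  pose n := (N + size B)%N.
  have -> : y j = \sum_(i < size B) B`_i * \sum_(m < n.+1) psi (m%:Z - (i : nat)%:Z) * y (j + m)%N.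
    have -> : \sum_(i < size B) B`_i * \sum_(m < n.+1) psi (m%:Z - (i : nat)%:Z) * y (j + m)%N =
        \sum_(m < n.+1) filt B psi m%:Z * y (j + m)%N.
      under eq_bigr do rewrite mulr_sumr.
      rewrite exchange_big/=; apply: eq_bigr => m _; rewrite /filt mulr_suml.
      by apply: eq_bigr => i _; rewrite mulrA.
    rewrite big_ord_recl hpsi mul1r addn0 big1 ?addr0// => m _.
    by rewrite hpsi mul0r.
  rewrite -sumrB /Q mulr_suml; apply: (le_trans (ler_norm_sum _ _ _)); apply: ler_sum => i _.
  rewrite -mulrBr normrM -mulrA; apply: ler_wpM2l => //.
  have -> : \sum_(m < n.+1) psi (m%:Z - (i : nat)%:Z) * y (j + m)%N =
    \sum_(k < (n.+1 - i)%N) psi k%:Z * y (j + i + k)%N.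
    pose F (k : int) := psi k * (if k is Posz k' then y (j + i + k')%N else 0).
    rewrite -(sum_lag (F := F)) => [|k k0]; last by rewrite /F psineg// mul0r.
    apply: eq_bigr => m _; rewrite /F; have [im|mi] := leqP i m.
      rewrite subzn//.
      by rewrite -addnA subnKC.
    by rewrite psineg ?mul0r// subr_lt0 ltz_nat.
  apply: le_trans (hyt _ _) _; apply: ler_wpM2l => //.
  apply: ler_wiXn2l; [exact: ltW|exact: ltW|].
  by move: (ltn_ord i); rewrite /n; clear; lia.
have c1 : 0 < (1 - rho)^-1 by rewrite invr_gt0.
exists ((1 - rho)^-1 * (K ^+ 2 + C ^+ 2 / (1 - rho))).
  by rewrite mulr_ge0 ?addr_ge0 ?sqr_ge0 ?divr_ge0 ?sqr_ge0// ltW.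
move=> N n Nn.
have e0 l : 0 <= e l by exact: le_trans (yte l).
(* Convexity of the square as in [smooth_sqr], now backwards in time; shifting the sum by one costs
   only e_n^2 <= K^2. *)
have sq l : e l ^+ 2 <= rho * e l.+1 ^+ 2 + C ^+ 2 / (1 - rho) * y l ^+ 2.
  have h : e l ^+ 2 <= (C * `|y l| + rho * e l.+1) ^+ 2.
    by apply: lerXn2r; rewrite ?nnegrE ?addr_ge0 ?mulr_ge0// ltW.
  apply: le_trans h _; rewrite -(real_normK (num_real (y l))).
  set v := `|y l|; set u := e l.+1; rewrite -subr_ge0.
  have -> : rho * u ^+ 2 + C ^+ 2 / (1 - rho) * v ^+ 2 - (C * v + rho * u) ^+ 2 =
      rho * (1 - rho) * (u - C * v / (1 - rho)) ^+ 2.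
    by field; rewrite gt_eqF.
  by rewrite mulr_ge0 ?sqr_ge0// mulr_ge0// ltW.
have sumsq : (1 - rho) * \sum_(N <= l < n) e l ^+ 2 <=
    K ^+ 2 + C ^+ 2 / (1 - rho) * \sum_(N <= l < n) y l ^+ 2.
  have h1 : \sum_(N <= l < n) e l ^+ 2 <=
      rho * \sum_(N <= l < n) e l.+1 ^+ 2 + C ^+ 2 / (1 - rho) * \sum_(N <= l < n) y l ^+ 2.
    by rewrite !mulr_sumr -big_split; apply: ler_sum => l _; exact: sq.
  have h2 : \sum_(N <= l < n) e l.+1 ^+ 2 <= \sum_(N <= l < n) e l ^+ 2 + K ^+ 2.
    have hK : e n ^+ 2 <= K ^+ 2.
      by apply: lerXn2r; rewrite ?nnegrE//; apply: (le_trans _ (eK n)); exact: ler_norm.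
    have := telescope_sumr (fun l => e l ^+ 2) Nn; rewrite sumrB.
    have := sqr_ge0 (e N); lra.
  have h3 : rho * \sum_(N <= l < n) e l.+1 ^+ 2 <= rho * (\sum_(N <= l < n) e l ^+ 2 + K ^+ 2).
    by rewrite ler_pM2l.
  have h4 : rho * K ^+ 2 <= K ^+ 2 by rewrite ler_piMl ?sqr_ge0// ltW.
  set a := _ * \sum_(N <= l < n) y l ^+ 2 in h1 *; lra.
rewrite -mulrA -ler_pdivrMl// invrK.
apply: (@le_trans _ _ ((1 - rho) * \sum_(N <= l < n) e l ^+ 2)).
  apply: ler_wpM2l; first exact: ltW.
  apply: ler_sum => l _; rewrite -real_normK ?num_real//.
  by apply: lerXn2r; rewrite ?nnegrE.
apply: le_trans sumsq _.
set c := C ^+ 2 / (1 - rho); set s := \sum_(N <= l < n) y l ^+ 2.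
have s0 : 0 <= s by apply: sumr_ge0 => l _; exact: sqr_ge0.
have c0 : 0 <= c by rewrite divr_ge0 ?sqr_ge0// ltW.
have : 0 <= K ^+ 2 * s by rewrite mulr_ge0// sqr_ge0.
lra.
Qed.

End BackwardFilter.

(** * Reduction of the cross term to a martingale *)

Section CrossTerm.
Variable R : realType.
Variables (m : nat) (w : int -> R) (z : int -> 'cV[R]_m) (bet : nat -> 'cV[R]_m) (f : nat -> R).
Variables (B : {poly R}) (Cp : 'I_m -> {poly R}) (K : nat).
Variables (rho Cz : R) (E : nat -> R) (x : nat -> R) (Cx Cb : R).
Variables (y yt : nat -> R) (My Cy : R).
Hypothesis w0 : forall n, n <= 0 -> w n = 0.
Hypothesis zneg : forall n, n < 0 -> z n = 0.
Hypothesis zB : forall i n, filt B (fun k => z k i 0) n = filt (Cp i) w n.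
Hypothesis CpK : forall i, (size (Cp i) <= K)%N.
Hypothesis rho01 : 0 < rho < 1.
Hypothesis E0 : E 0%N = `|w 0|.
Hypothesis ES : forall n, E n.+1 = rho * E n + `|w n.+1%:Z|.
Hypothesis Cz0 : 0 <= Cz.
Hypothesis zE : forall n : nat, nsq (z n%:Z) <= Cz * E n ^+ 2.
Hypothesis Enegl : negl (fun n => E n ^+ 2) (fun n => n%:R).
Hypothesis fE : forall n : nat, f n = dot (bet n) (z n%:Z).
Hypothesis fnegl : negl f lnS.
Hypothesis x0 : forall n, 0 <= x n.
Hypothesis Cx0 : 0 <= Cx.
Hypothesis xsum : forall n, \sum_(j < n) x j <= Cx * (1 + lnS n).
Hypothesis Cb0 : 0 <= Cb.
Hypothesis bstep : forall n, nsq (bet n.+1 - bet n) <= Cb / n.+1%:R * x n.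
Hypothesis ytM : forall j, `|yt j| <= My.
Hypothesis ytB : forall j, \sum_(i < size B) B`_i * yt (j + i)%N = y j.
Hypothesis Cy0 : 0 <= Cy.
Hypothesis yt_sq : forall N n, (N <= n)%N ->
  \sum_(N <= l < n) yt l ^+ 2 <= Cy * (1 + \sum_(N <= l < n) y l ^+ 2).

Let colC (k : nat) : 'cV[R]_m := \col_i (Cp i)`_k.

Hypothesis mart : forall k, (k < K)%N ->
  negl (fun n => \sum_(j < n) yt (j + k.+1)%N * dot (bet j) (colC k) * w j.+1%:Z) lnS.

Let r0 : 0 < rho. Proof. by have /andP[] := rho01. Qed.
Let lnS0 n : 0 <= lnS n :> R. Proof. exact: lnS_ge0. Qed.

Let E_ge0 n : 0 <= E n.
Proof. exact: (smooth_ge0 (w := fun n => w n%:Z) rho01). Qed.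

Let E_lag i n : (i <= n)%N -> E (n - i)%N ^+ 2 <= (rho ^+ i) ^- 2 * E n ^+ 2.
Proof.
move=> i_n; have := smooth_lag (w := fun n => w n%:Z) rho01 ES i (n - i).
rewrite subnK// => h.
have ri : 0 < rho ^+ i by rewrite exprn_gt0.
rewrite -exprVn -exprMn; apply: lerXn2r; rewrite ?nnegrE ?mulr_ge0 ?invr_ge0 ?(ltW ri)//.
by rewrite ler_pdivlMl.
Qed.

Definition window_small (t : nat -> R) := forall e : R, 0 < e -> exists C : R,
  forall N n, (N <= n)%N ->
  `|\sum_(N <= l < n) t l| <= C + e * lnS n + e * \sum_(N <= l < n) yt l ^+ 2.

Let ss0 N n : 0 <= \sum_(N <= l < n) yt l ^+ 2.
Proof. by apply: sumr_ge0 => l _; exact: sqr_ge0. Qed.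

Lemma window_small_ext (t t' : nat -> R) : t =1 t' -> window_small t -> window_small t'.
Proof.
move=> tt h e /h[C hC]; exists C => N n Nn; rewrite -(eq_bigr _ (fun l _ => tt l)).
exact: hC.
Qed.

Lemma window_smallD (t t' : nat -> R) : window_small t -> window_small t' ->
  window_small (fun l => t l + t' l).
Proof.
move=> h h' e e0; have e2 : 0 < e / 2 by rewrite divr_gt0.
have [C hC] := h _ e2; have [C' hC'] := h' _ e2; exists (C + C') => N n Nn.
rewrite big_split/=; apply: le_trans (ler_normD _ _) _.
have := hC N n Nn; have := hC' N n Nn; set u := \sum_(N <= l < n) yt l ^+ 2; lra.
Qed.

Lemma window_small_sum (I : Type) (s : seq I) (t : I -> nat -> R) :
  (forall i, window_small (t i)) -> window_small (fun l => \sum_(i <- s) t i l).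
Proof.
move=> h; elim: s => [|i s IH].
  move=> e e0; exists 0 => N n _; rewrite big1 ?normr0; last by move=> l _; rewrite big_nil.
  by rewrite add0r addr_ge0 ?mulr_ge0 ?ss0// ltW.
by apply: window_small_ext (window_smallD (h i) IH) => l; rewrite big_cons.
Qed.

Lemma window_small_negl (t : nat -> R) : negl (fun n => \sum_(j < n) t j) lnS -> window_small t.
Proof.
move=> h e e0; have e2 : 0 < e / 2 by rewrite divr_gt0.
have [C hC] := h _ e2; exists (C + C) => N n Nn; rewrite window_sum//.
have h1 := hC n; have h2 := hC N; have h3 := lnS_homo R Nn.
apply: le_trans (ler_normB _ _) _.
have h4 : e / 2 * lnS N <= e / 2 * lnS n by rewrite ler_pM2l.
have := mulr_ge0 (ltW e0) (ss0 N n); lra.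
Qed.

Let D s l := nsq (bet l - bet (l - s)%N) * E l ^+ 2.

Let D_ge0 s l : 0 <= D s l. Proof. by rewrite mulr_ge0 ?nsq_ge0// sqr_ge0. Qed.

(** Induction on the lag: a step adds |beta_(r+1) - beta_r|^2 E_(r+s+1)^2 <= Cb x_r
    E_(r+s+1)^2/(r+1), where the quotient E^2/(r+1) vanishes and x sums to O(log n). *)
Lemma increments_negl s : negl (fun n => \sum_(l < n) D s l) lnS.
Proof.
elim: s => [|s IH].
  apply: (negl_bounded (C := 0)) => // n; rewrite big1 ?normr0// => l _.
  by rewrite /D subn0 subrr nsq0 mul0r.
pose v r := E (r + s.+1)%N ^+ 2 / r.+1%:R.
have vv : vanish v.
  have h : negl (fun r => E (r + s.+1)%N ^+ 2) (fun n => n%:R).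
    move=> e e0; have [C hC] := Enegl e0; exists (C + e * s.+1%:R) => n.
    by apply: le_trans (hC _) _; rewrite natrD; lra.
  exact: negl_vanish h.
have cx : forall n, \sum_(j < n) x j <= Cx + Cx * lnS n.
  by move=> n; have := xsum n; rewrite mulrDr mulr1.
have h1 := negl_sum_vanish vv Cx0 x0 lnS0 cx.
have h2 := neglZ (2 * Cb) lnS0 h1; have h3 := neglZ 2 lnS0 IH.
apply: negl_le (neglD h2 h3) => n.
have v0 r : 0 <= v r by rewrite divr_ge0// sqr_ge0.
rewrite ger0_norm; last by apply: sumr_ge0 => l _; exact: D_ge0.
apply: (le_trans _ (ler_norm _)).
pose d r := nsq (bet r.+1 - bet r).
have step l : D s.+1 l <= 2 * D s l +
    2 * (if (s < l)%N then d (l - s.+1)%N * E l ^+ 2 else 0).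
  rewrite /D; have [sl|ls] := ltnP s l; last first.
    rewrite (_ : (l - s.+1 = l - s)%N) ?mulr0 ?addr0; last by lia.
    by rewrite ler_peMl ?ler1n// mulr_ge0 ?nsq_ge0// sqr_ge0.
  rewrite [2 * (nsq _ * _)]mulrA [2 * (d _ * _)]mulrA -mulrDl.
  apply: ler_wpM2r; first exact: sqr_ge0.
  rewrite /d (_ : (l - s.+1).+1 = l - s)%N; last by lia.
  have -> : bet l - bet (l - s.+1)%N =
    (bet l - bet (l - s)%N) + (bet (l - s)%N - bet (l - s.+1)%N) by rewrite addrA subrK.
  exact: nsqD_le.
have sumd : \sum_(l < n) (if (s < l)%N then d (l - s.+1)%N * E l ^+ 2 else 0) <=
    Cb * \sum_(r < n) v r * x r.
  pose F (k : int) := if k is Posz r then d r * E (r + s.+1)%N ^+ 2 else 0.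
  have -> : \sum_(l < n) (if (s < l)%N then d (l - s.+1)%N * E l ^+ 2 else 0) =
      \sum_(l < n) F (l%:Z - s.+1%:Z).
    apply: eq_bigr => l _; case: ltnP => sl.
      by rewrite (_ : l%:Z - s.+1%:Z = (l - s.+1)%N%:Z) /= ?subnK//; lia.
    have : l%:Z - s.+1%:Z < 0 by lia.
    by case: (_ - _).
  apply: (@le_trans _ _ (\sum_(r < n) F r%:Z)).
    apply: sum_lag_le => [[]//|[r|r]//=].
    by rewrite mulr_ge0 ?nsq_ge0// sqr_ge0.
  rewrite mulr_sumr; apply: ler_sum => r _ /=.
  have -> : Cb * (v r * x r) = (Cb / r.+1%:R * x r) * E (r + s.+1)%N ^+ 2.
    by rewrite /v; ring.
  by apply: ler_wpM2r; [exact: sqr_ge0|exact: bstep].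
apply: (@le_trans _ _ (\sum_(l < n) (2 * D s l +
    2 * (if (s < l)%N then d (l - s.+1)%N * E l ^+ 2 else 0)))).
  by apply: ler_sum => l _; exact: step.
rewrite big_split/= -!mulr_sumr.
lra.
Qed.

(** Young's inequality with weight e: the squares of [yt] are allowed by [window_small], and those
    of t, divided by the fixed e, remain negligible. *)
Lemma window_small_increment s (C : R) (t : nat -> R) : 0 <= C ->
  (forall l, t l ^+ 2 <= C * D s l) -> window_small (fun l => yt l * t l).
Proof.
move=> C0 ht e e0.
have e1 : 0 < e * e by rewrite mulr_gt0.
pose C1 := C / e.
have C10 : 0 <= C1 by rewrite divr_ge0// ltW.
have h := neglZ C1 lnS0 (increments_negl s).
have [C' hC'] := h _ e0; exists C' => N n Nn.
apply: (le_trans (ler_norm_sum _ _ _)).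
apply: (@le_trans _ _ (\sum_(N <= l < n) (e * yt l ^+ 2 + C1 * D s l))).
  apply: ler_sum => l _; rewrite normrM.
  have h1 : `|t l| ^+ 2 / e <= C1 * D s l.
    rewrite real_normK ?num_real// /C1 [leRHS]mulrAC.
    by apply: ler_wpM2r; rewrite ?invr_ge0 ?(ltW e0).
  apply: (@le_trans _ _ (e * yt l ^+ 2 + `|t l| ^+ 2 / e)); last by rewrite lerD2l.
  rewrite -(real_normK (num_real (yt l))) -subr_ge0.
  set u := `|yt l|; set v := `|t l|.
  have -> : e * u ^+ 2 + v ^+ 2 / e - u * v = e * ((u - v / (2 * e)) ^+ 2 + 3 / 4 * (v / e) ^+ 2).
    by field; rewrite gt_eqF.
  by rewrite mulr_ge0 ?(ltW e0)// addr_ge0 ?sqr_ge0// mulr_ge0 ?sqr_ge0.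
rewrite big_split/= -!mulr_sumr addrC lerD2r.
apply: (@le_trans _ _ (C1 * \sum_(l < n) D s l)).
  apply: ler_wpM2l => //; rewrite window_sum// gerBl.
  by apply: sumr_ge0 => l _; exact: D_ge0.
by apply: le_trans (ler_norm _) (hC' n).
Qed.

(* f extended by zero to negative times. *)
Let fI (k : int) : R := if k is Posz n then f n else 0.

Let fI_neg k : k < 0 -> fI k = 0. Proof. by case: k. Qed.

(** Each unit of lead of u exchanged for a unit of lag of f costs a boundary term u_n f_(n-i-1), a
    bounded factor times o(log n). *)
Lemma shift_negl i (u : nat -> R) (Mu : R) : (forall j, `|u j| <= Mu) ->
  negl (fun n => \sum_(j < n) u (j + i)%N * f j - \sum_(l < n) u l * fI (l%:Z - i%:Z)) lnS.
Proof.
elim: i u => [|i IH] u uM.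
  apply: (negl_bounded (C := 0)) => // n; rewrite -sumrB big1 ?normr0// => l _.
  by rewrite addn0 subr0 subrr.
have h1 := IH (fun j => u j.+1) (fun j => uM j.+1).
have h2 : negl (fun n => u n * fI (n%:Z - i.+1%:Z)) lnS.
  apply: (@negl_le _ _ (fun n => Mu * fI (n%:Z - i.+1%:Z))).
    move=> n; rewrite !normrM; apply: ler_wpM2r => //.
    by apply: le_trans (uM n) _; exact: ler_norm.
  apply: neglZ => //.
  move=> e e0; have [C hC] := fnegl e0; exists `|C| => n.
  have [ni|ni] := ltnP i n; last first.
    rewrite fI_neg ?subr_lt0 ?ltz_nat//.
    by rewrite normr0 addr_ge0// mulr_ge0// ltW.
  rewrite subzn//.
  apply: le_trans (hC _) _; apply: lerD; first exact: ler_norm.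
  by apply: ler_wpM2l; [exact: ltW|apply: lnS_homo; exact: leq_subr].
apply: negl_ext (neglD h1 h2) => n /=.
have tel : \sum_(l < n) u l.+1 * fI (l%:Z - i%:Z) =
    \sum_(l < n) u l * fI (l%:Z - i.+1%:Z) + u n * fI (n%:Z - i.+1%:Z).
  have -> : \sum_(l < n) u l * fI (l%:Z - i.+1%:Z) + u n * fI (n%:Z - i.+1%:Z) =
      \sum_(l < n.+1) u l * fI (l%:Z - i.+1%:Z) by rewrite big_ord_recr.
  rewrite big_ord_recl fI_neg ?mulr0 ?add0r; last by rewrite /=; lia.
  apply: eq_bigr => l _; rewrite lift0; congr (_ * fI _); lia.
rewrite tel.
have -> : \sum_(j < n) u (j + i).+1 * f j = \sum_(j < n) u (j + i.+1)%N * f j.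
  by apply: eq_bigr => j _; rewrite addnS.
ring.
Qed.

(* term1 and term2 only involve increments of bet over a bounded lag; in term3 the
   coefficient of w (l - k) is known at time l - k - 1. *)
Let term1 (i : nat) l := B`_i * dot (bet (l - i)%N - bet l) (z (l%:Z - i%:Z)).
Let term2 (k : nat) l := dot (bet l - bet (l - k.+1)%N) (colC k) * w (l%:Z - k%:Z).
Let term3 (k : nat) l := dot (bet (l - k.+1)%N) (colC k) * w (l%:Z - k%:Z).

(** beta is first frozen at time l, so that B acts on z alone and yields a finite noise average; it
    is then moved back to just before each noise term. *)
Lemma filt_pred_split l : filt B fI l%:Z =
  \sum_(i < size B) term1 i l + \sum_(k < K) term2 k l + \sum_(k < K) term3 k l.
Proof.
have -> : filt B fI l%:Z = \sum_(i < size B) term1 i l + filt B (fun k => dot (bet l) (z k)) l%:Z.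
  rewrite /filt -big_split/=; apply: eq_bigr => i _; rewrite /term1 -mulrDr; congr (_ * _).
  have [il|li] := leqP i l; last first.
    have neg : l%:Z - (i : nat)%:Z < 0 by lia.
    by rewrite (fI_neg neg) (zneg neg) !dot0r addr0.
  rewrite (_ : l%:Z - (i : nat)%:Z = (l - i)%N%:Z); last by lia.
  by rewrite /= fE -dotDl subrK.
rewrite (filt_dot zB CpK) -addrA; congr (_ + _).
rewrite -big_split/=; apply: eq_bigr => k _.
rewrite /term2 /term3 -mulrDl -dotDl subrK; congr (_ * _).
by apply: eq_bigr => i _; rewrite mxE.
Qed.

Lemma term1_small i : window_small (fun l => yt l * term1 i l).
Proof.
apply: (@window_small_increment i (B`_i ^+ 2 * (Cz * (rho ^+ i) ^- 2))).
  by rewrite mulr_ge0 ?sqr_ge0// mulr_ge0// invr_ge0 sqr_ge0.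
move=> l; rewrite /term1 exprMn -[leRHS]mulrA; apply: ler_wpM2l; first exact: sqr_ge0.
have [il|li] := leqP i l; last first.
  rewrite zneg ?dot0r ?expr0n; last by lia.
  by rewrite mulr_ge0// mulr_ge0// invr_ge0 sqr_ge0.
rewrite (_ : l%:Z - i%:Z = (l - i)%N%:Z); last by lia.
apply: le_trans (cauchy_schwarz_dot _ _) _.
rewrite /D -[bet l - _]opprB nsqN mulrCA; apply: ler_wpM2l; first exact: nsq_ge0.
apply: le_trans (zE _) _; rewrite -mulrA; apply: ler_wpM2l => //; exact: E_lag.
Qed.

Lemma term2_small k : window_small (fun l => yt l * term2 k l).
Proof.
apply: (@window_small_increment k.+1 (nsq (colC k) * (rho ^+ k) ^- 2)).
  by rewrite mulr_ge0 ?nsq_ge0// invr_ge0 sqr_ge0.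
move=> l; rewrite /term2 exprMn /D.
have [kl|lk] := leqP k l; last first.
  rewrite w0 ?expr0n ?mulr0; last by lia.
  by rewrite mulr_ge0 ?mulr_ge0 ?nsq_ge0 ?invr_ge0 ?sqr_ge0.
rewrite (_ : l%:Z - k%:Z = (l - k)%N%:Z); last by lia.
have wl : w (l - k)%N%:Z ^+ 2 <= (rho ^+ k) ^- 2 * E l ^+ 2.
  apply: le_trans (E_lag kl); rewrite -real_normK ?num_real//.
  apply: lerXn2r; rewrite ?nnegrE//.
  exact: (smooth_ge_norm (w := fun n => w n%:Z) rho01 E0 ES).
have -> : nsq (colC k) * rho ^+ k ^- 2 * (nsq (bet l - bet (l - k.+1)%N) * E l ^+ 2) =
  (nsq (bet l - bet (l - k.+1)%N) * nsq (colC k)) * ((rho ^+ k) ^- 2 * E l ^+ 2) by ring.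
by apply: ler_pM => //; rewrite ?sqr_ge0//; exact: cauchy_schwarz_dot.
Qed.

Lemma term3_small (k : 'I_K) : window_small (fun l => yt l * term3 k l).
Proof.
apply: window_small_negl.
have h := negl_pred k.+1 lnS0 (@lnS_homo R) (mart (ltn_ord k)).
apply: negl_ext h => n /=.
pose F (j : int) := if j is Posz j' then yt (j' + k.+1)%N * dot (bet j') (colC k) * w j'.+1%:Z else 0.
rewrite -(sum_lag (F := F)); last by case.
apply: eq_bigr => l _; have [kl|lk] := ltnP k l.
  rewrite (_ : l%:Z - k.+1%:Z = (l - k.+1)%N%:Z); last by lia.
  rewrite /= subnK// /term3 mulrA; congr (_ * w _); lia.
rewrite /term3 [w _]w0 ?mulr0; last by lia.
have : l%:Z - k.+1%:Z < 0 by lia.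
by case: (_ - _).
Qed.

Lemma cross_term : forall e : R, 0 < e -> exists C : R, forall N n, (N <= n)%N ->
  `|\sum_(N <= j < n) y j * f j| <= C + e * lnS n + e * \sum_(N <= j < n) y j ^+ 2.
Proof.
have main : window_small (fun l => y l * f l).
  have h1 : window_small (fun l => yt l * filt B fI l%:Z).
    have s1 := window_small_sum (index_enum 'I_(size B)) (fun i => term1_small i).
    have s2 := window_small_sum (index_enum 'I_K) (fun i : 'I_K => term2_small i).
    have s3 := window_small_sum (index_enum 'I_K) term3_small.
    apply: window_small_ext (window_smallD (window_smallD s1 s2) s3) => l.
    by rewrite filt_pred_split !mulrDr !mulr_sumr.
  have h2 : window_small (fun l => y l * f l - yt l * filt B fI l%:Z).
    apply: window_small_negl.
    have h (i : 'I_(size B)) := neglZ B`_i lnS0 (shift_negl i ytM).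
    apply: negl_ext (negl_sum (index_enum 'I_(size B)) lnS0 h) => n /=.
    rewrite sumrB; under eq_bigr do rewrite mulrBr !mulr_sumr.
    rewrite sumrB; congr (_ - _).
      rewrite exchange_big/=; apply: eq_bigr => j _; rewrite -ytB mulr_suml.
      by apply: eq_bigr => i _; rewrite mulrA.
    rewrite exchange_big/=; apply: eq_bigr => l _; rewrite /filt mulr_sumr.
    by apply: eq_bigr => i _; rewrite mulrCA.
  by apply: window_small_ext (window_smallD h2 h1) => l; rewrite subrK.
(* Dividing e by Cy + 1 converts the energy of [yt] into that of y. *)
move=> e e0; have cy := Cy0; have C1 : 0 < Cy + 1 by lra.
have e1 := divr_gt0 e0 C1.
have e1e : e / (Cy + 1) <= e by rewrite ler_pdivrMr//; have := mulr_ge0 (ltW e0) cy; lra.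
have [C hC] := main _ e1; exists (C + e) => N n Nn.
apply: le_trans (hC N n Nn) _.
have h1 : e / (Cy + 1) * lnS n <= e * lnS n by apply: ler_wpM2r.
have h2 : e / (Cy + 1) * \sum_(N <= l < n) yt l ^+ 2 <= e * (1 + \sum_(N <= l < n) y l ^+ 2).
  rewrite mulrAC ler_pdivrMr// -mulrA; apply: ler_wpM2l; first exact: ltW.
  apply: le_trans (yt_sq Nn) _; rewrite mulrC; apply: ler_wpM2l; last by lra.
  by rewrite addr_ge0// sumr_ge0// => l _; exact: sqr_ge0.
lra.
Qed.

End CrossTerm.

(** * The regression model *)

Section Coprime.
Variable R : realType.
Variables (p q : nat) (a b : nat -> R).
Hypothesis hq : (1 <= q)%N.
Hypothesis hb1 : b 1%N != 0.
Hypothesis hgcd : coprimep (polyA p a - 1) (polyB q b).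
Hypothesis hdeg : size (polyA p a - 1) = p.+1 \/ size (polyB q b) = q.

(** This is (A - 1)/X, with which the defining relation of the input reads B u = A' w at equal
    times. *)
Let A' : {poly R} := \poly_(i < p) a i.+1.
Let B := polyB q b.

Lemma polyB_poly : B = \poly_(j < q) b j.+1.
Proof. by rewrite /B /polyB big_add1 /= big_mkord poly_def. Qed.

Lemma polyA1_shift : polyA p a - 1 = A' * 'X.
Proof.
rewrite /polyA addrC addKr big_add1/= big_mkord /A' poly_def mulr_suml.
by apply: eq_bigr => i _; rewrite -scalerAl exprSr.
Qed.

Lemma polyB_neq0 : B != 0.
Proof.
apply: contra hb1 => /eqP h; have : B`_0 = 0 by rewrite h coef0.
by rewrite polyB_poly coef_poly hq => ->.
Qed.

(** Coprimality of B and A' forces V2 = k B and V1 = -k A' for a polynomial k. By [hdeg] one of the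
    two size bounds makes k constant, and the coefficients of -A' and B are the entries of
    [theta]. *)
Lemma null_filter_combination (v1 : 'cV[R]_p) (v2 : 'cV[R]_q) :
  B * (\poly_(i < p) (if insub i is Some k then v1 k 0 else 0))
  + (\poly_(j < q) (if insub j is Some k then v2 k 0 else 0)) * A' = 0 ->
  exists c, col_mx v1 v2 = c *: theta p q a b.
Proof.
set V1 := \poly_(i < p) _; set V2 := \poly_(j < q) _ => h.
have cop : coprimep B A'.
  by move: hgcd; rewrite polyA1_shift coprimepMl coprimep_sym => /andP[].
have dv : B %| V2.
  rewrite -(Gauss_dvdpl V2 cop); apply/dvdpP; exists (- V1).
  by rewrite mulNr; apply/eqP; rewrite -addr_eq0 mulrC addrC mulrC [V1 * _]mulrC h.
set k := V2 %/ B.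
have V2E : V2 = k * B by rewrite divpK.
have V1E : V1 = - (k * A').
  apply: (mulfI polyB_neq0); apply/eqP; rewrite mulrN -addr_eq0 -h V2E.
  by apply/eqP; congr (_ + _); ring.
have kc : (size k <= 1)%N.
  have [->|k0] := eqVneq k 0; first by rewrite size_poly0.
  case: hdeg => hs.
    have A'0 : A' != 0.
      apply/eqP => A0; move: hs; rewrite polyA1_shift A0 mul0r size_poly0//.
    have : (size V1 <= p)%N by exact: size_poly.
    rewrite V1E size_polyN size_mul//.
    have : (size A').+1 = p.+1 by rewrite -hs polyA1_shift size_mulX.
    have : (0 < size A')%N by rewrite size_poly_gt0.
    by move: (size A') (size k) => sa sk; lia.
  have : (size V2 <= q)%N by exact: size_poly.
  rewrite V2E size_mul ?polyB_neq0// -/B hs.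
  by move: (size k) => sk; lia.
exists k`_0.
have kE : k = (k`_0)%:P by exact: size1_polyC.
apply/matrixP => l j; rewrite ord1 mxE [in RHS]mxE /theta [in RHS]mxE.
case: (splitP l) => i _.
  have := congr1 (fun F : {poly R} => F`_i) V1E; rewrite /V1 coef_poly ltn_ord.
  by rewrite coefN {1}kE coefCM coef_poly ltn_ord mxE (valK i) mulrN.
have := congr1 (fun F : {poly R} => F`_i) V2E; rewrite /V2 coef_poly ltn_ord.
by rewrite {1}kE coefCM polyB_poly coef_poly ltn_ord mxE (valK i).
Qed.

Variable Q : 'M[R]_(p + q, (p + q).-1).
Hypothesis hQ : orthonormal_basis_of_orthogonal Q (theta p q a b).

Let m := (p + q).-1.

Definition colV1 (x : 'cV[R]_(p + q)) : {poly R} :=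
  \poly_(i < p) (if insub i is Some k then x (lshift q k) 0 else 0).
Definition colV2 (x : 'cV[R]_(p + q)) : {poly R} :=
  \poly_(i < q) (if insub i is Some k then x (rshift p k) 0 else 0).
(** Since B u = A' w, applying B to the i-th coordinate of z leaves exactly this filter of the
    noise. *)
Definition regfilt (i : 'I_m) : {poly R} := B * colV1 (col i Q) + colV2 (col i Q) * A'.

Lemma colV1E x (k : 'I_p) : (colV1 x)`_k = x (lshift q k) 0.
Proof.
by rewrite coef_poly ltn_ord (valK k).
Qed.

Lemma colV2E x (k : 'I_q) : (colV2 x)`_k = x (rshift p k) 0.
Proof.
by rewrite coef_poly ltn_ord (valK k).
Qed.

Lemma size_regfilt i : (size (regfilt i) <= p + q)%N.
Proof.
clear hq hb1 hgcd hdeg.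
have sB : (size B <= q)%N by rewrite polyB_poly size_poly.
have h1 := size_polyMleq B (colV1 (col i Q)).
have h2 := size_polyMleq (colV2 (col i Q)) A'.
have s1 : (size (colV1 (col i Q)) <= p)%N by exact: size_poly.
have s2 : (size (colV2 (col i Q)) <= q)%N by exact: size_poly.
have s3 : (size A' <= p)%N by exact: size_poly.
apply: leq_trans (size_polyD _ _) _; rewrite geq_max; apply/andP; split; lia.
Qed.

Lemma Q_orth : Q^T *m theta p q a b = 0.
Proof. by have [_ /andP[/sub_kermxP]] := hQ. Qed.

Lemma nsq_Q x : nsq (Q *m x) = nsq x.
Proof.
have [h _] := hQ.
by rewrite /nsq dot_mulmx mulmxA h mul1mx.
Qed.

(** A vanishing combination with coefficients x makes Q x a multiple of [theta]; being orthogonal to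
    [theta] it is zero, and Q preserves norms. *)
Lemma regfilt_free : row_free (\matrix_(i < m, k < (p + q)%N) (regfilt i)`_k).
Proof.
set C := \matrix_(i, k) _.
rewrite -kermx_eq0; apply/rowV0P => x /sub_kermxP xC.
pose v := Q *m x^T.
have lin : \sum_i x 0 i *: regfilt i = B * colV1 v + colV2 v * A'.
  have e1 : \sum_i x 0 i *: colV1 (col i Q) = colV1 v.
    apply/polyP => k; rewrite coef_sum coef_poly; case: ltnP => kp; last first.
      by apply: big1 => i _; rewrite coefZ coef_poly ltnNge kp mulr0.
    rewrite insubT/= mxE; apply: eq_bigr => i _.
    by rewrite coefZ coef_poly kp insubT/= !mxE mulrC.
  have e2 : \sum_i x 0 i *: colV2 (col i Q) = colV2 v.
    apply/polyP => k; rewrite coef_sum coef_poly; case: ltnP => kp; last first.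
      by apply: big1 => i _; rewrite coefZ coef_poly ltnNge kp mulr0.
    rewrite insubT/= mxE; apply: eq_bigr => i _.
    by rewrite coefZ coef_poly kp insubT/= !mxE mulrC.
  rewrite -e1 -e2 mulr_sumr mulr_suml -big_split; apply: eq_bigr => i _ /=.
  by rewrite /regfilt scalerDr -scalerAr -scalerAl.
have z : B * colV1 v + colV2 v * A' = 0.
  rewrite -lin; apply/polyP => k; rewrite coef0 coef_sum.
  have [kpq|kpq] := ltnP k (p + q); last first.
    apply: big1 => i _; rewrite coefZ nth_default ?mulr0//.
    exact: leq_trans (size_regfilt i) kpq.
  have E : (x *m C) 0 (Ordinal kpq) = 0 by rewrite xC mxE.
  rewrite -[RHS]E mxE; apply: eq_bigr => i _.
  by rewrite coefZ /C mxE.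
have [c vE] : exists c, v = c *: theta p q a b.
  rewrite -[v]vsubmxK; apply: null_filter_combination.
  rewrite -[RHS]z; congr (B * _ + _ * A').
    by apply: eq_poly => i _; case: insubP => // k _ _; rewrite mxE.
  by apply: eq_poly => i _; case: insubP => // k _ _; rewrite mxE.
have v0 : nsq v = 0.
  by rewrite /nsq {2}vE dotZr /v -dotC dot_mulmx Q_orth dot0l mulr0.
apply: trmx_inj; rewrite trmx0; apply: nsq_eq0.
by rewrite -nsq_Q.
Qed.

Variables (thetahat0 : 'cV[R]_(p + q)) (P0 : 'M[R]_(p + q)).
Hypothesis hP0 : sym_posdef P0.

Lemma G0E : G0 a b Q P0 = Q^T *m invmx P0 *m Q.
Proof.
by rewrite /G0 /Ltheta tr_row_mx mul_col_mx mul_col_row block_mxKdr.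
Qed.

Lemma G0_sym : (G0 a b Q P0)^T = G0 a b Q P0.
Proof. by have [h _] := hP0; rewrite G0E !trmx_mul trmxK trmx_inv h mulmxA. Qed.

(** An upper bound on P0 bounds its inverse from below, and Q is an isometry. *)
Lemma G0_low : exists2 g0 : R, 0 < g0 &
  forall x, g0 * nsq x <= dot x (G0 a b Q P0 *m x).
Proof.
have [c c0 hc] := posdef_lower_bound hP0.
have [C C0 hC] := qf_upper_bound P0.
have [Ps _] := hP0.
have C1 : 0 < C + 1 by lra.
have hC1 x : dot x (P0 *m x) <= (C + 1) * nsq x.
  by apply: le_trans (hC x) _; have := nsq_ge0 x; lra.
exists (C + 1)^-1 => [|x]; first by rewrite invr_gt0.
rewrite G0E -!mulmxA dot_mulmx trmxK -(nsq_Q x) ler_pdivrMl//.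
by have := nsq_le_dot_invmx Ps c0 hc C1 hC1 (Q *m x).
Qed.

Variables w u : int -> R.
Hypothesis w0 : forall n, n <= 0 -> w n = 0.
Hypothesis hu : ideal_input p q a b w u.

(** Defined at all integer times because B, applied near time 0, reaches back to negative ones. *)
Definition zint (n : int) : 'cV[R]_m :=
  Q^T *m col_mx (\col_(i < p) w (n - (i : nat)%:Z)) (\col_(j < q) u (n - (j : nat)%:Z)).

Let wneg n : n < 0 -> w n = 0. Proof. by move=> /ltW; exact: w0. Qed.

Lemma zint_neg n : n < 0 -> zint n = 0.
Proof.
clear hq hb1 hgcd hdeg hQ hP0.
have [uneg _] := hu; move=> n0; rewrite /zint.
have -> : col_mx (\col_(i < p) w (n - (i : nat)%:Z)) (\col_(j < q) u (n - (j : nat)%:Z)) = 0.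
  rewrite -[RHS]vsubmxK !linear0; congr col_mx; apply/matrixP => i j; rewrite !mxE.
    by rewrite wneg//; lia.
  by rewrite uneg//; lia.
by rewrite mulmx0.
Qed.

Lemma zint_coord n i : zint n i 0 =
  \sum_(k < p) Q (lshift q k) i * w (n - (k : nat)%:Z)
  + \sum_(k < q) Q (rshift p k) i * u (n - (k : nat)%:Z).
Proof.
rewrite mxE big_split_ord/=; congr (_ + _); apply: eq_bigr => k _; rewrite mxE; congr (_ * _).
  by rewrite col_mxEu mxE.
by rewrite col_mxEd mxE.
Qed.

Lemma filtB_input n : filt B u n = filt A' w n.
Proof.
have [uneg h] := hu; have [n0|n0] := leP 0 n; last by rewrite !filt_neg.
have : filt B u n = filt (polyA p a - 1) w (n + 1) := h n n0.
by rewrite polyA1_shift filtMX addrK.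
Qed.

Lemma zint_filt i n : filt B (fun k => zint k i 0) n = filt (regfilt i) w n.
Proof.
rewrite /regfilt filtDl.
have zE k : zint k i 0 = filt (colV1 (col i Q)) w k + filt (colV2 (col i Q)) u k.
  rewrite zint_coord; congr (_ + _).
    rewrite (filt_wide (N := p)); last exact: size_poly.
    by apply: eq_bigr => l _; rewrite colV1E mxE.
  rewrite (filt_wide (N := q)); last exact: size_poly.
  by apply: eq_bigr => l _; rewrite colV2E mxE.
rewrite (filt_ext B n zE).
rewrite filtDr -!filtM; congr (_ + _).
by rewrite mulrC !filtM; apply: filt_ext => k; exact: filtB_input.
Qed.

Hypothesis hB : forall x : R[i], `|x| <= 1 -> ~~ root (map_poly (real_complex R) B) x.

(** rho comes from the roots of B, E smooths |w| at that rate, and each lag costs a factor 1/rho in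
    the constant. *)
Lemma input_bound : exists rho E Cz,
  [/\ 0 < rho < 1, E 0%N = `|w 0|, forall n, E n.+1 = rho * E n + `|w n.+1%:Z|, 0 <= Cz &
   forall i (n : nat), `|zint n%:Z i 0| <= Cz * E n].
Proof.
clear hgcd hdeg.
have [rho r01 bnd] := stable_filter_bound hB.
have /andP[r0 r1] := r01.
pose fix E (n : nat) : R := if n is n'.+1 then rho * E n' + `|w n%:Z| else `|w 0|.
have E0 : E 0%N = `|w 0| by [].
have ES n : E n.+1 = rho * E n + `|w n.+1%:Z| by [].
have Ege0 := smooth_ge0 (w := fun n => w n%:Z) r01 E0 ES.
have Edec := smooth_decay (w := fun n => w n%:Z) ES.
have [uneg _] := hu.
have lag (v : int -> R) Cv : 0 <= Cv -> (forall n, n < 0 -> v n = 0) ->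
    (forall n : nat, `|v n%:Z| <= Cv * E n) ->
    forall k n : nat, `|v (n%:Z - k%:Z)| <= Cv / rho ^+ k * E n.
  move=> Cv0 vneg hv k n.
  have rk : 0 < rho ^+ k by rewrite exprn_gt0.
  have [kn|nk] := leqP k n; last first.
    have neg : n%:Z - k%:Z < 0 by lia.
    by rewrite (vneg _ neg) normr0 mulr_ge0 ?Ege0// divr_ge0// ltW.
  rewrite (_ : n%:Z - k%:Z = (n - k)%N%:Z); last by lia.
  apply: le_trans (hv _) _; rewrite -mulrA; apply: ler_wpM2l => //.
  rewrite ler_pdivlMl//; have := smooth_lag (w := fun n => w n%:Z) r01 ES k (n - k).
  by rewrite subnK.
have hw n : `|w n%:Z| <= 1 * E n.
  by rewrite mul1r; exact: (smooth_ge_norm (w := fun n => w n%:Z) r01 E0 ES).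
have wl := lag w 1 ler01 wneg hw.
have [Cu Cu0 hCu] : exists2 Cu, 0 <= Cu & forall n : nat, `|u n%:Z| <= Cu * E n.
  apply: (bnd E Ege0 Edec (\sum_(i < size A') `|A'`_i| * (1 / rho ^+ i))) => //.
    apply: sumr_ge0 => i _; rewrite mulr_ge0// divr_ge0// exprn_ge0// ltW//.
  move=> n; rewrite -/B filtB_input /filt mulr_suml.
  apply: (le_trans (ler_norm_sum _ _ _)); apply: ler_sum => i _.
  by rewrite normrM -mulrA; apply: ler_wpM2l.
have ul := lag u Cu Cu0 uneg hCu.
pose Cz := \sum_i (\sum_(k < p) `|Q (lshift q k) i| * (1 / rho ^+ k) +
  \sum_(k < q) `|Q (rshift p k) i| * (Cu / rho ^+ k)).
have pos i : 0 <= \sum_(k < p) `|Q (lshift q k) i| * (1 / rho ^+ k) +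
  \sum_(k < q) `|Q (rshift p k) i| * (Cu / rho ^+ k).
  by rewrite addr_ge0// sumr_ge0// => k _; rewrite mulr_ge0// divr_ge0// exprn_ge0// ltW.
exists rho, E, Cz; split => //; first by apply: sumr_ge0 => i _.
move=> i n; apply: (@le_trans _ _ ((\sum_(k < p) `|Q (lshift q k) i| * (1 / rho ^+ k) +
  \sum_(k < q) `|Q (rshift p k) i| * (Cu / rho ^+ k)) * E n)); last first.
  apply: ler_wpM2r; first exact: Ege0.
  by rewrite /Cz (bigD1 i)//= lerDl sumr_ge0.
rewrite zint_coord mulrDl !mulr_suml; apply: le_trans (ler_normD _ _) _; apply: lerD.
  apply: (le_trans (ler_norm_sum _ _ _)); apply: ler_sum => k _.
  by rewrite normrM -mulrA; apply: ler_wpM2l.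
apply: (le_trans (ler_norm_sum _ _ _)); apply: ler_sum => k _.
by rewrite normrM -mulrA; apply: ler_wpM2l.
Qed.

End Coprime.

(** * Adaptedness of the least-squares quantities *)

Section AdaptedRegression.
Context d (T : measurableType d) (R : realType).
Variable gen : nat -> set (set T).
Hypothesis gen_mono : forall n, gen n `<=` gen n.+1.
Variables (w u : int -> T -> R).
Hypothesis w0 : forall k t, k <= 0 -> w k t = 0.
Hypothesis w_adapted : forall k n : nat, (1 <= k)%N -> (k <= n)%N -> adapted gen n (w k%:Z).
Variables (p q : nat) (a b : nat -> R).
Hypothesis hq : (1 <= q)%N.
Hypothesis hb1 : b 1%N != 0.
Hypothesis hgcd : coprimep (polyA p a - 1) (polyB q b).
Hypothesis hdeg : size (polyA p a - 1) = p.+1 \/ size (polyB q b) = q.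
Hypothesis hu : forall t, ideal_input p q a b (w ^~ t) (u ^~ t).
Variable Q : 'M[R]_(p + q, (p + q).-1).
Hypothesis hQ : orthonormal_basis_of_orthogonal Q (theta p q a b).
Variables (thetahat0 : 'cV[R]_(p + q)) (P0 : 'M[R]_(p + q)).
Hypothesis hP0 : sym_posdef P0.

Local Notation adapted := (adapted (R := R) gen).
Local Notation mx_adapted n := (@mx_measurable _ (g_sigma_algebraType (gen n)) R _ _).
Local Notation m := (p + q).-1.

Lemma adapted_ext n f g : f =1 g -> adapted n f -> adapted n g.
Proof. by move=> /funext <-. Qed.

Lemma noise_lag_adapted (k : int) n : k <= n%:Z -> adapted n (w k).
Proof.
case: k => [[|k]|k] kn.
- by apply: (@adapted_ext _ (fun=> 0)) => [t|]; [rewrite w0|exact: measurable_cst].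
- exact: w_adapted.
- by apply: (@adapted_ext _ (fun=> 0)) => [t|]; [rewrite w0|exact: measurable_cst].
Qed.

Lemma filt_adapted (F : {poly R}) (v : int -> T -> R) (k : int) n :
  (forall k, k <= n%:Z -> adapted n (v k)) -> k <= n%:Z ->
  adapted n (fun t => filt F (v ^~ t) k).
Proof.
move=> hv kn; apply: measurable_sum => i; apply: measurable_funM; first exact: measurable_cst.
by apply: hv; lia.
Qed.

(** Induction on time: as b_1 is nonzero, B u = A' w is solved for the current input in terms of
    earlier inputs and of noise up to the present. *)
Lemma input_adapted (k : int) n : k <= n%:Z -> adapted n (u k).
Proof.
have uneg j t : j < 0 -> u j t = 0 by have [h _] := hu t; exact: h.
have [N kN] : exists N : nat, k < N%:Z by exists `|k|.+1; lia.
elim: N k n kN => [|N IH] k n kN kn.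
  by apply: (@adapted_ext _ (fun=> 0)) => [t|]; [rewrite uneg|exact: measurable_cst].
have [kN'|kN'] := ltP k N%:Z; first exact: (IH k n).
have {kN kN'} kE : k = N%:Z by lia.
pose F := \poly_(j < q.-1) b j.+2.
have BE : polyB q b = (b 1%N)%:P + F * 'X.
  apply/polyP => j; rewrite polyB_poly coef_poly coefD coefC coefMX.
  by case: j => [|j]; rewrite ?hq ?addr0//= add0r coef_poly ltn_predRL.
apply: (@adapted_ext _ (fun t => (b 1%N)^-1 *
    (filt (\poly_(i < p) a i.+1) (w ^~ t) k - filt F (u ^~ t) (k - 1)))) => [t|].
  have w0t j : j <= 0 -> w j t = 0 by move=> j0; exact: w0.
  have := filtB_input w0t (hu t) k; rewrite BE filtDl filtC filtMX => <-.
  by rewrite addrK mulKf.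
apply: measurable_funM; first exact: measurable_cst.
apply: measurable_funB; first by apply: filt_adapted => // j; exact: noise_lag_adapted.
apply: measurable_sum => i; apply: measurable_funM; first exact: measurable_cst.
by apply: IH; lia.
Qed.

Definition zof t n : 'cV[R]_m := zint Q (w ^~ t) (u ^~ t) n.

Lemma zof_adapted (k : int) n : k <= n%:Z -> mx_adapted n (zof ^~ k).
Proof.
move=> kn i j; rewrite ord1.
apply: (@adapted_ext _ _ _ (fun t => esym (zint_coord Q (w ^~ t) (u ^~ t) k i))).
apply: measurable_funD; apply: measurable_sum => l;
  (apply: measurable_funM; first exact: measurable_cst).
  by apply: noise_lag_adapted; lia.
by apply: input_adapted; lia.
Qed.

Definition Gof t n : 'M[R]_m := gram (zof t) (G0 a b Q P0) n.
Definition Sof t n : 'cV[R]_m :=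
  S0 a b Q thetahat0 P0 + \sum_(j < n) w j.+1%:Z t *: zof t j%:Z.

Lemma Gof_adapted n : mx_adapted n (Gof ^~ n).
Proof.
apply: (@mx_measurableD _ (g_sigma_algebraType (gen n)) _ _ _ (fun=> G0 a b Q P0)
  (fun t => \sum_(j < n) zof t j%:Z *m (zof t j%:Z)^T)); first exact: mx_measurable_cst.
apply: (@mx_measurable_sum _ (g_sigma_algebraType (gen n)) _ _ _ _ (fun j t => zof t j%:Z *m (zof t j%:Z)^T)) => j jn.
apply: mx_measurableM; last apply: mx_measurable_tr.
  by apply: zof_adapted; rewrite lez_nat ltnW.
by apply: zof_adapted; rewrite lez_nat ltnW.
Qed.

Lemma Sof_adapted n : mx_adapted n (Sof ^~ n).
Proof.
apply: (@mx_measurableD _ (g_sigma_algebraType (gen n)) _ _ _ (fun=> S0 a b Q thetahat0 P0)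
  (fun t => \sum_(j < n) w j.+1%:Z t *: zof t j%:Z)); first exact: mx_measurable_cst.
apply: (@mx_measurable_sum _ (g_sigma_algebraType (gen n)) _ _ _ _ (fun j t => w j.+1%:Z t *: zof t j%:Z)) => j jn.
apply: mx_measurableZ; first exact: noise_lag_adapted.
by apply: zof_adapted; rewrite lez_nat ltnW.
Qed.

Lemma Gof_sym t n : (Gof t n)^T = Gof t n.
Proof.
rewrite /Gof /gram linearD/= G0_sym//; congr (_ + _).
by rewrite linear_sum/=; apply: eq_bigr => j _; rewrite trmx_mul trmxK.
Qed.

(** The initial matrix alone gives this bound, at every sample point; it makes the determinant
    positive, as the measurability of the inverse requires. *)
Lemma Gof_low : exists2 g0 : R, 0 < g0 & forall t n x, g0 * nsq x <= dot x (Gof t n *m x).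
Proof.
have [g0 g00 h] := G0_low hQ hP0; exists g0 => // t n x.
by rewrite gram_dot; apply: le_trans (h x) _; rewrite lerDl sumr_ge0// => j _; exact: sqr_ge0.
Qed.

Lemma det_Gof_gt0 t n : 0 < \det (Gof t n).
Proof.
have [g0 g00 h] := Gof_low; have [C C0 hC] := qf_upper_bound (Gof t n).
have [h1 _] := det_bounds (Gof_sym t n) g00 (h t n) hC.
by apply: lt_le_trans h1; rewrite exprn_gt0.
Qed.

Lemma Gof_inv_adapted n : mx_adapted n (fun t => invmx (Gof t n)).
Proof. by apply: mx_measurable_inv => [t|]; [exact: det_Gof_gt0|exact: Gof_adapted]. Qed.

Definition zreg_of t (n : nat) := zof t n%:Z.

Lemma zreg_adapted n : mx_adapted n (zreg_of ^~ n).
Proof. exact: zof_adapted. Qed.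

Lemma lev_adapted n : adapted n (fun t => lev (zreg_of t) (Gof t) n).
Proof.
apply: measurable_dot; first exact: zreg_adapted.
by apply: mx_measurableM; [exact: Gof_inv_adapted|exact: zreg_adapted].
Qed.

Lemma pred_adapted n : adapted n (fun t => lspred (zreg_of t) (Sof t) (Gof t) n).
Proof.
apply: measurable_dot; first exact: Sof_adapted.
by apply: mx_measurableM; [exact: Gof_inv_adapted|exact: zreg_adapted].
Qed.

Lemma bet_adapted n : mx_adapted n (fun t => bet (Sof t) (Gof t) n).
Proof. by apply: mx_measurableM; [exact: Gof_inv_adapted|exact: Sof_adapted]. Qed.

Lemma lev_of_ge0 t n : 0 <= lev (zreg_of t) (Gof t) n.
Proof. by have [g0 g00 h] := Gof_low; exact: (dot_invmx_ge0 (Gof_sym t n) g00 (h t n)). Qed.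

Lemma lev_inv_adapted n : adapted n (fun t => (1 + lev (zreg_of t) (Gof t) n)^-1).
Proof.
apply: measurable_inv => [|t]; last by rewrite addr_ge0// lev_of_ge0.
by apply: measurable_funD; [exact: measurable_cst|exact: lev_adapted].
Qed.

Lemma rlev_adapted n : adapted n (fun t => rlev (zreg_of t) (Gof t) n).
Proof. by apply: measurable_funM; [exact: lev_adapted|exact: lev_inv_adapted]. Qed.

Lemma wpred_adapted n : adapted n (fun t => wpred (zreg_of t) (Sof t) (Gof t) n).
Proof. by apply: measurable_funM; [exact: pred_adapted|exact: lev_inv_adapted]. Qed.

Lemma rlev_of_ge0 t n : 0 <= rlev (zreg_of t) (Gof t) n.
Proof. by rewrite divr_ge0 ?addr_ge0// lev_of_ge0. Qed.

Lemma rlev_of_le1 t n : rlev (zreg_of t) (Gof t) n <= 1.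
Proof.
have h := lev_of_ge0 t n; rewrite ler_pdivrMr ?ltr_pwDl//.
by rewrite mul1r lerDr.
Qed.

Lemma wlev_of_ge1 t n : 1 <= wlev (zreg_of t) (Gof t) n.
Proof. by rewrite lerDl sumr_ge0// => j _; exact: rlev_of_ge0. Qed.

Lemma wlev_adapted n : adapted n (fun t => wlev (zreg_of t) (Gof t) n.+1).
Proof.
apply: measurable_funD; first exact: measurable_cst.
apply: measurable_sum => j; apply: (adapted_leq gen_mono (n := j)); first by rewrite -ltnS.
exact: rlev_adapted.
Qed.

Lemma wlev_inv_adapted n : adapted n (fun t => (wlev (zreg_of t) (Gof t) n.+1)^-1).
Proof.
apply: measurable_inv => [|t]; first exact: wlev_adapted.
exact: le_trans ler01 (wlev_of_ge1 _ _).
Qed.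

Lemma omega_adapted n : adapted n (fun t => omega (zreg_of t) (Gof t) n).
Proof.
apply: measurable_inv => [|t]; last exact: sqr_ge0.
by apply: measurable_funM; exact: wlev_adapted.
Qed.

Lemma fluct_adapted n : adapted n (fun t => fluct (zreg_of t) (Gof t) n).
Proof.
apply: measurable_funM; last exact: measurable_cst.
apply: measurable_funM; first exact: omega_adapted.
by apply: measurable_dot; exact: zreg_adapted.
Qed.

Lemma drift_adapted n : adapted n (fun t => drift (zreg_of t) (Sof t) (Gof t) n).
Proof.
apply: measurable_funM; last exact: measurable_cst.
apply: measurable_funM; first exact: omega_adapted.
by apply: measurable_dot; [exact: Sof_adapted|exact: zreg_adapted].
Qed.

Lemma cross_adapted (y : nat -> R) (c : 'cV[R]_m) n :
  adapted n (fun t => y n * dot (bet (Sof t) (Gof t) n) c / wlev (zreg_of t) (Gof t) n.+1).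
Proof.
apply: measurable_funM; last exact: wlev_inv_adapted.
apply: measurable_funM; first exact: measurable_cst.
by apply: measurable_dot; [exact: bet_adapted|exact: mx_measurable_cst].
Qed.

End AdaptedRegression.

(** * The deterministic argument on one sample path *)

Section Path.
Variable R : realType.
Variables (p q : nat) (a b : nat -> R).
Hypothesis hq : (1 <= q)%N.
Hypothesis hd : (2 <= p + q)%N.
Hypothesis hb1 : b 1%N != 0.
Hypothesis hB : forall x : R[i], `|x| <= 1 -> ~~ root (map_poly (real_complex R) (polyB q b)) x.
Hypothesis hgcd : coprimep (polyA p a - 1) (polyB q b).
Hypothesis hdeg : size (polyA p a - 1) = p.+1 \/ size (polyB q b) = q.
Variable Q : 'M[R]_(p + q, (p + q).-1).
Hypothesis hQ : orthonormal_basis_of_orthogonal Q (theta p q a b).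
Variables (thetahat0 : 'cV[R]_(p + q)) (P0 : 'M[R]_(p + q)).
Hypothesis hP0 : sym_posdef P0.
Variables w u : int -> R.
Hypothesis w0 : forall k, k <= 0 -> w k = 0.
Hypothesis hu : ideal_input p q a b w u.
Variable sigma2 : R.
Hypothesis sigma2_gt0 : 0 < sigma2.
Variables (y yt : nat -> R) (My Cy : R).
Hypothesis ytM : forall j, `|yt j| <= My.
Hypothesis ytB : forall j, \sum_(i < size (polyB q b)) (polyB q b)`_i * yt (j + i)%N = y j.
Hypothesis Cy0 : 0 <= Cy.
Hypothesis yt_sq : forall N n, (N <= n)%N ->
  \sum_(N <= l < n) yt l ^+ 2 <= Cy * (1 + \sum_(N <= l < n) y l ^+ 2).

Local Notation m := (p + q).-1.
Local Notation z := (zint Q w u).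
Local Notation zr := (fun n : nat => zint Q w u n%:Z).
Let G n := gram z (G0 a b Q P0) n.
Let S n := S0 a b Q thetahat0 P0 + \sum_(j < n) w j.+1%:Z *: z j%:Z.
Local Notation W := (fun n : nat => w n.+1%:Z).
Let colC (k : nat) : 'cV[R]_m := \col_i (regfilt a b Q i)`_k.
Let crossg k j := yt (j + k.+1)%N * dot (bet S G j) (colC k) / wlev zr G j.+1.

Hypothesis w_sq : negl (fun n => \sum_(j < n) (w j.+1%:Z ^+ 2 - sigma2)) (fun n => 1 + n%:R).
Hypothesis w_corr : forall i : nat, negl (fun n => \sum_(j < n) w (j%:Z - i%:Z) * w j.+1%:Z)
  (fun n => 1 + \sum_(j < n) w (j%:Z - i%:Z) ^+ 2).
Hypothesis rlev_noise : negl (fun n => \sum_(j < n) rlev zr G j * (W j ^+ 2 - sigma2)) (wlev zr G).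
Hypothesis wpred_noise : negl (fun n => \sum_(j < n) wpred zr S G j * W j)
  (fun n => 1 + \sum_(j < n) wpred zr S G j ^+ 2).
Hypothesis fluct_noise : (exists M, forall n, \sum_(j < n) `|fluct zr G j| <= M) ->
  cvgn (fun n => \sum_(j < n) fluct zr G j * (W j ^+ 2 - sigma2)).
Hypothesis drift_noise : (exists M, forall n, \sum_(j < n) drift zr S G j ^+ 2 <= M) ->
  cvgn (fun n => \sum_(j < n) drift zr S G j * W j).
Hypothesis cross_noise : forall k, (exists M, forall n, \sum_(j < n) crossg k j ^+ 2 <= M) ->
  cvgn (fun n => \sum_(j < n) crossg k j * W j).

Let f n := ls_pred a b Q thetahat0 P0 w u n.

Lemma ls_pred_path n : f n = lspred zr S G n.
Proof.
rewrite /f /ls_pred.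
have -> : Gw a b Q P0 w u n = G n by rewrite /Gw big_mkord.
have -> : Sw a b Q thetahat0 P0 w u n = S n by rewrite /Sw big_mkord.
by rewrite -mulmxA dotE.
Qed.

Let GS n : G n.+1 = G n + zr n *m (zr n)^T. Proof. exact: gramS. Qed.

Let SS n : S n.+1 = S n + W n *: zr n.
Proof. by rewrite /S big_ord_recr/= addrA. Qed.

Let Gsym n : (G n)^T = G n.
Proof.
rewrite /G /gram linearD/= G0_sym//; congr (_ + _).
by rewrite linear_sum/=; apply: eq_bigr => j _; rewrite trmx_mul trmxK.
Qed.

Let m0 : (0 < m)%N. Proof. by move: hd; case: (p + q)%N => [|[]]. Qed.

Lemma path_asymptotics :
  negl (fun n => \sum_(j < n) f j ^+ 2 - m%:R * sigma2 * lnS n) lnS /\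
  forall e, 0 < e -> exists C, forall N n, (N <= n)%N ->
    `|\sum_(N <= j < n) y j * f j| <= C + e * lnS n + e * \sum_(N <= j < n) y j ^+ 2.
Proof.
have zneg n : n < 0 -> z n = 0 by exact: (zint_neg Q w0 hu).
have zB i n : filt (polyB q b) (fun k => z k i 0) n = filt (regfilt a b Q i) w n.
  exact: (zint_filt Q w0 hu).
have [g0 g00 G0low] := G0_low hQ hP0.
have [cl cl0 Glow] := gram_low sigma2_gt0 w0 w_sq w_corr zneg zB
  (size_regfilt a b Q) (regfilt_free hq hb1 hgcd hdeg hQ) g00 G0low.
have [rho [E [Cz [rho01 E0 ES Cz0 zE]]]] := input_bound hq hb1 Q w0 hu hB.
have [cu cu0 Gup] := gram_up sigma2_gt0 w0 w_sq (G0 a b Q P0) rho01 E0 ES Cz0 zE.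
have zE2 n : nsq (zr n) <= m%:R * Cz ^+ 2 * E n ^+ 2 by exact: (nsq_z_le rho01 E0 ES Cz0 zE).
have E2negl := E_sq_negl w0 w_sq rho01 ES.
have E20 n : 0 <= E n ^+ 2 by exact: sqr_ge0.
have h1 := pred_sq_negl m0 sigma2_gt0 GS SS Gsym cl0 cu0 Glow Gup E20 zE2 E2negl
  rlev_noise wpred_noise fluct_noise drift_noise.
have [Mb hMb] := bet_sum_le m0 sigma2_gt0 GS SS Gsym cl0 cu0 Glow Gup E20 zE2 E2negl
  rlev_noise wpred_noise fluct_noise drift_noise.
have [Cx Cx0 xsum] := bet_step_sum m0 sigma2_gt0 GS SS Gsym cl0 cu0 Glow Gup E20 zE2 E2negl
  rlev_noise wpred_noise fluct_noise drift_noise.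
have [Cw Cw0 wle] := wlev_le GS Gsym cl0 cu0 Glow Gup.
have f1 : negl (fun n => \sum_(j < n) f j ^+ 2 - m%:R * sigma2 * lnS n) lnS.
  by apply: negl_ext h1 => n; congr (_ - _); apply: eq_bigr => j _; rewrite ls_pred_path.
split=> //.
(* f_n^2 is one increment of a sum equal to K log n + o(log n), hence o(log n), and |f_n| <= 1 +
   f_n^2. *)
have fnegl : negl f lnS.
  move=> e e0; have e2 : 0 < e / 2 by rewrite divr_gt0.
  have [C hC] := f1 _ e2.
  exists (1 + 2 * C + e / 2 + m%:R * sigma2) => n.
  have := hC n.+1; rewrite big_ord_recr/= ler_norml => /andP[_ h].
  have := hC n; rewrite ler_norml => /andP[h' _].
  have ms : 0 <= m%:R * sigma2 by rewrite mulr_ge0// ltW.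
  have l1 := lnS_step1 R n.
  have h2 : e / 2 * lnS n.+1 <= e / 2 * (1 + lnS n) by rewrite ler_pM2l.
  have h3 : m%:R * sigma2 * lnS n.+1 <= m%:R * sigma2 * (1 + lnS n) by exact: ler_wpM2l.
  have h4 : `|f n| <= 1 + f n ^+ 2.
    have := sqr_ge0 (`|f n| - 1); rewrite sqrrB real_normK ?num_real// expr1n mulr1.
    have := normr_ge0 (f n); set F2 := f n ^+ 2; set F := `|f n|; rewrite -mulr_natr; lra.
  move: h h' h2 h3 h4; set F := `|f n|; set F2 := f n ^+ 2; set L := lnS n; set L1 := lnS n.+1.
  set A := \sum_(i < n) _; set M := m%:R * sigma2; lra.
(* Divided by [wlev], which is O(log n), the weights are square summable by [bet_sum_le];
   Kronecker's lemma gives o(log n). *)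
have mart k : (k < p + q)%N ->
    negl (fun n => \sum_(j < n) yt (j + k.+1)%N * dot (bet S G j) (colC k) * w j.+1%:Z) lnS.
  move=> _; have rl0 n : 0 <= rlev zr G n by exact: (rlev_ge0 _ Gsym cl0 Glow).
  have wl1 n : 1 <= wlev zr G n by rewrite lerDl sumr_ge0.
  have wl0 n : 0 < wlev zr G n by exact: lt_le_trans ltr01 (wl1 n).
  have wlS n : wlev zr G n <= wlev zr G n.+1.
    by rewrite /wlev [in leRHS]big_ord_recr/= addrA lerDl.
  have cv : cvgn (fun n => \sum_(j < n) crossg k j * W j).
    apply: cross_noise; exists (My ^+ 2 * nsq (colC k) * Mb) => n.
    have My0 : 0 <= My by exact: le_trans (normr_ge0 _) (ytM 0).
    have c0 : 0 <= My ^+ 2 * nsq (colC k) by rewrite mulr_ge0 ?sqr_ge0 ?nsq_ge0.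
    apply: le_trans (_ : My ^+ 2 * nsq (colC k) * \sum_(j < n) omega zr G j * nsq (bet S G j) <= _);
      last exact: ler_wpM2l.
    rewrite mulr_sumr; apply: ler_sum => j _; rewrite /crossg expr_div_n exprMn.
    rewrite [leRHS]mulrCA [leRHS]mulrC; apply: ler_wpM2r.
      by rewrite invr_ge0 sqr_ge0.
    rewrite -[leRHS]mulrA; apply: ler_pM; rewrite ?sqr_ge0//.
      by rewrite -[leLHS]real_normK ?num_real// lerXn2r ?nnegrE.
    by rewrite mulrC; exact: cauchy_schwarz_dot.
  have ng := @kronecker R (fun j => yt (j + k.+1)%N * dot (bet S G j) (colC k) * w j.+1%:Z)
    (wlev zr G) wl0 wlS.
  refine (@negl_weight R _ (wlev zr G) lnS Cw Cw Cw0 _ _ _) => [n|n|].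
  - by have := wle n; rewrite mulrDr mulr1.
  - exact: lnS_ge0.
  apply: ng; rewrite (_ : (fun n => _) = fun n => \sum_(j < n) crossg k j * W j)//.
  by apply/funext => n; apply: eq_bigr => j _; rewrite [RHS]mulrAC.
have Cb0 : 0 <= 2 / cl by rewrite divr_ge0// ltW.
have bstep j : nsq (bet S G j.+1 - bet S G j) <=
    2 / cl / j.+1%:R * (rlev zr G j * W j ^+ 2 + lspred zr S G j ^+ 2).
  by have := bet_step GS SS Gsym cl0 Glow j; rewrite invfM mulrA.
have fE n : f n = dot (bet S G n) (z n%:Z).
  by rewrite ls_pred_path dotC (dot_S_beta (Gsym n)).
have CC0 : 0 <= m%:R * Cz ^+ 2 by rewrite mulr_ge0// sqr_ge0.
apply: (cross_term w0 zneg zB (size_regfilt a b Q) rho01 E0 ES CC0 zE2 E2negl fE fnegl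
  _ Cx0 xsum Cb0 bstep ytM ytB Cy0 yt_sq mart).
move=> n; rewrite addr_ge0 ?sqr_ge0// mulr_ge0 ?sqr_ge0//.
exact: (rlev_ge0 _ Gsym cl0 Glow).
Qed.
End Path.

(** * Conclusions *)

Section Conclusion.
Variable R : realType.
Variables (f ystar : nat -> R) (K : R).
Hypothesis K0 : 0 < K.
Hypothesis f_sq : negl (fun n => \sum_(j < n) f j ^+ 2 - K * lnS n) lnS.
Hypothesis cross : forall e, 0 < e -> exists C, forall N n, (N <= n)%N ->
  `|\sum_(N <= j < n) ystar j.+1 * f j| <=
    C + e * lnS n + e * \sum_(N <= j < n) ystar j.+1 ^+ 2.

Lemma lnS_ln n : (0 < n)%N -> ln (n%:R : R) <= lnS n /\ lnS n <= 1 + ln (n%:R : R).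
Proof.
case: n => // n _; split; last exact: lnS_step1.
exact: (lnS_homo R (leqnSn n)).
Qed.

Lemma ln_unbounded (C : R) : exists N, forall n, (N <= n)%N ->
  [/\ (0 < n)%N, 0 <= ln (n%:R : R) & C <= ln (n%:R : R)].
Proof.
have [N hN] := lnS_unbounded C; exists N.+1 => -[//|n] Nn; split=> //.
  exact: lnS_ge0.
exact: hN.
Qed.

(** Passing from [lnS n] to ln n costs at most 1, and dropping the term j = 0 costs a constant. *)
Lemma sum_sq_equiv : (fun n : nat => \sum_(1 <= j < n) f j ^+ 2) ~_\oo
  (fun n : nat => K * ln (n%:R : R)).
Proof.
apply/eqaddoP => e e0; have eK : 0 < e * K / 2 by rewrite divr_gt0// mulr_gt0.
have [C hC] := f_sq eK.
have [N hN] := ln_unbounded ((`|C| + e * K / 2 + f 0 ^+ 2 + K) / (e * K / 2)).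
exists N => // n /= /hN[n0 l0]; rewrite ler_pdivrMr// => h.
have [l1 l2] := lnS_ln n0.
rewrite !fctE (window_sum _ n0) big_ord1.
rewrite [X in _ <= _ * X]ger0_norm ?mulr_ge0// ?(ltW K0)//.
have := hC n; rewrite !ler_norml => /andP[h1 h2].
have := ler_norm C; have f0 := sqr_ge0 (f 0).
have h3 : K * ln n%:R <= K * lnS n by rewrite ler_pM2l.
have h4 : K * lnS n <= K * (1 + ln n%:R) by rewrite ler_pM2l.
have h5 : e * K / 2 * lnS n <= e * K / 2 * (1 + ln n%:R) by rewrite ler_pM2l.
have h6 : e * (K * ln n%:R) = e * K / 2 * ln n%:R + e * K / 2 * ln n%:R by field.
rewrite h6; rewrite ![_ * (1 + _)]mulrDr !mulr1 in h4 h5.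
move: h h1 h2 h3 h4 h5 f0 K0; rewrite [ln _ * _]mulrC.
set a := e * K / 2; set x := a * ln _; set x1 := a * lnS n; set x2 := K * ln _.
set x3 := K * lnS n; set F := \sum_(i < n) _; set F0 := f 0 ^+ 2.
move=> *; apply/andP; split; lra.
Qed.

(** The ln 3 comes from ceil x + 1 <= 3x for x = n^alpha >= 1. *)
Lemma ceil_pow_bounds (alpha : R) n : 0 < alpha < 1 -> (0 < n)%N ->
  (ceil_pow alpha n <= n)%N /\ lnS (ceil_pow alpha n) <= ln 3 + alpha * ln (n%:R : R).
Proof.
move=> /andP[a0 a1] n0; rewrite /ceil_pow; set x := _ `^ alpha.
have n1 : 1 <= n%:R :> R by rewrite ler1n.
have x1 : 1 <= x.
  have E : (1 : R) `^ alpha = 1 by rewrite powR1.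
  by rewrite -[leLHS]E; apply: ge0_ler_powR; rewrite ?nnegrE//; exact: ltW.
have xn : x <= n%:R.
  by rewrite -[leRHS]powRr1 ?ler0n//; apply: ler_powR => //; exact: ltW.
have c0 : 0 <= Num.ceil x by rewrite -(ler_int R) (le_trans _ (ceil_ge _))//; exact: le_trans x1.
have cn : Num.ceil x <= n%:Z by rewrite ceil_le_int.
split; first by move: c0 cn; lia.
have cx : (`|Num.ceil x|%N)%:R = (Num.ceil x)%:~R :> R.
  by rewrite -{2}(gez0_abs c0).
rewrite /lnS -ln_powR -lnM ?posrE ?(lt_le_trans ltr01 x1)// ler_ln ?posrE ?mulr_gt0 ?(lt_le_trans ltr01 x1)//.
rewrite -natr1 cx; have := ceilB1_lt x; rewrite rmorphB/= -/x; lra.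
Qed.

Lemma tracking_lower_bound (alpha : R) : 0 < alpha < 1 ->
  \forall n \near \oo,
    \sum_(ceil_pow alpha n <= j < n) (ystar j.+1 - f j) ^+ 2 >=
      2^-1 * (\sum_(ceil_pow alpha n <= j < n) ystar j.+1 ^+ 2)
      + K * (1 - alpha) / 4 * ln (n%:R : R).
Proof.
move=> ha; have /andP[a0 a1] := ha.
pose k := K * (1 - alpha); have k0 : 0 < k by rewrite mulr_gt0// subr_gt0.
(* With e <= 1/4 the doubled cross term takes at most half of the energy of y. The logarithmic
   errors cost at most 4e <= k/4 and the constants k/2, so k/4 is left of the k log n contributed by
   f^2: this is c_alpha. *)
pose e := Num.min 4^-1 (k / 16).
have e0 : 0 < e by rewrite lt_min invr_gt0 divr_gt0// ltr0n.
have e4 : e <= 4^-1 by rewrite ge_min lexx.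
have ek : e <= k / 16 by rewrite ge_min lexx orbT.
have [C1 h1] := f_sq e0; have [C2 h2] := cross e0.
have [N hN] := ln_unbounded ((2 * `|C1| + 2 * `|C2| + 3 * e + (e + K) * ln 3) / (k / 2)).
exists N => // n /= /hN[n0 l0]; rewrite ler_pdivrMr ?divr_gt0// => h.
have [Mn lM] := ceil_pow_bounds ha n0.
move: (ceil_pow alpha n) Mn lM => M Mn lM.
have [l1 l2] := lnS_ln n0.
have E : \sum_(M <= j < n) (ystar j.+1 - f j) ^+ 2 =
    \sum_(M <= j < n) ystar j.+1 ^+ 2 - 2 * (\sum_(M <= j < n) ystar j.+1 * f j)
    + (\sum_(j < n) f j ^+ 2 - \sum_(j < M) f j ^+ 2).
  rewrite -(window_sum (fun j => f j ^+ 2) Mn) mulr_sumr -sumrB -big_split/=; apply: eq_bigr => j _.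
  by rewrite sqrrB mulr_natl.
have Y0 : 0 <= \sum_(M <= j < n) ystar j.+1 ^+ 2 by apply: sumr_ge0 => j _; exact: sqr_ge0.
have := h2 M n Mn; have := h1 n; have := h1 M.
rewrite E !ler_norml => /andP[_ hM] /andP[hn _] /andP[_ hc].
move: hM hn hc h Y0 l1 l2 lM l0 (ler_norm C1) (ler_norm C2).
set A := \sum_(j < M) _; set B := \sum_(j < n) _; set D := \sum_(M <= j < n) _ * _.
set Y := \sum_(M <= j < n) _; set LM := lnS M; set L := lnS n; set l := ln n%:R.
move=> hM hn hc h Y0 l1 l2 lM l0 hC1 hC2.
have q1 : e * Y <= 4^-1 * Y by exact: ler_wpM2r.
have q2 : e * L <= e * (1 + l) by rewrite ler_pM2l.
have q3 : e * LM <= e * (ln 3 + alpha * l) by rewrite ler_pM2l.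
have q4 : K * l <= K * L by rewrite ler_pM2l.
have q5 : K * LM <= K * (ln 3 + alpha * l) by rewrite ler_pM2l.
have q6 : alpha * l <= l by rewrite ler_piMl// ltW.
have q7 : e * (alpha * l) <= e * l by rewrite ler_pM2l.
have q8 : e * l <= k / 16 * l by exact: ler_wpM2r.
rewrite -/k; have kE : k * l = K * l - K * (alpha * l) by rewrite /k; ring.
rewrite !mulrDr !mulr1 in q2 q3 q5.
rewrite (mulrDl e K) in h.
rewrite (_ : l * (k / 2) = k * l / 2) in h; last by ring.
rewrite (_ : k / 16 * l = k * l / 16) in q8; last by ring.
rewrite (_ : k / 4 * l = k * l / 4); last by ring.
move: q1 q2 q3 q4 q5 q7 q8 kE h hM hn hc.
set kl := k * l; set Kl := K * l; set eY := e * Y; set eL := e * L; set el := e * l.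
set eLM := e * LM; set e3 := e * ln 3; set eal := e * (alpha * l); set KL := K * L.
set KLM := K * LM; set K3 := K * ln 3; set Kal := K * (alpha * l).
move=> *; lra.
Qed.

(** On windows starting at 0 the energy bound c log n turns the error into e' (1 + c) log n. A
    strictly increasing k satisfies m <= k m, so k m tends to infinity. *)
Lemma cross_littleo (k : nat -> nat) : {homo k : i j / (i < j)%N} ->
  (fun m : nat => energy ystar (k m)) =O_\oo (fun m : nat => ln ((k m)%:R : R)) ->
  (fun m : nat => \sum_(0 <= j < k m) ystar j.+1 * f j) =o_\oo
    (fun m : nat => ln ((k m)%:R : R)).
Proof.
move=> kh /eqO_exP[c c0 [N1 _ hc]]; apply/eqoP => e e0.
have c1 : 0 < 2 * (1 + c) by lra.
pose e' := e / (2 * (1 + c)); have e'0 : 0 < e' by rewrite divr_gt0.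
have [C h2] := cross e'0.
have [N2 hN] := ln_unbounded ((`|C| + e') / (e / 2)).
have km m : (m <= k m)%N.
  by elim: m => // m IH; apply: leq_ltn_trans IH _; exact: kh.
exists (maxn N1 N2) => // m /=; rewrite geq_max => /andP[m1 m2].
have [n0 l0] := hN _ (leq_trans m2 (km m)); rewrite ler_pdivrMr ?divr_gt0// => h.
have [l1 l2] := lnS_ln n0.
have := hc m m1; rewrite /= [X in _ <= _ * X]ger0_norm// [X in X <= _]ger0_norm; last first.
  by apply: sumr_ge0 => j _; exact: sqr_ge0.
move=> hE; rewrite (ger0_norm l0).
apply: le_trans (h2 0 _ (leq0n _)) _.
have q1 : e' * energy ystar (k m) <= e' * (c * ln (k m)%:R) by rewrite ler_pM2l.
have q2 : e' * lnS (k m) <= e' * (1 + ln (k m)%:R) by rewrite ler_pM2l.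
have E : e' * (1 + c) = e / 2 by rewrite /e'; field; rewrite gt_eqF//; lra.
have E2 : e' * ln (k m)%:R + e' * (c * ln (k m)%:R) = e / 2 * ln (k m)%:R.
  by rewrite -E; ring.
have := ler_norm C; rewrite -/(energy ystar (k m)).
rewrite mulrDr mulr1 in q2.
move: h q1 q2 E2; rewrite [ln _ * _]mulrC -!/(_ / 2).
set l := ln _; move: (e' * energy _ _) (e' * lnS _) (e' * l) (e' * (c * l)) => x1 x2 x3 x4.
move=> *; lra.
Qed.

End Conclusion.

Theorem lemma4p2
  (R : realType) (disp : measure_display) (T : measurableType disp)
  (P : probability T R)
  (p q : nat) (hq : (1 <= q)%N) (hd : (2 <= p + q)%N)
  (a b : nat -> R) (hb1 : b 1%N != 0)
  (hB : forall x : R[i], `|x| <= 1 ->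
     ~~ root (map_poly (real_complex R) (polyB q b)) x)
  (hgcd : coprimep (polyA p a - 1) (polyB q b))
  (hdeg : size (polyA p a - 1) = p.+1 \/ size (polyB q b) = q)
  (Q : 'M[R]_(p + q, (p + q).-1))
  (hQ : orthonormal_basis_of_orthogonal Q (theta p q a b))
  (thetahat0 : 'cV[R]_(p + q)) (P0 : 'M[R]_(p + q)) (hP0 : sym_posdef P0)
  (ystar : nat -> R)
  (hystar : exists M : R, forall n : nat, (1 <= n)%N -> `|ystar n| <= M)
  (w : int -> {RV P >-> R})
  (hw0 : forall n : int, n <= 0 -> forall t : T, w n t = 0)
  (u : int -> T -> R)
  (hu : forall t : T, ideal_input p q a b (fun n => w n t) (fun n => u n t))
  (sigma2 : R) (hsigma2 : 0 < sigma2)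
  (nu : R) (hnu : 2 < nu)
  (hmean : forall n : nat,
     cond_exp P (noise_filtration w n) (w (n.+1)%:Z) (fun=> 0))
  (hvar : forall n : nat,
     cond_exp P (noise_filtration w n)
       (fun t => w (n.+1)%:Z t ^+ 2) (fun=> sigma2))
  (V : nat -> T -> \bar R)
  (hV : forall n : nat,
     cond_exp_ge0 P (noise_filtration w n)
       (fun t => `|w (n.+1)%:Z t| `^ nu) (V n))
  (hmom : {ae P, forall t, (ereal_sup (range (fun n : nat => V n t)) < +oo)%E})
  (alpha : R) (halpha0 : 0 < alpha) (halpha1 : alpha < 1) :
  let f (n : nat) (t : T) : R :=
    ls_pred a b Q thetahat0 P0 (fun k => w k t) (fun k => u k t) n in
  let c : R := ((p + q).-1)%:R * sigma2 * (1 - alpha) / 4 in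
  {ae P, forall t : T,
    [/\ (fun n : nat => \sum_(1 <= j < n) f j t ^+ 2) ~_\oo
          (fun n : nat => ((p + q).-1)%:R * sigma2 * ln (n%:R : R)),
        \forall n \near \oo,
          \sum_(ceil_pow alpha n <= j < n) (ystar j.+1 - f j t) ^+ 2 >=
          2^-1 * (\sum_(ceil_pow alpha n <= j < n) ystar j.+1 ^+ 2)
            + c * ln (n%:R : R) &
        forall k : nat -> nat, {homo k : i j / (i < j)%N} ->
          (fun m : nat => energy ystar (k m)) =O_\oo
            (fun m : nat => ln ((k m)%:R : R)) ->
          (fun m : nat => \sum_(0 <= j < k m) ystar j.+1 * f j t) =o_\oo
            (fun m : nat => ln ((k m)%:R : R))]}.
Proof.
move=> f c.
have [M yM] : exists M : R, forall j, `|ystar j.+1| <= M.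
  by have [M hM] := hystar; exists M => j; exact: hM.
(* [yt] is deterministic, so it may enter the predictable weights of the martingale laws below. *)
have [yt [[My ytM] ytB [Cy Cy0 yt_sq]]] := backward_filter hB yM.
pose wf (k : int) (t : T) : R := w k t.
have gmono := @noise_gen_mono _ _ _ P w.
have wf0 k t : k <= 0 -> wf k t = 0 by move=> k0; exact: hw0.
have wk : forall k n : nat, (1 <= k)%N -> (k <= n)%N -> adapted (noise_gen w) n (wf k%:Z).
  by move=> k n k1 kn; exact: noise_adapted.
pose col k : 'cV[R]_(p + q).-1 := \col_i (regfilt a b Q i)`_k.
have F1 := noise_sq_transform_negl hsigma2 hvar hnu hV hmom
  (g := fun _ _ => 1) (fun n => @measurable_cst _ _ (g_sigma_algebraType (noise_gen w n)) R setT 1).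
have {}F1 := F1 (fun _ _ => introT andP (conj ler01 (lexx 1))).
have F2 := ae_foralln (fun i : nat => noise_transform_negl hsigma2 hmean hvar
  (g := fun n => wf (n%:Z - i%:Z))
  (fun n => noise_lag_adapted wf0 wk (k := n%:Z - i%:Z) (n := n) ltac:(lia))).
have F3 := noise_sq_transform_negl hsigma2 hvar hnu hV hmom
  (rlev_adapted wf0 wk hq hb1 hgcd hdeg hu hQ hP0)
  (fun n t => introT andP (conj (rlev_of_ge0 wf u hQ hP0 t n) (rlev_of_le1 wf u hQ hP0 t n))).
have F4 := noise_transform_negl hsigma2 hmean hvar
  (wpred_adapted wf0 wk hq hb1 hgcd hdeg hu hQ thetahat0 hP0).
have F5 := noise_sq_transform_cvg1 hsigma2 hvar hnu hV hmom
  (fluct_adapted gmono wf0 wk hq hb1 hgcd hdeg hu hQ hP0).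
have F6 := noise_transform_cvg hsigma2 hmean hvar
  (drift_adapted gmono wf0 wk hq hb1 hgcd hdeg hu hQ thetahat0 hP0).
have F7 := ae_foralln (fun k : nat => noise_transform_cvg hsigma2 hmean hvar
  (cross_adapted gmono wf0 wk hq hb1 hgcd hdeg hu hQ thetahat0 hP0
    (fun j => yt (j + k.+1)%N) (col k))).
apply: filter_app F7; apply: filter_app F6; apply: filter_app F5; apply: filter_app F4.
apply: filter_app F3; apply: filter_app F2; apply: filter_app F1.
(* From here on the path is fixed; the null set was chosen before any subsequence. *)
apply: filterE => t f1 f2 f3 f4 f5 f6 f7.
have w_sq : negl (fun n => \sum_(j < n) (w j.+1%:Z t ^+ 2 - sigma2)) (fun n => 1 + n%:R).
  move=> e e0; have [C hC] := f1 e e0; exists C => n; have := hC n.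
  rewrite sumr_const card_ord; congr (`|_| <= _).
  by apply: eq_bigr => j _; rewrite mul1r.
have [h1 h2] := path_asymptotics hq hd hb1 hB hgcd hdeg hQ hP0
  (fun k k0 => hw0 k k0 t) (hu t) hsigma2 ytM ytB Cy0 yt_sq w_sq f2 f3 f4 f5 f6 f7.
have K0 : 0 < (p + q).-1%:R * sigma2.
  by rewrite mulr_gt0// ltr0n; move: hd; case: (p + q)%N => [|[]].
split.
- exact: sum_sq_equiv K0 h1.
- apply: (tracking_lower_bound K0 h1 h2); exact/andP.
- exact: (cross_littleo h2).
Qed.
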